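(* A virtual double functor $P:\mathbb{D}\to\mathbb{E}$ between small virtual double categories is exponentiable in $\mathbf{Vdc}$ (i.e. the pullback functor $-\times_{\mathbb{E}}\mathbb{D}:\mathbf{Vdc}/\mathbb{E}\to\mathbf{Vdc}$ admits a right adjoint) if and only if $P$ lifts decompositions essentially uniquely, meaning: (D1) for every tight arrow $a$ of $\mathbb{D}$, every $n\ge2$ and every factorization $P(a)=b_n\circ\cdots\circ b_1$ into $n$ tight arrows of $\mathbb{E}$, the category of factorizations of $a$ into $n$ tight arrows lying over $(b_1,\dots,b_n)$ is nonempty and connected; and (D2) for every multicell $\alpha$ of $\mathbb{D}$, every $n\ge 2$ and every height-$n$ decomposition $\gamma$ of $P(\alpha)$ in $\mathbb{E}$, the category of height-$n$ decompositions of $\alpha$ lying over $\gamma$ is nonempty and connected.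
   Context: A virtual double category (VDC) has objects, tight arrows forming a category, loose arrows, and $n$-ary multicells from a composable path of $n$ loose arrows to a loose arrow with two tight sides, with identities and associative unital composition; a virtual double functor (VDF) preserves everything strictly; $\mathbf{Vdc}$ is the category of small VDCs and VDFs. Factorizations: a factorization of a tight arrow $a$ into $n$ tight arrows is a composable tuple with composite $a$; a morphism between two such factorizations (with the same endpoints) consists of tight arrows between the corresponding intermediate objects making all squares commute; the category of factorizations lying over $(b_1,\dots,b_n)$ has objects the factorizations mapped by $P$ to $(b_1,\dots,b_n)$ and morphisms those whose components are mapped by $P$ to identities. Decompositions: a height-$n$ decomposition of a multicell $\alpha$ is a stack of $n$ layers of multicells (layer 1 a single multicell, each layer a compatible row whose loose targets form the loose source path of the layer below, the interface) whose iterated composite is $\alpha$. A morphism between two height-$n$ decompositions $(P_i)$, $(Q_i)$ of $\alpha$ consists of compatible rows $\sigma_i$ ($1\le i\le n-1$) of unary multicells from interface $i$ of $P$ to interface $i$ of $Q$ (with $\sigma_0,\sigma_n$ identities on the target and source of $\alpha$) such that layer $i$ of $P$ followed by $\sigma_{i-1}$ equals $\sigma_i$ followed by layer $i$ of $Q$. The category of decompositions of $\alpha$ lying over $\gamma$ has as objects the decompositions mapped by $P$ to $\gamma$ and as morphisms those whose unary multicells are mapped by $P$ to identity multicells. *)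

(* Defs.v *)
(* Virtual double categories (VDCs) in an "essentially algebraic"
   encoding: four sorts (objects, tight arrows, loose arrows, multicells) with
   boundary maps; tight composition and multicell composition are total
   operations whose values are only constrained (by the axioms) on composable
   inputs. *)
From Stdlib Require Import List Relations.
Import ListNotations.

Set Implicit Arguments.

Fixpoint lpath_ok {O L : Type} (src tgt : L -> O) (x : O) (p : list L) (y : O) : Prop :=
  match p with
  | [] => x = y
  | u :: p' => src u = x /\ lpath_ok src tgt (tgt u) p' y
  end.

Fixpoint row_ok {T C : Type} (left right : C -> T) (f : T) (cs : list C) : Prop :=
  match cs with
  | [] => True
  | c :: cs' => left c = f /\ row_ok left right (right c) cs'
  end.

Fixpoint row_end {T C : Type} (right : C -> T) (f : T) (cs : list C) : T :=
  match cs with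
  | [] => f
  | c :: cs' => row_end right (right c) cs'
  end.

(* composite of a row [bs] (lower) with a row [cs] (upper, leftmost tight arrow g)
   whose loose targets are the concatenated loose sources of [bs]:
   each b is composed with the sub-row of cs lying over its source. *)
Fixpoint row_comp {T L C : Type} (csrc : C -> list L) (right : C -> T)
  (comp : C -> T -> list C -> C) (g : T) (bs cs : list C) : list C :=
  match bs with
  | [] => []
  | b :: bs' =>
      let k := length (csrc b) in
      let c1 := firstn k cs in
      comp b g c1 :: row_comp csrc right comp (row_end right g c1) bs' (skipn k cs)
  end.

Record vdc_data := VdcData {
  ob : Type;
  tarr : Type;
  larr : Type;
  cell : Type;
  tdom : tarr -> ob;
  tcod : tarr -> ob;
  tid : ob -> tarr;
  tcomp : tarr -> tarr -> tarr;     (* diagrammatic: tcomp f g = g o f *)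
  lsrc : larr -> ob;
  ltgt : larr -> ob;
  csrc : cell -> list larr;
  ctgt : cell -> larr;
  cleft : cell -> tarr;
  cright : cell -> tarr;
  cid : larr -> cell;
  (* ccomp a f bs : composite of the cell a with the row (f, bs) above it,
     f being the leftmost tight arrow of the row (needed when bs = []) *)
  ccomp : cell -> tarr -> list cell -> cell
}.

Arguments tdom {_} _.  Arguments tcod {_} _.  Arguments tid {_} _.
Arguments tcomp {_} _ _.  Arguments lsrc {_} _.  Arguments ltgt {_} _.
Arguments csrc {_} _.  Arguments ctgt {_} _.  Arguments cleft {_} _.
Arguments cright {_} _.  Arguments cid {_} _.  Arguments ccomp {_} _ _ _.

Definition vrow_ok (V : vdc_data) (f : tarr V) (cs : list (cell V)) : Prop :=
  row_ok (@cleft V) (@cright V) f cs.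
Arguments vrow_ok : clear implicits.

Definition vrow_end (V : vdc_data) (f : tarr V) (cs : list (cell V)) : tarr V :=
  row_end (@cright V) f cs.
Arguments vrow_end : clear implicits.

Definition vrow_comp (V : vdc_data) (g : tarr V) (bs cs : list (cell V)) : list (cell V) :=
  row_comp (@csrc V) (@cright V) (@ccomp V) g bs cs.
Arguments vrow_comp : clear implicits.

Definition composable (V : vdc_data) (a : cell V) (f : tarr V) (bs : list (cell V)) : Prop :=
  vrow_ok V f bs /\ map (@ctgt V) bs = csrc a /\ tcod f = tdom (cleft a).
Arguments composable : clear implicits.

Record vdc_axioms (V : vdc_data) : Prop := {
  ax_tid_dom : forall x : ob V, tdom (tid x) = x;
  ax_tid_cod : forall x : ob V, tcod (tid x) = x;
  ax_tcomp_dom : forall f g : tarr V, tcod f = tdom g -> tdom (tcomp f g) = tdom f;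
  ax_tcomp_cod : forall f g : tarr V, tcod f = tdom g -> tcod (tcomp f g) = tcod g;
  ax_tcomp_idl : forall f : tarr V, tcomp (tid (tdom f)) f = f;
  ax_tcomp_idr : forall f : tarr V, tcomp f (tid (tcod f)) = f;
  ax_tcomp_assoc : forall f g h : tarr V, tcod f = tdom g -> tcod g = tdom h ->
      tcomp (tcomp f g) h = tcomp f (tcomp g h);
  ax_cell_path : forall c : cell V,
      lpath_ok (@lsrc V) (@ltgt V) (tdom (cleft c)) (csrc c) (tdom (cright c));
  ax_cell_tgt_src : forall c : cell V, lsrc (ctgt c) = tcod (cleft c);
  ax_cell_tgt_tgt : forall c : cell V, ltgt (ctgt c) = tcod (cright c);
  ax_cid_src : forall u : larr V, csrc (cid u) = [u];
  ax_cid_tgt : forall u : larr V, ctgt (cid u) = u;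
  ax_cid_left : forall u : larr V, cleft (cid u) = tid (lsrc u);
  ax_cid_right : forall u : larr V, cright (cid u) = tid (ltgt u);
  ax_comp_src : forall a f bs, composable V a f bs ->
      csrc (ccomp a f bs) = concat (map (@csrc V) bs);
  ax_comp_tgt : forall a f bs, composable V a f bs -> ctgt (ccomp a f bs) = ctgt a;
  ax_comp_left : forall a f bs, composable V a f bs ->
      cleft (ccomp a f bs) = tcomp f (cleft a);
  ax_comp_right : forall a f bs, composable V a f bs ->
      cright (ccomp a f bs) = tcomp (vrow_end V f bs) (cright a);
  ax_comp_idl : forall u f b, composable V (cid u) f [b] -> ccomp (cid u) f [b] = b;
  ax_comp_idr : forall a : cell V,
      ccomp a (tid (tdom (cleft a))) (map (@cid V) (csrc a)) = a;
  ax_comp_assoc : forall a f bs g cs,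
      composable V a f bs -> composable V (ccomp a f bs) g cs ->
      ccomp (ccomp a f bs) g cs = ccomp a (tcomp g f) (vrow_comp V g bs cs)
}.

Record vdc := Vdc { vdata :> vdc_data; vaxioms : vdc_axioms vdata }.

Record vdf (A B : vdc) := Vdf {
  fob : ob A -> ob B;
  ftarr : tarr A -> tarr B;
  flarr : larr A -> larr B;
  fcell : cell A -> cell B;
  f_tdom : forall f, tdom (ftarr f) = fob (tdom f);
  f_tcod : forall f, tcod (ftarr f) = fob (tcod f);
  f_tid : forall x, ftarr (tid x) = tid (fob x);
  f_tcomp : forall f g, tcod f = tdom g -> ftarr (tcomp f g) = tcomp (ftarr f) (ftarr g);
  f_lsrc : forall u, lsrc (flarr u) = fob (lsrc u);
  f_ltgt : forall u, ltgt (flarr u) = fob (ltgt u);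
  f_csrc : forall c, csrc (fcell c) = map flarr (csrc c);
  f_ctgt : forall c, ctgt (fcell c) = flarr (ctgt c);
  f_cleft : forall c, cleft (fcell c) = ftarr (cleft c);
  f_cright : forall c, cright (fcell c) = ftarr (cright c);
  f_cid : forall u, fcell (cid u) = cid (flarr u);
  f_ccomp : forall a f bs, composable A a f bs ->
      fcell (ccomp a f bs) = ccomp (fcell a) (ftarr f) (map fcell bs)
}.

(* F = G  (a VDF is determined by its four component maps) *)
Definition vdf_eq (A B : vdc) (F G : vdf A B) : Prop :=
  (forall x, fob F x = fob G x) /\ (forall f, ftarr F f = ftarr G f) /\
  (forall u, flarr F u = flarr G u) /\ (forall c, fcell F c = fcell G c).

Definition vdf_tri (A B C : vdc) (F : vdf A B) (G : vdf B C) (H : vdf A C) : Prop :=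
  (forall x, fob G (fob F x) = fob H x) /\ (forall f, ftarr G (ftarr F f) = ftarr H f) /\
  (forall u, flarr G (flarr F u) = flarr H u) /\ (forall c, fcell G (fcell F c) = fcell H c).

Definition vdf_sq (A B C D : vdc) (F : vdf A B) (G : vdf B D) (F' : vdf A C) (G' : vdf C D)
  : Prop :=
  (forall x, fob G (fob F x) = fob G' (fob F' x)) /\
  (forall f, ftarr G (ftarr F f) = ftarr G' (ftarr F' f)) /\
  (forall u, flarr G (flarr F u) = flarr G' (flarr F' u)) /\
  (forall c, fcell G (fcell F c) = fcell G' (fcell F' c)).

Definition is_pullback (X D E : vdc) (x : vdf X E) (P : vdf D E)
  (X' : vdc) (p1 : vdf X' X) (p2 : vdf X' D) : Prop :=
  vdf_sq p1 x p2 P /\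
  forall (W : vdc) (u : vdf W X) (v : vdf W D), vdf_sq u x v P ->
    exists w : vdf W X',
      vdf_tri w p1 u /\ vdf_tri w p2 v /\
      forall w' : vdf W X', vdf_tri w' p1 u -> vdf_tri w' p2 v -> vdf_eq w w'.

(* P is exponentiable: the pullback functor  - x_E D : Vdc/E -> Vdc  has a right
   adjoint, expressed pointwise: every Y has a universal arrow (counit)
   eps : R x_E D -> Y from the pullback functor. *)
Definition exponentiable (D E : vdc) (P : vdf D E) : Prop :=
  forall Y : vdc,
  exists (R : vdc) (r : vdf R E) (R' : vdc) (q1 : vdf R' R) (q2 : vdf R' D)
         (eps : vdf R' Y),
    is_pullback r P q1 q2 /\
    forall (X : vdc) (x : vdf X E) (X' : vdc) (p1 : vdf X' X) (p2 : vdf X' D),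
      is_pullback x P p1 p2 ->
      forall g : vdf X' Y,
        exists h : vdf X R,
          (vdf_tri h r x /\
           exists h' : vdf X' R',
             vdf_sq h' q1 p1 h /\ vdf_tri h' q2 p2 /\ vdf_tri h' eps g) /\
          forall h2 : vdf X R,
            (vdf_tri h2 r x /\
             exists h2' : vdf X' R',
               vdf_sq h2' q1 p1 h2 /\ vdf_tri h2' q2 p2 /\ vdf_tri h2' eps g) ->
            vdf_eq h h2.

Definition nonempty_connected (X : Type) (Ob : X -> Prop) (Hom : X -> X -> Prop) : Prop :=
  (exists x, Ob x) /\
  forall x y, Ob x -> Ob y ->
    clos_refl_sym_trans X (fun u v => Ob u /\ Ob v /\ Hom u v) x y.

Fixpoint tchain (V : vdc_data) (x : ob V) (fs : list (tarr V)) (y : ob V) : Prop :=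
  match fs with
  | [] => x = y
  | f :: fs' => tdom f = x /\ @tchain V (tcod f) fs' y
  end.
Arguments tchain : clear implicits.

Definition tcomp_list (V : vdc_data) (x : ob V) (fs : list (tarr V)) : tarr V :=
  match fs with
  | [] => tid x
  | f :: fs' => fold_left (@tcomp V) fs' f
  end.
Arguments tcomp_list : clear implicits.

Definition is_factorization (V : vdc_data) (a : tarr V) (fs : list (tarr V)) : Prop :=
  tchain V (tdom a) fs (tcod a) /\ tcomp_list V (tdom a) fs = a.
Arguments is_factorization : clear implicits.

Definition fact_hom (V : vdc_data) (a : tarr V) (xs ys ms : list (tarr V)) : Prop :=
  length ms = length xs - 1 /\
  (forall i, i < length ms ->
     tdom (nth i ms a) = tcod (nth i xs a) /\ tcod (nth i ms a) = tcod (nth i ys a)) /\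
  let ms' := tid (tdom a) :: ms ++ [tid (tcod a)] in
  forall i, i < length xs ->
    tcomp (nth i xs a) (nth (S i) ms' a) = tcomp (nth i ms' a) (nth i ys a).
Arguments fact_hom : clear implicits.

Definition lifts_factorizations (D E : vdc) (P : vdf D E) : Prop :=
  forall (a : tarr D) (bs : list (tarr E)),
    2 <= length bs -> is_factorization E (ftarr P a) bs ->
    nonempty_connected
      (fun xs => is_factorization D a xs /\ map (ftarr P) xs = bs)
      (fun xs ys => exists ms, fact_hom D a xs ys ms /\
                      Forall (fun m => ftarr P m = tid (fob P (tdom m))) ms).

(* a row (layer): its leftmost tight arrow and its list of cells *)
Definition row (V : vdc_data) : Type := (tarr V * list (cell V))%type.

Fixpoint layers_ok (V : vdc_data) (acc : cell V) (rows : list (row V)) (a : cell V) : Prop :=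
  match rows with
  | [] => acc = a
  | (f, bs) :: rest => composable V acc f bs /\ @layers_ok V (ccomp acc f bs) rest a
  end.
Arguments layers_ok : clear implicits.

(* ls = (layer_1, ..., layer_n) is a decomposition of a: layer 1 is a single cell,
   each next layer is a row composable with the composite so far (its loose
   targets are the loose sources of the previous layer), and the iterated
   composite is a.  Its height is length ls. *)
Definition is_decomposition (V : vdc_data) (a : cell V) (ls : list (row V)) : Prop :=
  match ls with
  | (f, [c]) :: rest => f = cleft c /\ layers_ok V c rest a
  | _ => False
  end.
Arguments is_decomposition : clear implicits.

Definition iface (V : vdc_data) (r : row V) : list (larr V) := concat (map (@csrc V) (snd r)).
Arguments iface : clear implicits.

Definition unary_row_between (V : vdc_data) (s p q : row V) : Prop :=
  vrow_ok V (fst s) (snd s) /\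
  Forall (fun c => length (csrc c) = 1) (snd s) /\
  iface V s = iface V p /\ map (@ctgt V) (snd s) = iface V q /\
  tdom (fst s) = tdom (fst p) /\ tcod (fst s) = tdom (fst q).
Arguments unary_row_between : clear implicits.

Definition rowcomp_full (V : vdc_data) (low up : row V) : row V :=
  (tcomp (fst up) (fst low), vrow_comp V (fst up) (snd low) (snd up)).
Arguments rowcomp_full : clear implicits.

Definition decomp_hom (V : vdc_data) (a : cell V) (Ps Qs sig : list (row V)) : Prop :=
  let s0 : row V := (tid (lsrc (ctgt a)), [cid (ctgt a)]) in
  let sn : row V := (tid (tdom (cleft a)), map (@cid V) (csrc a)) in
  length sig = length Ps - 1 /\
  (forall i, i < length sig -> unary_row_between V (nth i sig s0) (nth i Ps s0) (nth i Qs s0)) /\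
  let full := s0 :: sig ++ [sn] in
  forall j, j < length Ps ->
    rowcomp_full V (nth j full s0) (nth j Ps s0) = rowcomp_full V (nth j Qs s0) (nth (S j) full s0).
Arguments decomp_hom : clear implicits.

Definition map_row (D E : vdc) (P : vdf D E) (r : row D) : row E :=
  (ftarr P (fst r), map (fcell P) (snd r)).

Definition lifts_decompositions (D E : vdc) (P : vdf D E) : Prop :=
  forall (a : cell D) (g : list (row E)),
    2 <= length g -> is_decomposition E (fcell P a) g ->
    nonempty_connected
      (fun Ps => is_decomposition D a Ps /\ map (map_row P) Ps = g)
      (fun Ps Qs => exists sig, decomp_hom D a Ps Qs sig /\
         Forall (fun s => ftarr P (fst s) = tid (fob P (tdom (fst s))) /\
                          Forall (fun c => fcell P c = cid (ctgt (fcell P c))) (snd s)) sig).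

Definition lifts_decompositions_ess_uniquely (D E : vdc) (P : vdf D E) : Prop :=
  lifts_factorizations P /\ lifts_decompositions P.

(* Main.v *)
From Stdlib Require Import List Relations Lia Arith.
From Stdlib Require Import ProofIrrelevance FunctionalExtensionality PropExtensionality.
From Stdlib Require Import ClassicalEpsilon.
Require Import Defs.
Import ListNotations.

(** Both lifting conditions are equivalent to their height-two instances, where two
    decompositions count as equivalent when they are linked by moving vertical rows across
    the interface; general heights follow by peeling off one layer at a time.

    If decompositions of height two lift essentially uniquely, the exponential of [Y] is the
    VDC whose cells over a cell [e] of [E] are the functions, compatible with vertical cells,
    from the cells of [D] over [e] to the cells of [Y].  A composite is evaluated by
    decomposing its argument: a decomposition exists by nonemptiness, and the value does not
    depend on it by connectedness.

    Conversely, let [collage P] be the VDC with three levels in which the cells from level 0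
    to level 2 are equivalence classes of composable pairs of [D].  The identity-like maps from
    the pullbacks of two-level copies of [E] transpose to maps into its exponential.
    Composing there the images of a cell [c] and a row above it, and evaluating at a cell [a]
    of [D] over the composite, gives a single class which contains every decomposition of [a]
    over the given one; this is connectedness.  Comparing the exponential of [collage P] with
    that of the pullback of [collage (vdf_id E)] shows that this class consists of decompositions
    of [a] over the given one; this is nonemptiness. *)

(** The fibre of [P] over an object is a category of vertical arrows, not a set. This is why objects
    and loose arrows of the exponential carry an action on vertical arrows and on vertical unary
    multicells, and why lifts are compared by zigzags. The quotient in the collage comes from
    associativity: if the middle one of three composable arrows is vertical on level 1, the two
    bracketings are two different pairs linked by one move, so such pairs must be identified. A
    multicell from level 0 to level 2 carries an inhabited class by construction; as soon as one
    over [a] is found, [a] has a decomposition. Whether that class lies over the given decomposition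
    is read off in [collage (vdf_id E)], where every class is a singleton. Since operations are
    total but constrained only on composable inputs, the pullback, the exponential and the collage
    are built as raw data and then cut down to good elements. Values in the exponential are graphs
    rather than dependent functions, so that comparing them over equal base points needs no
    transport. *)

Set Implicit Arguments.
Unset Strict Implicit.

(** * Rows of multicells *)

(* The laws of a VDC that determine boundaries: all of [vdc_axioms] except the
   unit and associativity laws of multicell composition. *)
Record vdc_typing (V : vdc_data) : Prop := {
  ty_tid_dom : forall x : ob V, tdom (tid x) = x;
  ty_tid_cod : forall x : ob V, tcod (tid x) = x;
  ty_tcomp_dom : forall f g : tarr V, tcod f = tdom g -> tdom (tcomp f g) = tdom f;
  ty_tcomp_cod : forall f g : tarr V, tcod f = tdom g -> tcod (tcomp f g) = tcod g;
  ty_tcomp_idl : forall f : tarr V, tcomp (tid (tdom f)) f = f;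
  ty_tcomp_idr : forall f : tarr V, tcomp f (tid (tcod f)) = f;
  ty_tcomp_assoc : forall f g h : tarr V, tcod f = tdom g -> tcod g = tdom h ->
      tcomp (tcomp f g) h = tcomp f (tcomp g h);
  ty_cell_path : forall c : cell V,
      lpath_ok (@lsrc V) (@ltgt V) (tdom (cleft c)) (csrc c) (tdom (cright c));
  ty_cell_tgt_src : forall c : cell V, lsrc (ctgt c) = tcod (cleft c);
  ty_cell_tgt_tgt : forall c : cell V, ltgt (ctgt c) = tcod (cright c);
  ty_cid_src : forall u : larr V, csrc (cid u) = [u];
  ty_cid_tgt : forall u : larr V, ctgt (cid u) = u;
  ty_cid_left : forall u : larr V, cleft (cid u) = tid (lsrc u);
  ty_cid_right : forall u : larr V, cright (cid u) = tid (ltgt u);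
  ty_comp_src : forall a f bs, composable V a f bs ->
      csrc (ccomp a f bs) = concat (map (@csrc V) bs);
  ty_comp_tgt : forall a f bs, composable V a f bs -> ctgt (ccomp a f bs) = ctgt a;
  ty_comp_left : forall a f bs, composable V a f bs ->
      cleft (ccomp a f bs) = tcomp f (cleft a);
  ty_comp_right : forall a f bs, composable V a f bs ->
      cright (ccomp a f bs) = tcomp (vrow_end V f bs) (cright a)
}.

Lemma vdc_axioms_typing (V : vdc_data) : vdc_axioms V -> vdc_typing V.
Proof. intros []; split; assumption. Qed.

Lemma lpath_end_unique (O L : Type) (s t : L -> O) p x y y' :
  lpath_ok s t x p y -> lpath_ok s t x p y' -> y = y'.
Proof.
  revert x; induction p as [|u p IH]; simpl; intros x H H'.
  - congruence.
  - eapply IH; [apply H | apply H'].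
Qed.

Lemma lpath_app (O L : Type) (s t : L -> O) p q x y z :
  lpath_ok s t x p y -> lpath_ok s t y q z -> lpath_ok s t x (p ++ q) z.
Proof.
  revert x; induction p as [|u p IH]; simpl; intros x H H'.
  - subst; assumption.
  - destruct H; split; auto.
Qed.

(* [(g, cs)] is the upper row, [(f, bs)] the lower one. *)
Definition stack (V : vdc_data) (f : tarr V) (bs : list (cell V)) (g : tarr V)
  (cs : list (cell V)) : Prop :=
  vrow_ok V f bs /\ vrow_ok V g cs /\
  map (@ctgt V) cs = concat (map (@csrc V) bs) /\ tcod g = tdom f.
Arguments stack : clear implicits.

Section Rows.
Context {V : vdc_data}.

Lemma vrow_ok_app f bs cs :
  vrow_ok V f (bs ++ cs) <-> vrow_ok V f bs /\ vrow_ok V (vrow_end V f bs) cs.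
Proof.
  unfold vrow_ok, vrow_end. revert f.
  induction bs as [|b bs IH]; intros f; simpl; [tauto|rewrite IH; tauto].
Qed.

Lemma vrow_end_app f bs cs :
  vrow_end V f (bs ++ cs) = vrow_end V (vrow_end V f bs) cs.
Proof. revert f; induction bs as [|b bs IH]; intros f; simpl; [reflexivity|apply IH]. Qed.

(** [row_comp] cuts the upper row by arity; here the cut appears as a given splitting, the form in
    which later inductions meet it. *)
Lemma vrow_comp_cons g b bs c1 c2 :
  length c1 = length (csrc b) ->
  vrow_comp V g (b :: bs) (c1 ++ c2) =
  ccomp b g c1 :: vrow_comp V (vrow_end V g c1) bs c2.
Proof.
  intros H; unfold vrow_comp; simpl; rewrite <- H.
  rewrite firstn_app, Nat.sub_diag, firstn_all, firstn_O, app_nil_r.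
  rewrite skipn_app, Nat.sub_diag, skipn_all. reflexivity.
Qed.

Lemma composable_length a f bs : composable V a f bs -> length bs = length (csrc a).
Proof. intros (_ & H & _). rewrite <- H, length_map. reflexivity. Qed.

Context (T : vdc_typing V).

Lemma vrow_src_path f bs : vrow_ok V f bs ->
  lpath_ok (@lsrc V) (@ltgt V) (tdom f) (concat (map (@csrc V) bs)) (tdom (vrow_end V f bs)).
Proof.
  revert f; induction bs as [|b bs IH]; simpl; intros f H; [reflexivity|].
  destruct H as [<- H]. eapply lpath_app; [apply (ty_cell_path T)|]. apply IH, H.
Qed.

Lemma vrow_tgt_path f bs : vrow_ok V f bs ->
  lpath_ok (@lsrc V) (@ltgt V) (tcod f) (map (@ctgt V) bs) (tcod (vrow_end V f bs)).
Proof.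
  revert f; induction bs as [|b bs IH]; simpl; intros f H; [reflexivity|].
  destruct H as [<- H]. split; [apply (ty_cell_tgt_src T)|].
  rewrite (ty_cell_tgt_tgt T). apply IH, H.
Qed.

(** [composable] records only the left boundary. The right one follows because a path of loose
    arrows and its starting point determine its end. *)
Lemma composable_end a f bs : composable V a f bs -> tcod (vrow_end V f bs) = tdom (cright a).
Proof.
  intros (H & H1 & H2). pose proof (vrow_tgt_path H) as Hp.
  rewrite H1, H2 in Hp. eapply lpath_end_unique; [exact Hp|apply (ty_cell_path T)].
Qed.

Lemma stack_end f bs g cs : stack V f bs g cs ->
  tcod (vrow_end V g cs) = tdom (vrow_end V f bs).
Proof.
  intros (H & H0 & H1 & H2). pose proof (vrow_tgt_path H0) as Hp.
  rewrite H1, H2 in Hp. eapply lpath_end_unique; [exact Hp|apply vrow_src_path, H].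
Qed.

(** Induction over stacked rows. The targets of the upper row are the concatenated sources of the
    lower one, so the upper row splits into the part above the first lower cell and the rest. *)
Lemma stack_rec (Q : tarr V -> list (cell V) -> tarr V -> list (cell V) -> Prop) :
  (forall f g, tcod g = tdom f -> Q f [] g []) ->
  (forall b bs g c1 c2, composable V b g c1 ->
     stack V (cright b) bs (vrow_end V g c1) c2 ->
     Q (cright b) bs (vrow_end V g c1) c2 -> Q (cleft b) (b :: bs) g (c1 ++ c2)) ->
  forall f bs g cs, stack V f bs g cs -> Q f bs g cs.
Proof.
  intros Hn Hc f bs; revert f; induction bs as [|b bs IH]; intros f g cs (H & H0 & H1 & H2).
  - simpl in H1. destruct cs; [|discriminate]. auto.
  - destruct H as [<- H]. simpl in H1.
    destruct (map_eq_app _ _ _ _ H1) as (c1 & c2 & -> & E1 & E2).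
    apply vrow_ok_app in H0; destruct H0 as [H3 H4].
    assert (Hb : composable V b g c1) by (repeat split; assumption).
    assert (Hs : stack V (cright b) bs (vrow_end V g c1) c2).
    { repeat split; try assumption. apply composable_end, Hb. }
    auto.
Qed.

Lemma stack_row_ok f bs g cs : stack V f bs g cs ->
  vrow_ok V (tcomp g f) (vrow_comp V g bs cs).
Proof.
  revert f bs g cs. apply stack_rec.
  - intros; exact I.
  - intros b bs g c1 c2 H _ IH. rewrite (vrow_comp_cons _ _ _ (composable_length H)).
    split; [apply (ty_comp_left T), H|].
    rewrite (ty_comp_right T H). exact IH.
Qed.

Lemma stack_row_end f bs g cs : stack V f bs g cs ->
  vrow_end V (tcomp g f) (vrow_comp V g bs cs) = tcomp (vrow_end V g cs) (vrow_end V f bs).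
Proof.
  revert f bs g cs. apply stack_rec.
  - reflexivity.
  - intros b bs g c1 c2 H _ IH. rewrite (vrow_comp_cons _ _ _ (composable_length H)).
    change (vrow_end V (cright (ccomp b g c1)) (vrow_comp V (vrow_end V g c1) bs c2) =
      tcomp (vrow_end V g (c1 ++ c2)) (vrow_end V (cright b) bs)).
    rewrite vrow_end_app, (ty_comp_right T H). exact IH.
Qed.

Lemma stack_row_tgt f bs g cs : stack V f bs g cs ->
  map (@ctgt V) (vrow_comp V g bs cs) = map (@ctgt V) bs.
Proof.
  revert f bs g cs. apply stack_rec.
  - reflexivity.
  - intros b bs g c1 c2 H _ IH. rewrite (vrow_comp_cons _ _ _ (composable_length H)).
    simpl. rewrite (ty_comp_tgt T H), IH. reflexivity.
Qed.

Lemma stack_row_src f bs g cs : stack V f bs g cs ->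
  concat (map (@csrc V) (vrow_comp V g bs cs)) = concat (map (@csrc V) cs).
Proof.
  revert f bs g cs. apply stack_rec.
  - reflexivity.
  - intros b bs g c1 c2 H _ IH. rewrite (vrow_comp_cons _ _ _ (composable_length H)).
    simpl. rewrite (ty_comp_src T H), IH, map_app, concat_app. reflexivity.
Qed.

(** Separates what a third layer must satisfy from the bottom cell: the condition on the right no
    longer mentions [a]. *)
Lemma composable_stack a f bs g cs : composable V a f bs ->
  composable V (ccomp a f bs) g cs <-> stack V f bs g cs.
Proof.
  intros H. unfold composable at 1, stack.
  rewrite (ty_comp_src T H), (ty_comp_left T H).
  destruct H as (H & H1 & H2). rewrite (ty_tcomp_dom T) by assumption. tauto.
Qed.

Lemma composable_comp a f bs g cs : composable V a f bs -> stack V f bs g cs ->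
  composable V a (tcomp g f) (vrow_comp V g bs cs).
Proof.
  intros H Hs. split; [|split].
  - apply stack_row_ok, Hs.
  - rewrite (stack_row_tgt Hs). apply H.
  - rewrite (ty_tcomp_cod T); [apply H|apply Hs].
Qed.

Lemma stack_app_inv f c1 c2 g ds : stack V f (c1 ++ c2) g ds ->
  exists d1 d2, ds = d1 ++ d2 /\ stack V f c1 g d1 /\
    stack V (vrow_end V f c1) c2 (vrow_end V g d1) d2.
Proof.
  intros (H & H0 & H1 & H2). rewrite map_app, concat_app in H1.
  destruct (map_eq_app _ _ _ _ H1) as (d1 & d2 & -> & E1 & E2).
  apply vrow_ok_app in H0; apply vrow_ok_app in H.
  assert (Hs : stack V f c1 g d1) by (repeat split; tauto).
  exists d1, d2; split; [reflexivity|split; [exact Hs|]].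
  repeat split; try tauto. apply stack_end, Hs.
Qed.

Lemma vrow_comp_app f c1 c2 g d1 d2 : stack V f c1 g d1 ->
  vrow_comp V g (c1 ++ c2) (d1 ++ d2) =
  vrow_comp V g c1 d1 ++ vrow_comp V (vrow_end V g d1) c2 d2.
Proof.
  intros H; revert f c1 g d1 H. apply (stack_rec (Q := fun f c1 g d1 =>
   vrow_comp V g (c1 ++ c2) (d1 ++ d2) =
   vrow_comp V g c1 d1 ++ vrow_comp V (vrow_end V g d1) c2 d2)).
  - reflexivity.
  - intros b bs g e1 e2 H _ IH.
    rewrite (vrow_comp_cons _ _ _ (composable_length H)).
    rewrite <- app_assoc. simpl. rewrite (vrow_comp_cons _ _ _ (composable_length H)).
    rewrite IH, vrow_end_app. reflexivity.
Qed.

Lemma vrow_comp_single a f bs : composable V a f bs -> vrow_comp V f [a] bs = [ccomp a f bs].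
Proof.
  intros H. rewrite <- (app_nil_r bs) at 1.
  rewrite (vrow_comp_cons _ _ _ (composable_length H)). reflexivity.
Qed.

Lemma stack_single a f bs : composable V a f bs -> stack V (cleft a) [a] f bs.
Proof.
  intros (H & H1 & H2). repeat split; try assumption. simpl. rewrite app_nil_r. exact H1.
Qed.

Lemma composable_single a b : ctgt b :: nil = csrc a -> tcod (cleft b) = tdom (cleft a) ->
  composable V a (cleft b) [b].
Proof. intros H H1. repeat split; assumption. Qed.

Lemma cid_row_ok x p y : lpath_ok (@lsrc V) (@ltgt V) x p y ->
  vrow_ok V (tid x) (map (@cid V) p) /\ vrow_end V (tid x) (map (@cid V) p) = tid y.
Proof.
  revert x; induction p as [|u p IH]; simpl; intros x H.
  - subst; split; [exact I|reflexivity].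
  - destruct H as [<- H]. destruct (IH _ H) as [H1 H2].
    split; [split|].
    + apply (ty_cid_left T).
    + change (vrow_ok V (cright (cid u)) (map (@cid V) p)).
      rewrite (ty_cid_right T). exact H1.
    + change (vrow_end V (cright (cid u)) (map (@cid V) p) = tid y).
      rewrite (ty_cid_right T). exact H2.
Qed.

Lemma cid_row_tgt p : map (@ctgt V) (map (@cid V) p) = p.
Proof.
  induction p as [|u p IH]; simpl; [reflexivity|].
  rewrite (ty_cid_tgt T), IH; reflexivity.
Qed.

Lemma cid_row_src p : concat (map (@csrc V) (map (@cid V) p)) = p.
Proof.
  induction p as [|u p IH]; simpl; [reflexivity|].
  rewrite (ty_cid_src T), IH; reflexivity.
Qed.

Lemma composable_idr a : composable V a (tid (tdom (cleft a))) (map (@cid V) (csrc a)).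
Proof.
  split; [|split].
  - eapply cid_row_ok, (ty_cell_path T).
  - apply cid_row_tgt.
  - apply (ty_tid_cod T).
Qed.

Lemma composable_idl b : composable V (cid (ctgt b)) (cleft b) [b].
Proof.
  apply composable_single.
  - symmetry. apply (ty_cid_src T).
  - rewrite (ty_cid_left T), (ty_tid_dom T). symmetry. apply (ty_cell_tgt_src T).
Qed.

End Rows.

Section FullRows.
Context {V : vdc_data} (A : vdc_axioms V).
Let T := vdc_axioms_typing A.

Lemma vrow_comp_assoc f bs g cs h ds : stack V f bs g cs -> stack V g cs h ds ->
  vrow_comp V h (vrow_comp V g bs cs) ds = vrow_comp V (tcomp h g) bs (vrow_comp V h cs ds).
Proof.
  intros H; revert f bs g cs H h ds.
  apply (stack_rec T (Q := fun f bs g cs => forall h ds, stack V g cs h ds ->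
   vrow_comp V h (vrow_comp V g bs cs) ds = vrow_comp V (tcomp h g) bs (vrow_comp V h cs ds))).
  - reflexivity.
  - intros b bs g c1 c2 H Hs IH h ds Hd.
    destruct (stack_app_inv T Hd) as (d1 & d2 & -> & H1 & H2).
    rewrite (vrow_comp_app T _ _ H1).
    rewrite (vrow_comp_cons _ _ _ (composable_length H)).
    assert (H3 : composable V (ccomp b g c1) h d1) by (apply (composable_stack T); assumption).
    rewrite (vrow_comp_cons _ _ _ (composable_length H3)).
    pose proof (composable_comp T H H1) as H4.
    rewrite (vrow_comp_cons _ _ _ (composable_length H4)).
    rewrite (ax_comp_assoc A H H3). f_equal.
    rewrite (stack_row_end T H1). apply IH, H2.
Qed.

Lemma vrow_comp_idr f bs : vrow_ok V f bs ->
  vrow_comp V (tid (tdom f)) bs (map (@cid V) (concat (map (@csrc V) bs))) = bs.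
Proof.
  revert f; induction bs as [|b bs IH]; simpl; intros f H; [reflexivity|].
  destruct H as [<- H]. rewrite map_app.
  rewrite vrow_comp_cons by apply length_map.
  rewrite (ax_comp_idr A). f_equal.
  replace (vrow_end V _ _) with (tid (tdom (cright b))); [apply IH, H|].
  symmetry. eapply (cid_row_ok T), (ty_cell_path T).
Qed.

Lemma vrow_comp_idl f bs : vrow_ok V f bs ->
  vrow_comp V f (map (@cid V) (map (@ctgt V) bs)) bs = bs.
Proof.
  revert f; induction bs as [|b bs IH]; simpl; intros f H; [reflexivity|].
  destruct H as [<- H].
  assert (L : length [b] = length (csrc (cid (ctgt b)))) by (rewrite (ax_cid_src A); reflexivity).
  etransitivity; [exact (vrow_comp_cons (cleft b) (map (@cid V) (map (@ctgt V) bs)) bs L)|].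
  rewrite (ax_comp_idl A) by apply (composable_idl T). f_equal. apply IH, H.
Qed.

End FullRows.

(** * Structure maps and sub-structures *)

(** The fields of [vdf], but between raw data, so that structure maps are available before the
    axioms of source or target are established. *)
Record vmap (A B : vdc_data) := VMap {
  mob : ob A -> ob B;
  mtarr : tarr A -> tarr B;
  mlarr : larr A -> larr B;
  mcell : cell A -> cell B;
  m_tdom : forall f, tdom (mtarr f) = mob (tdom f);
  m_tcod : forall f, tcod (mtarr f) = mob (tcod f);
  m_tid : forall x, mtarr (tid x) = tid (mob x);
  m_tcomp : forall f g, tcod f = tdom g -> mtarr (tcomp f g) = tcomp (mtarr f) (mtarr g);
  m_lsrc : forall u, lsrc (mlarr u) = mob (lsrc u);
  m_ltgt : forall u, ltgt (mlarr u) = mob (ltgt u);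
  m_csrc : forall c, csrc (mcell c) = map mlarr (csrc c);
  m_ctgt : forall c, ctgt (mcell c) = mlarr (ctgt c);
  m_cleft : forall c, cleft (mcell c) = mtarr (cleft c);
  m_cright : forall c, cright (mcell c) = mtarr (cright c);
  m_cid : forall u, mcell (cid u) = cid (mlarr u);
  m_ccomp : forall a f bs, composable A a f bs ->
      mcell (ccomp a f bs) = ccomp (mcell a) (mtarr f) (map mcell bs)
}.

Definition vmap_of_vdf (A B : vdc) (F : vdf A B) : vmap A B :=
  VMap (f_tdom F) (f_tcod F) (f_tid F) (f_tcomp F) (f_lsrc F) (f_ltgt F)
    (f_csrc F) (f_ctgt F) (f_cleft F) (f_cright F) (f_cid F) (f_ccomp F).

Definition vdf_of_vmap (A B : vdc) (F : vmap A B) : vdf A B :=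
  @Vdf A B (mob F) (mtarr F) (mlarr F) (mcell F)
    (m_tdom F) (m_tcod F) (m_tid F) (m_tcomp F) (m_lsrc F) (m_ltgt F)
    (m_csrc F) (m_ctgt F) (m_cleft F) (m_cright F) (m_cid F) (m_ccomp F).

Section VMap.
Context {A B : vdc_data} (F : vmap A B).

Lemma vmap_row_ok f bs : vrow_ok A f bs -> vrow_ok B (mtarr F f) (map (mcell F) bs).
Proof.
  unfold vrow_ok. revert f; induction bs as [|b bs IH]; simpl; intros f H; [exact I|].
  destruct H as [<- H]. rewrite (m_cleft F), (m_cright F). auto.
Qed.

Lemma vmap_row_end f bs : vrow_end B (mtarr F f) (map (mcell F) bs) = mtarr F (vrow_end A f bs).
Proof.
  unfold vrow_end. revert f; induction bs as [|b bs IH]; simpl; intros f; [reflexivity|].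
  rewrite (m_cright F). apply IH.
Qed.

Lemma vmap_tgts bs : map (@ctgt B) (map (mcell F) bs) = map (mlarr F) (map (@ctgt A) bs).
Proof. rewrite !map_map. apply map_ext. intros; apply m_ctgt. Qed.

Lemma vmap_srcs bs :
  concat (map (@csrc B) (map (mcell F) bs)) = map (mlarr F) (concat (map (@csrc A) bs)).
Proof.
  rewrite concat_map, !map_map. f_equal. apply map_ext. intros; apply m_csrc.
Qed.

Lemma vmap_composable a f bs : composable A a f bs ->
  composable B (mcell F a) (mtarr F f) (map (mcell F) bs).
Proof.
  intros (H & H1 & H2). split; [|split].
  - apply vmap_row_ok, H.
  - rewrite vmap_tgts, (m_csrc F), H1; reflexivity.
  - rewrite (m_tcod F), (m_cleft F), (m_tdom F), H2; reflexivity.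
Qed.

Lemma vmap_stack f bs g cs : stack A f bs g cs ->
  stack B (mtarr F f) (map (mcell F) bs) (mtarr F g) (map (mcell F) cs).
Proof.
  intros (H & H0 & H1 & H2). split; [|split; [|split]].
  - apply vmap_row_ok, H.
  - apply vmap_row_ok, H0.
  - rewrite vmap_tgts, vmap_srcs, H1; reflexivity.
  - rewrite (m_tcod F), (m_tdom F), H2; reflexivity.
Qed.

Lemma vmap_row_comp (T : vdc_typing A) f bs g cs : stack A f bs g cs ->
  map (mcell F) (vrow_comp A g bs cs) =
  vrow_comp B (mtarr F g) (map (mcell F) bs) (map (mcell F) cs).
Proof.
  revert f bs g cs.
  apply (stack_rec T (Q := fun f bs g cs => map (mcell F) (vrow_comp A g bs cs) =
    vrow_comp B (mtarr F g) (map (mcell F) bs) (map (mcell F) cs))).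
  - reflexivity.
  - intros b bs g c1 c2 H _ IH.
    rewrite (vrow_comp_cons _ _ _ (composable_length H)).
    rewrite map_app. simpl map.
    rewrite (vrow_comp_cons _ _ _ (composable_length (vmap_composable H))).
    rewrite (m_ccomp F H), vmap_row_end, IH. reflexivity.
Qed.

End VMap.

Definition vdf_id (A : vdc) : vdf A A.
Proof.
  refine (@Vdf A A (fun x => x) (fun x => x) (fun x => x) (fun x => x) _ _ _ _ _ _ _ _ _ _ _ _);
    try reflexivity; intros; rewrite ?map_id; reflexivity.
Defined.
Arguments vdf_id : clear implicits.

Definition vdf_comp (A B C : vdc) (F : vdf A B) (G : vdf B C) : vdf A C.
Proof.
  refine (@Vdf A C (fun x => fob G (fob F x)) (fun x => ftarr G (ftarr F x))
    (fun x => flarr G (flarr F x)) (fun x => fcell G (fcell F x)) _ _ _ _ _ _ _ _ _ _ _ _);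
    intros.
  - rewrite !f_tdom; reflexivity.
  - rewrite !f_tcod; reflexivity.
  - rewrite !f_tid; reflexivity.
  - rewrite (f_tcomp F), f_tcomp; [reflexivity| |assumption].
    rewrite f_tcod, f_tdom, H; reflexivity.
  - rewrite !f_lsrc; reflexivity.
  - rewrite !f_ltgt; reflexivity.
  - rewrite !f_csrc, map_map; reflexivity.
  - rewrite !f_ctgt; reflexivity.
  - rewrite !f_cleft; reflexivity.
  - rewrite !f_cright; reflexivity.
  - rewrite !f_cid; reflexivity.
  - rewrite (f_ccomp F), f_ccomp, map_map; [reflexivity| |assumption].
    apply (vmap_composable (vmap_of_vdf F) H).
Defined.

Fixpoint list_sig (X : Type) (G : X -> Prop) (l : list X) : Forall G l -> list {x | G x} :=
  match l with
  | [] => fun _ => []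
  | x :: l' => fun H => exist G x (Forall_inv H) :: list_sig (Forall_inv_tail H)
  end.

Lemma list_sig_val (X : Type) (G : X -> Prop) (l : list X) (H : Forall G l) :
  map (@proj1_sig X G) (list_sig H) = l.
Proof. induction l as [|x l IH]; simpl; [reflexivity|]. rewrite IH; reflexivity. Qed.

Lemma sig_inj (X : Type) (G : X -> Prop) (a b : {x | G x}) : proj1_sig a = proj1_sig b -> a = b.
Proof.
  destruct a as [a Ha], b as [b Hb]; simpl; intros <-. f_equal. apply proof_irrelevance.
Qed.

Lemma map_sig_inj (X : Type) (G : X -> Prop) (a b : list {x | G x}) :
  map (@proj1_sig X G) a = map (@proj1_sig X G) b -> a = b.
Proof.
  revert b; induction a as [|x a IH]; intros [|y b]; simpl; intros H; try discriminate.
  - reflexivity.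
  - injection H as H1 H2. f_equal; [apply sig_inj, H1|apply IH, H2].
Qed.

Lemma sig_list_good (X : Type) (G : X -> Prop) (a : list {x | G x}) :
  Forall G (map (@proj1_sig X G) a).
Proof. induction a as [|x a IH]; simpl; constructor; [apply proj2_sig|exact IH]. Qed.

(** Operations must be total on the good elements, but closure is known only on composable inputs;
    elsewhere an arbitrary good default is returned. *)
Definition restrict_op (X : Type) (G : X -> Prop) (x : X) (dflt : {x | G x}) : {x | G x} :=
  match excluded_middle_informative (G x) with
  | left H => exist G x H
  | right _ => dflt
  end.

Lemma restrict_op_val (X : Type) (G : X -> Prop) (x : X) (dflt : {x | G x}) :
  G x -> proj1_sig (restrict_op x dflt) = x.
Proof.
  intros H. unfold restrict_op. destruct (excluded_middle_informative (G x)); [reflexivity|tauto].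
Qed.

(** * Sub-structures of raw data cut out by predicates *)

Section Sub.
Context (V : vdc_data) (go : ob V -> Prop) (gt : tarr V -> Prop) (gl : larr V -> Prop)
  (gc : cell V -> Prop).

(** All laws are relativized to good elements: the ambient data of a pullback, an exponential or a
    collage may violate them elsewhere. *)
Record sub_typing : Prop := {
  st_tdom : forall f, gt f -> go (tdom f);
  st_tcod : forall f, gt f -> go (tcod f);
  st_tid : forall x, go x -> gt (tid x);
  st_tcomp : forall f g, gt f -> gt g -> tcod f = tdom g -> gt (tcomp f g);
  st_lsrc : forall u, gl u -> go (lsrc u);
  st_ltgt : forall u, gl u -> go (ltgt u);
  st_csrc : forall c, gc c -> Forall gl (csrc c);
  st_ctgt : forall c, gc c -> gl (ctgt c);
  st_cleft : forall c, gc c -> gt (cleft c);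
  st_cright : forall c, gc c -> gt (cright c);
  st_cid : forall u, gl u -> gc (cid u);
  st_ccomp : forall a f bs, gc a -> gt f -> Forall gc bs -> composable V a f bs ->
      gc (ccomp a f bs);
  st_tid_dom : forall x, go x -> tdom (tid x) = x;
  st_tid_cod : forall x, go x -> tcod (tid x) = x;
  st_tcomp_dom : forall f g, gt f -> gt g -> tcod f = tdom g -> tdom (tcomp f g) = tdom f;
  st_tcomp_cod : forall f g, gt f -> gt g -> tcod f = tdom g -> tcod (tcomp f g) = tcod g;
  st_tcomp_idl : forall f, gt f -> tcomp (tid (tdom f)) f = f;
  st_tcomp_idr : forall f, gt f -> tcomp f (tid (tcod f)) = f;
  st_tcomp_assoc : forall f g h, gt f -> gt g -> gt h -> tcod f = tdom g -> tcod g = tdom h ->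
      tcomp (tcomp f g) h = tcomp f (tcomp g h);
  st_cell_path : forall c, gc c ->
      lpath_ok (@lsrc V) (@ltgt V) (tdom (cleft c)) (csrc c) (tdom (cright c));
  st_cell_tgt_src : forall c, gc c -> lsrc (ctgt c) = tcod (cleft c);
  st_cell_tgt_tgt : forall c, gc c -> ltgt (ctgt c) = tcod (cright c);
  st_cid_src : forall u, gl u -> csrc (cid u) = [u];
  st_cid_tgt : forall u, gl u -> ctgt (cid u) = u;
  st_cid_left : forall u, gl u -> cleft (cid u) = tid (lsrc u);
  st_cid_right : forall u, gl u -> cright (cid u) = tid (ltgt u);
  st_comp_src : forall a f bs, gc a -> gt f -> Forall gc bs -> composable V a f bs ->
      csrc (ccomp a f bs) = concat (map (@csrc V) bs);
  st_comp_tgt : forall a f bs, gc a -> gt f -> Forall gc bs -> composable V a f bs ->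
      ctgt (ccomp a f bs) = ctgt a;
  st_comp_left : forall a f bs, gc a -> gt f -> Forall gc bs -> composable V a f bs ->
      cleft (ccomp a f bs) = tcomp f (cleft a);
  st_comp_right : forall a f bs, gc a -> gt f -> Forall gc bs -> composable V a f bs ->
      cright (ccomp a f bs) = tcomp (vrow_end V f bs) (cright a)
}.

(* Since boundaries of composites are determined by [sub_typing], the remaining
   laws may be proved assuming that both sides are good and parallel. *)
Definition parallel (c d : cell V) : Prop :=
  gc c /\ gc d /\ csrc c = csrc d /\ ctgt c = ctgt d /\ cleft c = cleft d /\ cright c = cright d.

Record sub_laws : Prop := {
  sl_comp_idl : forall b, composable V (cid (ctgt b)) (cleft b) [b] ->
      parallel (ccomp (cid (ctgt b)) (cleft b) [b]) b ->
      ccomp (cid (ctgt b)) (cleft b) [b] = b;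
  sl_comp_idr : forall a,
      composable V a (tid (tdom (cleft a))) (map (@cid V) (csrc a)) ->
      parallel (ccomp a (tid (tdom (cleft a))) (map (@cid V) (csrc a))) a ->
      ccomp a (tid (tdom (cleft a))) (map (@cid V) (csrc a)) = a;
  sl_comp_assoc : forall a f bs g cs, gc a -> gt f -> Forall gc bs -> gt g -> Forall gc cs ->
      composable V a f bs -> stack V f bs g cs ->
      composable V (ccomp a f bs) g cs ->
      composable V a (tcomp g f) (vrow_comp V g bs cs) ->
      gc (ccomp a f bs) -> Forall gc (vrow_comp V g bs cs) ->
      parallel (ccomp (ccomp a f bs) g cs) (ccomp a (tcomp g f) (vrow_comp V g bs cs)) ->
      ccomp (ccomp a f bs) g cs = ccomp a (tcomp g f) (vrow_comp V g bs cs)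
}.

Context (ST : sub_typing).

Definition sub_data : vdc_data := {|
  ob := {x | go x};
  tarr := {f | gt f};
  larr := {u | gl u};
  cell := {c | gc c};
  tdom := fun f => exist go _ (st_tdom ST (proj2_sig f));
  tcod := fun f => exist go _ (st_tcod ST (proj2_sig f));
  tid := fun x => exist gt _ (st_tid ST (proj2_sig x));
  tcomp := fun f g => restrict_op (tcomp (proj1_sig f) (proj1_sig g)) f;
  lsrc := fun u => exist go _ (st_lsrc ST (proj2_sig u));
  ltgt := fun u => exist go _ (st_ltgt ST (proj2_sig u));
  csrc := fun c => list_sig (st_csrc ST (proj2_sig c));
  ctgt := fun c => exist gl _ (st_ctgt ST (proj2_sig c));
  cleft := fun c => exist gt _ (st_cleft ST (proj2_sig c));
  cright := fun c => exist gt _ (st_cright ST (proj2_sig c));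
  cid := fun u => exist gc _ (st_cid ST (proj2_sig u));
  ccomp := fun a f bs =>
    restrict_op (ccomp (proj1_sig a) (proj1_sig f) (map (@proj1_sig _ gc) bs)) a
|}.

Lemma sub_row_ok (f : tarr sub_data) (bs : list (cell sub_data)) :
  vrow_ok sub_data f bs <-> vrow_ok V (proj1_sig f) (map (@proj1_sig _ gc) bs).
Proof.
  unfold vrow_ok. revert f; induction bs as [|b bs IH]; simpl; intros f; [tauto|].
  rewrite IH. split; intros [H1 H2]; split; try assumption.
  - rewrite <- H1; reflexivity.
  - apply sig_inj; exact H1.
Qed.

Lemma sub_row_end (f : tarr sub_data) (bs : list (cell sub_data)) :
  proj1_sig (vrow_end sub_data f bs) = vrow_end V (proj1_sig f) (map (@proj1_sig _ gc) bs).
Proof.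
  unfold vrow_end. revert f; induction bs as [|b bs IH]; simpl; intros f; [reflexivity|].
  rewrite IH; reflexivity.
Qed.

Lemma sub_tgts (bs : list (cell sub_data)) :
  map (@proj1_sig _ gl) (map (@ctgt sub_data) bs) = map (@ctgt V) (map (@proj1_sig _ gc) bs).
Proof. rewrite !map_map; reflexivity. Qed.

Lemma sub_srcs (bs : list (cell sub_data)) :
  map (@proj1_sig _ gl) (concat (map (@csrc sub_data) bs)) =
  concat (map (@csrc V) (map (@proj1_sig _ gc) bs)).
Proof.
  rewrite concat_map, !map_map. f_equal. apply map_ext. intros c. apply list_sig_val.
Qed.

Lemma sub_composable (a : cell sub_data) (f : tarr sub_data) (bs : list (cell sub_data)) :
  composable sub_data a f bs <->
  composable V (proj1_sig a) (proj1_sig f) (map (@proj1_sig _ gc) bs).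
Proof.
  unfold composable. rewrite sub_row_ok, <- sub_tgts.
  rewrite <- (list_sig_val (st_csrc ST (proj2_sig a))).
  split; intros (H & H1 & H2); split; [assumption| |assumption|]; split.
  - rewrite H1; reflexivity.
  - exact (f_equal (@proj1_sig _ go) H2).
  - apply map_sig_inj; exact H1.
  - apply sig_inj; exact H2.
Qed.

Lemma sub_lpath (x y : ob sub_data) (p : list (larr sub_data)) :
  lpath_ok (@lsrc sub_data) (@ltgt sub_data) x p y <->
  lpath_ok (@lsrc V) (@ltgt V) (proj1_sig x) (map (@proj1_sig _ gl) p) (proj1_sig y).
Proof.
  revert x; induction p as [|u p IH]; simpl; intros x.
  - split; [intros ->; reflexivity|apply sig_inj].
  - rewrite IH. split; intros [H1 H2]; split; try assumption.
    + rewrite <- H1; reflexivity.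
    + apply sig_inj; exact H1.
Qed.

Lemma sub_comp_val (a : cell sub_data) (f : tarr sub_data) (bs : list (cell sub_data)) :
  composable sub_data a f bs ->
  proj1_sig (ccomp a f bs) = ccomp (proj1_sig a) (proj1_sig f) (map (@proj1_sig _ gc) bs).
Proof.
  intros H. apply restrict_op_val. apply (st_ccomp ST).
  - apply proj2_sig.
  - apply proj2_sig.
  - apply sig_list_good.
  - apply sub_composable, H.
Qed.

Lemma sub_tcomp_val (f g : tarr sub_data) : tcod f = tdom g ->
  proj1_sig (tcomp f g) = tcomp (proj1_sig f) (proj1_sig g).
Proof.
  intros H. apply restrict_op_val. apply (st_tcomp ST); try apply proj2_sig.
  exact (f_equal (@proj1_sig _ go) H).
Qed.

Definition sub_val : vmap sub_data V.
Proof.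
  refine (@VMap sub_data V (@proj1_sig _ go) (@proj1_sig _ gt) (@proj1_sig _ gl) (@proj1_sig _ gc)
    _ _ _ _ _ _ _ _ _ _ _ _); try reflexivity.
  - intros f g H. apply sub_tcomp_val, H.
  - intros c. symmetry. apply list_sig_val.
  - intros a f bs H. apply sub_comp_val, H.
Defined.

Lemma sub_typed : vdc_typing sub_data.
Proof.
  assert (E : forall f g : tarr sub_data, tcod f = tdom g ->
    tcod (proj1_sig f) = tdom (proj1_sig g)).
  { intros f g H. exact (f_equal (@proj1_sig _ go) H). }
  split.
  - intros x. apply sig_inj, (st_tid_dom ST), proj2_sig.
  - intros x. apply sig_inj, (st_tid_cod ST), proj2_sig.
  - intros f g H. apply sig_inj. simpl. rewrite restrict_op_val.
    + apply (st_tcomp_dom ST); try apply proj2_sig. apply E, H.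
    + apply (st_tcomp ST); try apply proj2_sig. apply E, H.
  - intros f g H. apply sig_inj. simpl. rewrite restrict_op_val.
    + apply (st_tcomp_cod ST); try apply proj2_sig. apply E, H.
    + apply (st_tcomp ST); try apply proj2_sig. apply E, H.
  - intros f. apply sig_inj. simpl.
    pose proof (st_tcomp_idl ST (proj2_sig f)) as H.
    rewrite restrict_op_val; [exact H|]. simpl. rewrite H. apply proj2_sig.
  - intros f. apply sig_inj. simpl.
    pose proof (st_tcomp_idr ST (proj2_sig f)) as H.
    rewrite restrict_op_val; [exact H|]. simpl. rewrite H. apply proj2_sig.
  - intros f g h H H1. apply sig_inj.
    assert (D1 : tcod (tcomp f g) = tdom h).
    { apply sig_inj. simpl. rewrite restrict_op_val.
      - rewrite (st_tcomp_cod ST); try apply proj2_sig; apply E; assumption.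
      - apply (st_tcomp ST); try apply proj2_sig. apply E, H. }
    assert (D2 : tcod f = tdom (tcomp g h)).
    { apply sig_inj. simpl. rewrite restrict_op_val.
      - rewrite (st_tcomp_dom ST); try apply proj2_sig; apply E; assumption.
      - apply (st_tcomp ST); try apply proj2_sig. apply E, H1. }
    rewrite !sub_tcomp_val by assumption.
    apply (st_tcomp_assoc ST); try apply proj2_sig; apply E; assumption.
  - intros c. apply sub_lpath. simpl. rewrite list_sig_val. apply (st_cell_path ST), proj2_sig.
  - intros c. apply sig_inj, (st_cell_tgt_src ST), proj2_sig.
  - intros c. apply sig_inj, (st_cell_tgt_tgt ST), proj2_sig.
  - intros u. apply map_sig_inj. simpl. rewrite list_sig_val. apply (st_cid_src ST), proj2_sig.
  - intros u. apply sig_inj, (st_cid_tgt ST), proj2_sig.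
  - intros u. apply sig_inj, (st_cid_left ST), proj2_sig.
  - intros u. apply sig_inj, (st_cid_right ST), proj2_sig.
  - intros a f bs H. apply map_sig_inj. rewrite sub_srcs.
    etransitivity; [apply list_sig_val|]. rewrite (sub_comp_val H).
    apply (st_comp_src ST); try apply proj2_sig; [apply sig_list_good|apply sub_composable, H].
  - intros a f bs H. apply sig_inj.
    etransitivity; [exact (f_equal (@ctgt V) (sub_comp_val H))|].
    apply (st_comp_tgt ST); try apply proj2_sig; [apply sig_list_good|apply sub_composable, H].
  - intros a f bs H. apply sig_inj.
    etransitivity; [exact (f_equal (@cleft V) (sub_comp_val H))|].
    rewrite sub_tcomp_val by apply H.
    apply (st_comp_left ST); try apply proj2_sig; [apply sig_list_good|apply sub_composable, H].
  - intros a f bs H. apply sig_inj.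
    pose proof (proj1 (sub_composable _ _ _) H) as H'.
    assert (X : cright (proj1_sig (ccomp a f bs)) = tcomp (proj1_sig (vrow_end sub_data f bs))
      (proj1_sig (cright a))).
    { rewrite (sub_comp_val H), sub_row_end.
      apply (st_comp_right ST); try apply proj2_sig; [apply sig_list_good|exact H']. }
    etransitivity; [exact X|]. symmetry. apply restrict_op_val.
    rewrite <- X. apply (st_cright ST), proj2_sig.
Qed.

Lemma sub_parallel (c d : cell sub_data) : csrc c = csrc d -> ctgt c = ctgt d ->
  cleft c = cleft d -> cright c = cright d -> parallel (proj1_sig c) (proj1_sig d).
Proof.
  intros H1 H2 H3 H4. split; [apply proj2_sig|split; [apply proj2_sig|split; [|split; [|split]]]].
  - apply (f_equal (map (@proj1_sig _ gl))) in H1. simpl in H1.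
    rewrite !list_sig_val in H1. exact H1.
  - exact (f_equal (@proj1_sig _ gl) H2).
  - exact (f_equal (@proj1_sig _ gt) H3).
  - exact (f_equal (@proj1_sig _ gt) H4).
Qed.

Context (SL : sub_laws).

Lemma sub_axioms : vdc_axioms sub_data.
Proof.
  pose proof sub_typed as T.
  split; try (destruct T; assumption).
  - intros u f b H.
    assert (Hu : u = ctgt b).
    { destruct H as (_ & H & _). rewrite (ty_cid_src T) in H. injection H as <-. reflexivity. }
    assert (Hf : f = cleft b) by (symmetry; apply H). subst u f.
    apply sig_inj. rewrite (sub_comp_val H).
    apply (sl_comp_idl SL (b := proj1_sig b)).
    { exact (proj1 (sub_composable _ _ _) H). }
    pose proof (sub_parallel (c := ccomp (cid (ctgt b)) (cleft b) [b]) (d := b)) as K.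
    rewrite (sub_comp_val H) in K. apply K.
    + rewrite (ty_comp_src T H). simpl. apply app_nil_r.
    + rewrite (ty_comp_tgt T H). apply (ty_cid_tgt T).
    + rewrite (ty_comp_left T H), (ty_cid_left T), (ty_cell_tgt_src T). apply (ty_tcomp_idr T).
    + rewrite (ty_comp_right T H), (ty_cid_right T), (ty_cell_tgt_tgt T). apply (ty_tcomp_idr T).
  - intros a. pose proof (composable_idr T a) as H.
    apply sig_inj.
    pose proof (sub_parallel (c := ccomp a (tid (tdom (cleft a))) (map (@cid _) (csrc a)))
      (d := a)) as K.
    pose proof (proj1 (sub_composable _ _ _) H) as H'.
    rewrite (sub_comp_val H) in K |- *.
    assert (X : map (@proj1_sig _ gc) (map (@cid sub_data) (csrc a)) =
      map (@cid V) (csrc (proj1_sig a))).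
    { rewrite <- (list_sig_val (st_csrc ST (proj2_sig a))), !map_map. reflexivity. }
    rewrite X in *. apply (sl_comp_idr SL (a := proj1_sig a)); [exact H'|]. apply K.
    + rewrite (ty_comp_src T H). apply (cid_row_src T).
    + apply (ty_comp_tgt T H).
    + rewrite (ty_comp_left T H). apply (ty_tcomp_idl T).
    + rewrite (ty_comp_right T H).
      rewrite (proj2 (cid_row_ok T (ty_cell_path T a))). apply (ty_tcomp_idl T).
  - intros a f bs g cs H H1.
    pose proof (proj1 (composable_stack T g cs H) H1) as Hs.
    pose proof (composable_comp T H Hs) as H2.
    (* The boundary laws are already proved for [sub_data], so both bracketings are parallel there;
       [sub_val] carries this to the ambient data, where [sub_laws] expects it. *)
    assert (K : parallel (mcell sub_val (ccomp (ccomp a f bs) g cs))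
      (mcell sub_val (ccomp a (tcomp g f) (vrow_comp sub_data g bs cs)))).
    { apply sub_parallel.
      + rewrite (ty_comp_src T H1), (ty_comp_src T H2). symmetry. apply (stack_row_src T Hs).
      + rewrite (ty_comp_tgt T H1), (ty_comp_tgt T H2). apply (ty_comp_tgt T H).
      + rewrite (ty_comp_left T H1), (ty_comp_left T H2), (ty_comp_left T H).
      symmetry. apply (ty_tcomp_assoc T); [apply Hs|apply H].
      + rewrite (ty_comp_right T H1), (ty_comp_right T H2), (ty_comp_right T H).
      rewrite (stack_row_end T Hs). symmetry.
      apply (ty_tcomp_assoc T); [apply (stack_end T Hs)|apply (composable_end T H)]. }
    pose proof (vmap_row_comp sub_val T Hs) as E.
    pose proof (vmap_stack sub_val Hs) as Hs'.
    pose proof (vmap_composable sub_val H) as H'.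
    pose proof (vmap_composable sub_val H1) as H1'.
    pose proof (vmap_composable sub_val H2) as H2'.
    assert (G1 : gc (mcell sub_val (ccomp a f bs))) by exact (proj2_sig (ccomp a f bs)).
    assert (G2 : Forall gc (map (mcell sub_val) (vrow_comp sub_data g bs cs)))
      by apply sig_list_good.
    apply sig_inj.
    change (mcell sub_val (ccomp (ccomp a f bs) g cs) =
      mcell sub_val (ccomp a (tcomp g f) (vrow_comp sub_data g bs cs))).
    rewrite (m_ccomp sub_val H2), (m_ccomp sub_val H1) in K |- *.
    rewrite (m_ccomp sub_val H) in *. rewrite E in *.
    rewrite (m_tcomp sub_val) in * by apply Hs.
    apply (sl_comp_assoc SL); try assumption;
      first [exact (proj2_sig a)|exact (proj2_sig f)|exact (proj2_sig g)|apply sig_list_good|exact K].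
Qed.

Definition sub_vdc : vdc := Vdc sub_axioms.

End Sub.

Lemma map_sig_lift (X W : Type) (G : W -> Prop) (h : X -> W) (L : forall x, G (h x)) (l : list X) :
  map (@proj1_sig _ G) (map (fun x => exist G (h x) (L x)) l) = map h l.
Proof. rewrite map_map; reflexivity. Qed.

Definition sub_lift (A V : vdc_data) go gt gl gc (ST : @sub_typing V go gt gl gc)
  (F : vmap A V) (Lo : forall x, go (mob F x)) (Lt : forall x, gt (mtarr F x))
  (Ll : forall x, gl (mlarr F x)) (Lc : forall x, gc (mcell F x)) : vmap A (sub_data ST).
Proof.
  refine (@VMap A (sub_data ST) (fun x => exist go _ (Lo x)) (fun x => exist gt _ (Lt x))
    (fun x => exist gl _ (Ll x)) (fun x => exist gc _ (Lc x)) _ _ _ _ _ _ _ _ _ _ _ _); intros.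
  - apply sig_inj, m_tdom.
  - apply sig_inj, m_tcod.
  - apply sig_inj, m_tid.
  - apply sig_inj. rewrite sub_tcomp_val; simpl.
    + apply m_tcomp; assumption.
    + apply sig_inj. simpl. rewrite m_tcod, m_tdom, H; reflexivity.
  - apply sig_inj, m_lsrc.
  - apply sig_inj, m_ltgt.
  - apply map_sig_inj. etransitivity; [apply list_sig_val|]. rewrite map_sig_lift.
    apply m_csrc.
  - apply sig_inj, m_ctgt.
  - apply sig_inj, m_cleft.
  - apply sig_inj, m_cright.
  - apply sig_inj, m_cid.
  - apply sig_inj.
    pose proof (map_sig_lift Lc bs) as E.
    rewrite sub_comp_val; cbn [proj1_sig].
    + etransitivity; [apply m_ccomp; assumption|]. f_equal. symmetry. exact E.
    + apply sub_composable. cbn [proj1_sig].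
      refine (eq_ind_r (fun l => composable V _ _ l) _ E). apply (vmap_composable F), H.
Defined.

(** * Concrete pullbacks *)

Lemma combine_fst (A B : Type) (l : list A) (m : list B) :
  length l = length m -> map fst (combine l m) = l.
Proof.
  revert m; induction l as [|a l IH]; intros [|b m] H; try discriminate; simpl; [reflexivity|].
  rewrite IH; [reflexivity|]. injection H; auto.
Qed.

Lemma combine_snd (A B : Type) (l : list A) (m : list B) :
  length l = length m -> map snd (combine l m) = m.
Proof.
  revert m; induction l as [|a l IH]; intros [|b m] H; try discriminate; simpl; [reflexivity|].
  rewrite IH; [reflexivity|]. injection H; auto.
Qed.

Lemma map_pair_inj (A B : Type) (l m : list (A * B)) :
  map fst l = map fst m -> map snd l = map snd m -> l = m.
Proof.
  revert m; induction l as [|[a b] l IH]; intros [|[c d] m]; simpl; intros H H1;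
    try discriminate; [reflexivity|].
  injection H as -> H; injection H1 as -> H1. rewrite (IH _ H H1); reflexivity.
Qed.

Lemma combine_app (A B : Type) (l l' : list A) (m m' : list B) :
  length l = length m -> combine (l ++ l') (m ++ m') = combine l m ++ combine l' m'.
Proof.
  revert m; induction l as [|a l IH]; intros [|b m] H; try discriminate; simpl; [reflexivity|].
  rewrite IH; [reflexivity|]. injection H; auto.
Qed.

(** Raw data only: [combine] truncates when two multicells have different arities. The pairs kept in
    the pullback lie over a common multicell of [E], hence have equal arities. *)
Definition prod_data (X D : vdc_data) : vdc_data := {|
  ob := ob X * ob D;
  tarr := tarr X * tarr D;
  larr := larr X * larr D;
  cell := cell X * cell D;
  tdom := fun f => (tdom (fst f), tdom (snd f));
  tcod := fun f => (tcod (fst f), tcod (snd f));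
  tid := fun x => (tid (fst x), tid (snd x));
  tcomp := fun f g => (tcomp (fst f) (fst g), tcomp (snd f) (snd g));
  lsrc := fun u => (lsrc (fst u), lsrc (snd u));
  ltgt := fun u => (ltgt (fst u), ltgt (snd u));
  csrc := fun c => combine (csrc (fst c)) (csrc (snd c));
  ctgt := fun c => (ctgt (fst c), ctgt (snd c));
  cleft := fun c => (cleft (fst c), cleft (snd c));
  cright := fun c => (cright (fst c), cright (snd c));
  cid := fun u => (cid (fst u), cid (snd u));
  ccomp := fun a f bs =>
    (ccomp (fst a) (fst f) (map fst bs), ccomp (snd a) (snd f) (map snd bs))
|}.

Lemma prod_row_ok (X D : vdc_data) (f : tarr (prod_data X D)) bs :
  vrow_ok (prod_data X D) f bs <->
  vrow_ok X (fst f) (map fst bs) /\ vrow_ok D (snd f) (map snd bs).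
Proof.
  unfold vrow_ok. revert f; induction bs as [|b bs IH]; simpl; intros [f1 f2]; [tauto|].
  rewrite IH; simpl. split.
  - intros [H1 H2]; injection H1; tauto.
  - intros [[H1 H2] [H3 H4]]; rewrite H1, H3; tauto.
Qed.

Lemma prod_row_end (X D : vdc_data) (f : tarr (prod_data X D)) bs :
  vrow_end (prod_data X D) f bs =
  (vrow_end X (fst f) (map fst bs), vrow_end D (snd f) (map snd bs)).
Proof.
  unfold vrow_end. revert f; induction bs as [|b bs IH]; simpl; intros [f1 f2]; [reflexivity|].
  rewrite IH; reflexivity.
Qed.

Lemma prod_lpath (X D : vdc_data) (x y : ob (prod_data X D)) p :
  lpath_ok (@lsrc X) (@ltgt X) (fst x) (map fst p) (fst y) ->
  lpath_ok (@lsrc D) (@ltgt D) (snd x) (map snd p) (snd y) ->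
  lpath_ok (@lsrc (prod_data X D)) (@ltgt (prod_data X D)) x p y.
Proof.
  revert x; induction p as [|u p IH]; simpl; intros [x1 x2].
  - destruct y; simpl; congruence.
  - simpl. intros [H1 H2] [H3 H4]. rewrite H1, H3. split; [reflexivity|]. apply IH; assumption.
Qed.

Section Pullback.
Context (X D E : vdc) (x : vdf X E) (P : vdf D E).

Let V := prod_data X D.
Definition pb_o (p : ob V) : Prop := fob x (fst p) = fob P (snd p).
Definition pb_t (p : tarr V) : Prop := ftarr x (fst p) = ftarr P (snd p).
Definition pb_l (p : larr V) : Prop := flarr x (fst p) = flarr P (snd p).
Definition pb_c (p : cell V) : Prop := fcell x (fst p) = fcell P (snd p).

Lemma pb_src_length (c : cell V) : pb_c c -> length (csrc (fst c)) = length (csrc (snd c)).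
Proof.
  intros H. rewrite <- (length_map (flarr x)), <- (length_map (flarr P)).
  rewrite <- !f_csrc, H. reflexivity.
Qed.

Lemma pb_composable (a : cell V) f bs : pb_c a -> composable V a f bs ->
  composable X (fst a) (fst f) (map fst bs) /\ composable D (snd a) (snd f) (map snd bs).
Proof.
  intros Ha (H & H1 & H2). apply prod_row_ok in H. injection H2 as H3 H4.
  pose proof (pb_src_length Ha) as L. simpl in H1.
  split; (split; [apply H|split; [|assumption]]); rewrite map_map.
  - rewrite <- (combine_fst L), <- H1, map_map. reflexivity.
  - rewrite <- (combine_snd L), <- H1, map_map. reflexivity.
Qed.

Lemma pb_map_cells (bs : list (cell V)) : Forall pb_c bs ->
  map (fcell x) (map fst bs) = map (fcell P) (map snd bs).
Proof.
  intros H. rewrite !map_map. induction H as [|b bs Hb _ IH]; simpl; [reflexivity|].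
  rewrite IH, Hb. reflexivity.
Qed.

Lemma pb_combine_good (l : list (larr X)) (m : list (larr D)) :
  map (flarr x) l = map (flarr P) m -> Forall pb_l (combine l m).
Proof.
  revert m; induction l as [|u l IH]; intros [|v m] H; simpl; constructor.
  - injection H; auto.
  - apply IH. injection H; auto.
Qed.

Lemma prod_srcs (bs : list (cell V)) : Forall pb_c bs ->
  concat (map (@csrc V) bs) =
  combine (concat (map (@csrc X) (map fst bs))) (concat (map (@csrc D) (map snd bs))).
Proof.
  induction 1 as [|b bs Hb _ IH]; [reflexivity|].
  cbn [map concat]. rewrite IH. symmetry. apply combine_app, pb_src_length, Hb.
Qed.

Lemma pb_sub_typing : sub_typing (V := V) pb_o pb_t pb_l pb_c.
Proof.
  pose proof (vaxioms X) as AX. pose proof (vaxioms D) as AD.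
  split; unfold pb_o, pb_t, pb_l, pb_c; simpl.
  - intros f H. rewrite <- !f_tdom, H; reflexivity.
  - intros f H. rewrite <- !f_tcod, H; reflexivity.
  - intros o H. rewrite !f_tid, H; reflexivity.
  - intros f g H1 H2 H. injection H as H3 H4. rewrite !f_tcomp, H1, H2 by assumption. reflexivity.
  - intros u H. rewrite <- !f_lsrc, H; reflexivity.
  - intros u H. rewrite <- !f_ltgt, H; reflexivity.
  - intros c H. apply pb_combine_good. rewrite <- !f_csrc, H; reflexivity.
  - intros c H. rewrite <- !f_ctgt, H; reflexivity.
  - intros c H. rewrite <- !f_cleft, H; reflexivity.
  - intros c H. rewrite <- !f_cright, H; reflexivity.
  - intros u H. rewrite !f_cid, H; reflexivity.
  - intros a f bs Ha Hf Hb H. destruct (pb_composable Ha H) as [H1 H2].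
    rewrite (f_ccomp x H1), (f_ccomp P H2), (pb_map_cells Hb), Ha, Hf. reflexivity.
  - intros [o1 o2] _; simpl. rewrite (ax_tid_dom AX), (ax_tid_dom AD); reflexivity.
  - intros [o1 o2] _; simpl. rewrite (ax_tid_cod AX), (ax_tid_cod AD); reflexivity.
  - intros f g _ _ H; injection H as H1 H2.
    rewrite (ax_tcomp_dom AX), (ax_tcomp_dom AD) by assumption; reflexivity.
  - intros f g _ _ H; injection H as H1 H2.
    rewrite (ax_tcomp_cod AX), (ax_tcomp_cod AD) by assumption; reflexivity.
  - intros [f1 f2] _; simpl. rewrite (ax_tcomp_idl AX), (ax_tcomp_idl AD); reflexivity.
  - intros [f1 f2] _; simpl. rewrite (ax_tcomp_idr AX), (ax_tcomp_idr AD); reflexivity.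
  - intros f g h _ _ _ H H0; injection H as H1 H2; injection H0 as H3 H4.
    rewrite (ax_tcomp_assoc AX), (ax_tcomp_assoc AD) by assumption; reflexivity.
  - intros c H. pose proof (pb_src_length H) as L. simpl in L.
    apply prod_lpath; simpl; rewrite ?(combine_fst L), ?(combine_snd L);
      [apply (ax_cell_path AX)|apply (ax_cell_path AD)].
  - intros c H. rewrite (ax_cell_tgt_src AX), (ax_cell_tgt_src AD); reflexivity.
  - intros c H. rewrite (ax_cell_tgt_tgt AX), (ax_cell_tgt_tgt AD); reflexivity.
  - intros [u1 u2] _; simpl. rewrite (ax_cid_src AX), (ax_cid_src AD); reflexivity.
  - intros [u1 u2] _; simpl. rewrite (ax_cid_tgt AX), (ax_cid_tgt AD); reflexivity.
  - intros [u1 u2] _; simpl. rewrite (ax_cid_left AX), (ax_cid_left AD); reflexivity.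
  - intros [u1 u2] _; simpl. rewrite (ax_cid_right AX), (ax_cid_right AD); reflexivity.
  - intros a f bs Ha Hf Hb H. destruct (pb_composable Ha H) as [H1 H2].
    etransitivity; [|symmetry; apply (prod_srcs Hb)].
    rewrite (ax_comp_src AX H1), (ax_comp_src AD H2). reflexivity.
  - intros a f bs Ha Hf Hb H. destruct (pb_composable Ha H) as [H1 H2].
    rewrite (ax_comp_tgt AX H1), (ax_comp_tgt AD H2). reflexivity.
  - intros a f bs Ha Hf Hb H. destruct (pb_composable Ha H) as [H1 H2].
    rewrite (ax_comp_left AX H1), (ax_comp_left AD H2). reflexivity.
  - intros a f bs Ha Hf Hb H. destruct (pb_composable Ha H) as [H1 H2].
    rewrite (ax_comp_right AX H1), (ax_comp_right AD H2).
    rewrite (prod_row_end (X := X) (D := D)). reflexivity.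
Qed.

(** By equality of arities both components cut the upper row at the same places. *)
Lemma vrow_comp_prod bs : Forall pb_c bs -> forall (g : tarr V) cs,
  map fst (vrow_comp V g bs cs) = vrow_comp X (fst g) (map fst bs) (map fst cs) /\
  map snd (vrow_comp V g bs cs) = vrow_comp D (snd g) (map snd bs) (map snd cs).
Proof.
  induction 1 as [|b bs Hb _ IH]; intros g cs; [split; reflexivity|].
  unfold vrow_comp in *; cbn [map row_comp].
  replace (length (csrc b)) with (length (csrc (snd b)))
    by (symmetry; simpl; rewrite length_combine, (pb_src_length Hb); apply Nat.min_id).
  rewrite (pb_src_length Hb).
  set (k := length (csrc (snd b))).
  destruct (IH (row_end (@cright V) g (firstn k cs)) (skipn k cs)) as [I1 I2].
  rewrite I1, I2. clear I1 I2.
  assert (R : row_end (@cright V) g (firstn k cs) =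
    (row_end (@cright X) (fst g) (map fst (firstn k cs)),
     row_end (@cright D) (snd g) (map snd (firstn k cs)))) by apply prod_row_end.
  rewrite R.
  simpl. rewrite !firstn_map, !skipn_map. split; reflexivity.
Qed.

Lemma pb_sub_laws : sub_laws (V := V) pb_t pb_c.
Proof.
  pose proof (vaxioms X) as AX. pose proof (vaxioms D) as AD.
  split.
  - intros [b1 b2] H (_ & Hb & _). simpl.
    rewrite (ax_comp_idl AX), (ax_comp_idl AD); [reflexivity| |].
    + apply (composable_idl (vdc_axioms_typing AD)).
    + apply (composable_idl (vdc_axioms_typing AX)).
  - intros a H (_ & Ha & _). pose proof (pb_src_length Ha) as L. simpl.
    rewrite !map_map. simpl.
    rewrite <- (map_map fst (@cid X)), <- (map_map snd (@cid D)), (combine_fst L), (combine_snd L).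
    rewrite (ax_comp_idr AX), (ax_comp_idr AD). symmetry; apply surjective_pairing.
  - intros a f bs g cs Ha Hf Hb Hg Hc H Hs H1 H2 Hab _ _.
    destruct (pb_composable Ha H) as [C1 C2].
    destruct (pb_composable Hab H1) as [C3 C4].
    destruct (vrow_comp_prod Hb g cs) as [R1 R2].
    etransitivity; [apply (f_equal2 pair); [apply (ax_comp_assoc AX C1 C3)|
      apply (ax_comp_assoc AD C2 C4)]|].
    rewrite <- R1, <- R2. reflexivity.
Qed.

Definition pb_vdc : vdc := sub_vdc pb_sub_typing pb_sub_laws.

Definition pb_fst : vdf pb_vdc X.
Proof.
  refine (@Vdf pb_vdc X (fun p => fst (proj1_sig p)) (fun p => fst (proj1_sig p))
    (fun p => fst (proj1_sig p)) (fun p => fst (proj1_sig p)) _ _ _ _ _ _ _ _ _ _ _ _);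
    try reflexivity.
  - intros f g H. exact (f_equal fst (sub_tcomp_val (ST := pb_sub_typing) H)).
  - intros [c Hc]. symmetry. change (map (fun p => fst (proj1_sig p))
      (list_sig (st_csrc pb_sub_typing Hc)) = csrc (fst c)).
    rewrite <- (map_map (@proj1_sig _ pb_l) fst), list_sig_val. apply combine_fst, pb_src_length, Hc.
  - intros a f bs H. etransitivity; [exact (f_equal fst (sub_comp_val (ST := pb_sub_typing) H))|].
    rewrite <- (map_map (@proj1_sig _ pb_c) fst). reflexivity.
Defined.

Definition pb_snd : vdf pb_vdc D.
Proof.
  refine (@Vdf pb_vdc D (fun p => snd (proj1_sig p)) (fun p => snd (proj1_sig p))
    (fun p => snd (proj1_sig p)) (fun p => snd (proj1_sig p)) _ _ _ _ _ _ _ _ _ _ _ _);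
    try reflexivity.
  - intros f g H. exact (f_equal snd (sub_tcomp_val (ST := pb_sub_typing) H)).
  - intros [c Hc]. symmetry. change (map (fun p => snd (proj1_sig p))
      (list_sig (st_csrc pb_sub_typing Hc)) = csrc (snd c)).
    rewrite <- (map_map (@proj1_sig _ pb_l) snd), list_sig_val. apply combine_snd, pb_src_length, Hc.
  - intros a f bs H. etransitivity; [exact (f_equal snd (sub_comp_val (ST := pb_sub_typing) H))|].
    rewrite <- (map_map (@proj1_sig _ pb_c) snd). reflexivity.
Defined.

Lemma pb_square : vdf_sq pb_fst x pb_snd P.
Proof. split; [|split; [|split]]; intros p; exact (proj2_sig p). Qed.

Lemma combine_map (A B C : Type) (f : A -> B) (g : A -> C) l :
  combine (map f l) (map g l) = map (fun a => (f a, g a)) l.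
Proof. induction l as [|a l IH]; simpl; congruence. Qed.

Section Pairing.
Context (W : vdc) (u : vdf W X) (v : vdf W D) (S : vdf_sq u x v P).

Definition pair_vmap : vmap W V.
Proof.
  refine (@VMap W V (fun w => (fob u w, fob v w)) (fun w => (ftarr u w, ftarr v w))
    (fun w => (flarr u w, flarr v w)) (fun w => (fcell u w, fcell v w))
    _ _ _ _ _ _ _ _ _ _ _ _); intros; simpl.
  - rewrite !f_tdom; reflexivity.
  - rewrite !f_tcod; reflexivity.
  - rewrite !f_tid; reflexivity.
  - rewrite !f_tcomp by assumption; reflexivity.
  - rewrite !f_lsrc; reflexivity.
  - rewrite !f_ltgt; reflexivity.
  - rewrite !f_csrc; apply combine_map.
  - rewrite !f_ctgt; reflexivity.
  - rewrite !f_cleft; reflexivity.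
  - rewrite !f_cright; reflexivity.
  - rewrite !f_cid; reflexivity.
  - rewrite !f_ccomp by assumption. rewrite !map_map. reflexivity.
Defined.

Definition pb_pair : vdf W pb_vdc :=
  vdf_of_vmap (A := W) (B := pb_vdc)
    (sub_lift pb_sub_typing (F := pair_vmap) (proj1 S) (proj1 (proj2 S))
      (proj1 (proj2 (proj2 S))) (proj2 (proj2 (proj2 S)))).

End Pairing.

Definition pbo c d (H : fob x c = fob P d) : ob pb_vdc := exist pb_o (c, d) H.
Definition pbt c d (H : ftarr x c = ftarr P d) : tarr pb_vdc := exist pb_t (c, d) H.
Definition pbl c d (H : flarr x c = flarr P d) : larr pb_vdc := exist pb_l (c, d) H.
Definition pbc c d (H : fcell x c = fcell P d) : cell pb_vdc := exist pb_c (c, d) H.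

Lemma pb_composable_intro a f bs :
  composable X (fcell pb_fst a) (ftarr pb_fst f) (map (fcell pb_fst) bs) ->
  composable D (fcell pb_snd a) (ftarr pb_snd f) (map (fcell pb_snd) bs) ->
  composable pb_vdc a f bs.
Proof.
  intros (H1 & H2 & H3) (K1 & K2 & K3). split; [|split].
  - clear H2 H3 K2 K3. unfold vrow_ok in *. revert f H1 K1.
    induction bs as [|b bs IH]; simpl; intros f H1 K1; [exact I|].
    destruct H1 as [H1 H2], K1 as [K1 K2].
    split; [apply sig_inj, injective_projections; assumption|]. apply IH; assumption.
  - clear - H2 K2. apply map_sig_inj, map_pair_inj.
    + rewrite !map_map. rewrite map_map in H2.
      etransitivity; [exact H2|]. exact (f_csrc pb_fst a).
    + rewrite !map_map. rewrite map_map in K2.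
      etransitivity; [exact K2|]. exact (f_csrc pb_snd a).
  - apply sig_inj, injective_projections; assumption.
Qed.

Lemma pb_is_pullback : is_pullback x P pb_fst pb_snd.
Proof.
  split; [apply pb_square|]. intros W u v S. exists (pb_pair S).
  split; [|split].
  - repeat split; intros; reflexivity.
  - repeat split; intros; reflexivity.
  - intros w' (H1 & H2 & H3 & H4) (H1' & H2' & H3' & H4').
    split; [|split; [|split]]; intros a; apply sig_inj; apply injective_projections; symmetry;
      first [exact (H1 a)|exact (H2 a)|exact (H3 a)|exact (H4 a)|
             exact (H1' a)|exact (H2' a)|exact (H3' a)|exact (H4' a)].
Qed.

(** The identity of [X'] and the passage through [pb_vdc] both factor the cone [(p1, p2)] through
    itself, so the uniqueness clause identifies them. *)
Lemma pullback_iso (X' : vdc) (p1 : vdf X' X) (p2 : vdf X' D) : is_pullback x P p1 p2 ->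
  exists (i : vdf pb_vdc X') (j : vdf X' pb_vdc),
    vdf_tri i p1 pb_fst /\ vdf_tri i p2 pb_snd /\
    vdf_tri j pb_fst p1 /\ vdf_tri j pb_snd p2 /\
    vdf_tri j i (vdf_id X').
Proof.
  intros [Sq Un]. destruct (Un _ _ _ pb_square) as (i & I1 & I2 & _).
  exists i, (pb_pair Sq).
  split; [exact I1|split; [exact I2|]].
  split; [repeat split; intros; reflexivity|].
  split; [repeat split; intros; reflexivity|].
  destruct (Un _ _ _ Sq) as (w & _ & _ & U).
  assert (K : forall w' : vdf X' X', vdf_tri w' p1 p1 -> vdf_tri w' p2 p2 ->
    vdf_eq w w') by (intros; apply U; assumption).
  destruct I1 as (A1 & A2 & A3 & A4), I2 as (B1 & B2 & B3 & B4).
  destruct (K (vdf_comp (pb_pair Sq) i)) as (C1 & C2 & C3 & C4).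
  { split; [|split; [|split]]; intros a; simpl; rewrite ?A1, ?A2, ?A3, ?A4; reflexivity. }
  { split; [|split; [|split]]; intros a; simpl; rewrite ?B1, ?B2, ?B3, ?B4; reflexivity. }
  destruct (K (vdf_id X')) as (D1 & D2 & D3 & D4); try (repeat split; intros; reflexivity).
  split; [|split; [|split]]; intros a; simpl in *; congruence.
Qed.

End Pullback.

(** * Exponentiability in terms of concrete pullbacks *)

Section Interface.
Context (D E : vdc) (P : vdf D E).

(** Elementwise form of the triangle: [eps] after the map of pullbacks induced by [h] equals [g].
    That induced map need not be constructed, and quantifying over both membership proofs makes the
    condition independent of their choice. *)
Definition transposes (Y R X : vdc) (r : vdf R E) (eps : vdf (pb_vdc r P) Y) (x : vdf X E)
  (g : vdf (pb_vdc x P) Y) (h : vdf X R) : Prop :=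
  vdf_tri h r x /\
  (forall c d (H : fob x c = fob P d) (H' : fob r (fob h c) = fob P d),
     fob eps (pbo H') = fob g (pbo H)) /\
  (forall c d (H : ftarr x c = ftarr P d) (H' : ftarr r (ftarr h c) = ftarr P d),
     ftarr eps (pbt H') = ftarr g (pbt H)) /\
  (forall c d (H : flarr x c = flarr P d) (H' : flarr r (flarr h c) = flarr P d),
     flarr eps (pbl H') = flarr g (pbl H)) /\
  (forall c d (H : fcell x c = fcell P d) (H' : fcell r (fcell h c) = fcell P d),
     fcell eps (pbc H') = fcell g (pbc H)).

Definition concretely_exponentiable : Prop :=
  forall Y : vdc, exists (R : vdc) (r : vdf R E) (eps : vdf (pb_vdc r P) Y),
    forall (X : vdc) (x : vdf X E) (g : vdf (pb_vdc x P) Y),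
      exists h : vdf X R, transposes eps g h /\
        forall h2 : vdf X R, transposes eps g h2 -> vdf_eq h h2.

Lemma square_comp_l (X R X' : vdc) (h : vdf X R) (r : vdf R E) (x : vdf X E)
  (p1 : vdf X' X) (p2 : vdf X' D) : vdf_tri h r x -> vdf_sq p1 x p2 P ->
  vdf_sq (vdf_comp p1 h) r p2 P.
Proof.
  intros (A1 & A2 & A3 & A4) (B1 & B2 & B3 & B4).
  split; [|split; [|split]]; intros a; simpl; congruence.
Qed.

Lemma exponentiable_of_concrete : concretely_exponentiable -> exponentiable P.
Proof.
  intros HC Y. destruct (HC Y) as (R & r & eps & U).
  exists R, r, (pb_vdc r P), (pb_fst r P), (pb_snd r P), eps.
  split; [apply pb_is_pullback|].
  intros X x X' p1 p2 HX g.
  destruct (pullback_iso HX) as (i & j & I1 & I2 & J1 & J2 & JI).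
  destruct I1 as (I1a & I1b & I1c & I1d), I2 as (I2a & I2b & I2c & I2d),
    J1 as (J1a & J1b & J1c & J1d), J2 as (J2a & J2b & J2c & J2d), JI as (Ja & Jb & Jc & Jd).
  pose proof (proj1 HX) as Sq.
  destruct (U X x (vdf_comp i g)) as (h & (T & Ta & Tb & Tc & Td) & Hu).
  exists h. split; [split; [exact T|]|].
  - exists (pb_pair (square_comp_l T Sq)).
    split; [repeat split; intros; reflexivity|].
    split; [repeat split; intros; reflexivity|].
    destruct Sq as (S1 & S2 & S3 & S4).
    split; [|split; [|split]]; intros a.
    + etransitivity; [apply (Ta _ _ (S1 a))|]. simpl. f_equal. etransitivity; [|exact (Ja a)]. simpl.
      f_equal. apply sig_inj, injective_projections; symmetry; [apply J1a|apply J2a].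
    + etransitivity; [apply (Tb _ _ (S2 a))|]. simpl. f_equal. etransitivity; [|exact (Jb a)]. simpl.
      f_equal. apply sig_inj, injective_projections; symmetry; [apply J1b|apply J2b].
    + etransitivity; [apply (Tc _ _ (S3 a))|]. simpl. f_equal. etransitivity; [|exact (Jc a)]. simpl.
      f_equal. apply sig_inj, injective_projections; symmetry; [apply J1c|apply J2c].
    + etransitivity; [apply (Td _ _ (S4 a))|]. simpl. f_equal. etransitivity; [|exact (Jd a)]. simpl.
      f_equal. apply sig_inj, injective_projections; symmetry; [apply J1d|apply J2d].
  - intros h2 (T2 & h2' & (A1 & A2 & A3 & A4) & (B1 & B2 & B3 & B4) & (C1 & C2 & C3 & C4)).
    apply Hu. split; [exact T2|].
    split; [|split; [|split]]; intros c d H H'; simpl.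
    + rewrite <- C1. f_equal. apply sig_inj, injective_projections; simpl; symmetry.
      * etransitivity; [apply A1|]. rewrite I1a. reflexivity.
      * etransitivity; [apply B1|]. apply I2a.
    + rewrite <- C2. f_equal. apply sig_inj, injective_projections; simpl; symmetry.
      * etransitivity; [apply A2|]. rewrite I1b. reflexivity.
      * etransitivity; [apply B2|]. apply I2b.
    + rewrite <- C3. f_equal. apply sig_inj, injective_projections; simpl; symmetry.
      * etransitivity; [apply A3|]. rewrite I1c. reflexivity.
      * etransitivity; [apply B3|]. apply I2c.
    + rewrite <- C4. f_equal. apply sig_inj, injective_projections; simpl; symmetry.
      * etransitivity; [apply A4|]. rewrite I1d. reflexivity.
      * etransitivity; [apply B4|]. apply I2d.
Qed.

Lemma concrete_of_exponentiable : exponentiable P -> concretely_exponentiable.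
Proof.
  intros HE Y. destruct (HE Y) as (R & r & R' & q1 & q2 & eps & HR & U).
  destruct (pullback_iso HR) as (i & j & I1 & I2 & J1 & J2 & JI).
  exists R, r, (vdf_comp i eps).
  (* The projections of the abstract pullback are jointly injective, because [j] embeds it in the
     concrete one with retraction [i]. *)
  assert (Inj : (forall a b, fob q1 a = fob q1 b -> fob q2 a = fob q2 b -> a = b) /\
    (forall a b, ftarr q1 a = ftarr q1 b -> ftarr q2 a = ftarr q2 b -> a = b) /\
    (forall a b, flarr q1 a = flarr q1 b -> flarr q2 a = flarr q2 b -> a = b) /\
    (forall a b, fcell q1 a = fcell q1 b -> fcell q2 a = fcell q2 b -> a = b)).
  { destruct J1 as (J1a & J1b & J1c & J1d), J2 as (J2a & J2b & J2c & J2d),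
      JI as (Ja & Jb & Jc & Jd).
    split; [|split; [|split]]; intros a b K1 K2.
    - transitivity (fob i (fob j a)); [symmetry; exact (Ja a)|].
      transitivity (fob i (fob j b)); [|exact (Ja b)]. f_equal. apply sig_inj, injective_projections.
      + etransitivity; [apply J1a|]. rewrite K1; symmetry; apply J1a.
      + etransitivity; [apply J2a|]. rewrite K2; symmetry; apply J2a.
    - transitivity (ftarr i (ftarr j a)); [symmetry; exact (Jb a)|].
      transitivity (ftarr i (ftarr j b)); [|exact (Jb b)]. f_equal. apply sig_inj, injective_projections.
      + etransitivity; [apply J1b|]. rewrite K1; symmetry; apply J1b.
      + etransitivity; [apply J2b|]. rewrite K2; symmetry; apply J2b.
    - transitivity (flarr i (flarr j a)); [symmetry; exact (Jc a)|].
      transitivity (flarr i (flarr j b)); [|exact (Jc b)]. f_equal. apply sig_inj, injective_projections.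
      + etransitivity; [apply J1c|]. rewrite K1; symmetry; apply J1c.
      + etransitivity; [apply J2c|]. rewrite K2; symmetry; apply J2c.
    - transitivity (fcell i (fcell j a)); [symmetry; exact (Jd a)|].
      transitivity (fcell i (fcell j b)); [|exact (Jd b)]. f_equal. apply sig_inj, injective_projections.
      + etransitivity; [apply J1d|]. rewrite K1; symmetry; apply J1d.
      + etransitivity; [apply J2d|]. rewrite K2; symmetry; apply J2d. }
  intros X x g.
  destruct (U X x _ _ _ (pb_is_pullback x P) g) as (h & (T & h' & A & B & C) & Hu).
  exists h. destruct I1 as (I1a & I1b & I1c & I1d), I2 as (I2a & I2b & I2c & I2d).
  destruct Inj as (Ia & Ib & Ic & Id).
  split.
  - destruct A as (A1 & A2 & A3 & A4), B as (B1 & B2 & B3 & B4), C as (C1 & C2 & C3 & C4).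
    split; [exact T|].
    split; [|split; [|split]]; intros c d H H'.
    + rewrite <- C1. simpl. f_equal. apply Ia.
      * rewrite I1a, A1. reflexivity.
      * rewrite I2a, B1. reflexivity.
    + rewrite <- C2. simpl. f_equal. apply Ib.
      * rewrite I1b, A2. reflexivity.
      * rewrite I2b, B2. reflexivity.
    + rewrite <- C3. simpl. f_equal. apply Ic.
      * rewrite I1c, A3. reflexivity.
      * rewrite I2c, B3. reflexivity.
    + rewrite <- C4. simpl. f_equal. apply Id.
      * rewrite I1d, A4. reflexivity.
      * rewrite I2d, B4. reflexivity.
  - intros h2 (T2 & K1 & K2 & K3 & K4). apply Hu. split; [exact T2|].
    pose proof (square_comp_l T2 (pb_square x P)) as S2.
    exists (vdf_comp (pb_pair S2) i).
    split; [|split].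
    + split; [|split; [|split]]; intros a; simpl.
      * rewrite I1a; reflexivity.
      * rewrite I1b; reflexivity.
      * rewrite I1c; reflexivity.
      * rewrite I1d; reflexivity.
    + split; [|split; [|split]]; intros a; simpl.
      * rewrite I2a; reflexivity.
      * rewrite I2b; reflexivity.
      * rewrite I2c; reflexivity.
      * rewrite I2d; reflexivity.
    + split; [|split; [|split]]; intros [[c d] H].
      * apply (K1 c d H).
      * apply (K2 c d H).
      * apply (K3 c d H).
      * apply (K4 c d H).
Qed.

End Interface.

(** * Decompositions of height two *)

Section HeightTwo.
Context {D E : vdc} (P : vdf D E).

Definition vert_t (m : tarr D) : Prop := ftarr P m = tid (fob P (tdom m)).
Definition vert_c (c : cell D) : Prop := fcell P c = cid (ctgt (fcell P c)).

Definition pair_of (a x z : tarr D) : Prop := tcod x = tdom z /\ a = tcomp x z.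

(** A morphism of factorizations of length two: the outer components are identities, and the two
    squares say that the first factors are [x] and [x] followed by [m], the second ones [m] followed
    by [z] and [z]. *)
Definition step_t (p q : tarr D * tarr D) : Prop :=
  exists x m z, tcod x = tdom m /\ tcod m = tdom z /\ vert_t m /\
    p = (x, tcomp m z) /\ q = (tcomp x m, z).

(** The zigzag ranges over all pairs: by [step_t_inv] a step keeps the composite and both images, so
    the zigzag stays over the given factorization by itself. *)
Definition two_factorizations : Prop :=
  forall a b1 b2, tcod b1 = tdom b2 -> ftarr P a = tcomp b1 b2 ->
    (exists x z, pair_of a x z /\ ftarr P x = b1 /\ ftarr P z = b2) /\
    forall x z x' z', pair_of a x z -> ftarr P x = b1 -> ftarr P z = b2 ->
      pair_of a x' z' -> ftarr P x' = b1 -> ftarr P z' = b2 ->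
      clos_refl_sym_trans _ step_t (x, z) (x', z').

Definition stack_of (a c : cell D) (f : tarr D) (bs : list (cell D)) : Prop :=
  composable D c f bs /\ a = ccomp c f bs.

(** Three layers [c], [(m, ss)], [(f, bs)] with a vertical one in the middle; the two decompositions
    absorb the middle layer downwards and upwards. *)
Definition step_c (p q : cell D * tarr D * list (cell D)) : Prop :=
  exists c m ss f bs, composable D c m ss /\ stack D m ss f bs /\
    vert_t m /\ Forall vert_c ss /\
    p = (ccomp c m ss, f, bs) /\ q = (c, tcomp f m, vrow_comp D f ss bs).

Definition two_decompositions : Prop :=
  forall a c f bs, composable E c f bs -> fcell P a = ccomp c f bs ->
    (exists c' f' bs', stack_of a c' f' bs' /\
       fcell P c' = c /\ ftarr P f' = f /\ map (fcell P) bs' = bs) /\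
    forall c1 f1 bs1 c2 f2 bs2,
      stack_of a c1 f1 bs1 -> fcell P c1 = c -> ftarr P f1 = f -> map (fcell P) bs1 = bs ->
      stack_of a c2 f2 bs2 -> fcell P c2 = c -> ftarr P f2 = f -> map (fcell P) bs2 = bs ->
      clos_refl_sym_trans _ step_c (c1, f1, bs1) (c2, f2, bs2).

Let AD := vaxioms D.
Let TD := vdc_axioms_typing AD.
Let AE := vaxioms E.
Let MP := vmap_of_vdf P.

Lemma crst_map (A B : Type) (R : A -> A -> Prop) (S : B -> B -> Prop) (h : A -> B) :
  (forall x y, R x y -> S (h x) (h y)) ->
  forall x y, clos_refl_sym_trans _ R x y -> clos_refl_sym_trans _ S (h x) (h y).
Proof.
  intros H x y K. induction K as [x y K|x|x y _ K|x y z _ K _ K'].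
  - apply rst_step, H, K.
  - apply rst_refl.
  - apply rst_sym, K.
  - eapply rst_trans; eassumption.
Qed.

Lemma two_factorizations_of_lifts : lifts_factorizations P -> two_factorizations.
Proof.
  intros L a b1 b2 Hc Ha.
  assert (F : is_factorization E (ftarr P a) [b1; b2]).
  { split; simpl; [|congruence]. rewrite Ha, (ax_tcomp_dom AE), (ax_tcomp_cod AE) by assumption.
    auto. }
  destruct (L a [b1; b2] (le_n 2) F) as [(xs & Fx & Ex) C].
  assert (Pair : forall x z, pair_of a x z -> is_factorization D a [x; z]).
  { intros x z (H & ->). split; simpl; [|congruence].
    rewrite (ax_tcomp_dom AD), (ax_tcomp_cod AD) by assumption. auto. }
  split.
  - destruct xs as [|x [|z [|]]]; try discriminate. simpl in Ex. injection Ex as E1 E2.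
    exists x, z. split; [|auto]. destruct Fx as [(_ & H & _) H']. simpl in H'.
    split; congruence.
  - intros x z x' z' H H1 H2 H' H1' H2'.
    assert (K : clos_refl_sym_trans _ (fun u v =>
      (is_factorization D a u /\ map (ftarr P) u = [b1; b2]) /\
      (is_factorization D a v /\ map (ftarr P) v = [b1; b2]) /\
      exists ms, fact_hom D a u v ms /\ Forall (fun m => ftarr P m = tid (fob P (tdom m))) ms)
      [x; z] [x'; z']).
    { apply C; (split; [apply Pair; assumption|simpl; congruence]). }
    (* The lists in the zigzag have length two, since they lie over [[b1; b2]], so the default [a]
       is never reached. *)
    apply (crst_map (S := step_t) (h := fun l => (nth 0 l a, nth 1 l a))) in K; [exact K|].
    clear - AD. intros u v ((Fu & Eu) & (Fv & Ev) & ms & (Hl & Hb & He) & Hv).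
    destruct u as [|x [|z [|]]]; try discriminate.
    destruct v as [|x' [|z' [|]]]; try discriminate.
    destruct ms as [|m [|]]; try discriminate.
    (* The two squares give [x'] as [x] followed by [m], and [z] as [m] followed by [z'], once the
       identities at the ends are removed. *)
    pose proof (Hb 0 (le_n 1)) as [B1 B2]. simpl in B1, B2.
    pose proof (He 0 (Nat.lt_0_2)) as E0. pose proof (He 1 (le_n 2)) as E1.
    simpl in E0, E1. destruct Fu as [(U1 & U2 & U3) _], Fv as [(V1 & V2 & V3) _].
    rewrite <- U3, (ax_tcomp_idr AD) in E1. rewrite <- V1, (ax_tcomp_idl AD) in E0.
    apply Forall_inv in Hv.
    exists x, m, z'. simpl. split; [congruence|split; [congruence|split; [exact Hv|]]].
    rewrite E1, E0; auto.
Qed.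

Lemma two_decompositions_of_lifts : lifts_decompositions P -> two_decompositions.
Proof.
  intros L a c f bs Hc Ha.
  assert (F : is_decomposition E (fcell P a) [(cleft c, [c]); (f, bs)]).
  { simpl. rewrite Ha. auto. }
  destruct (L a [(cleft c, [c]); (f, bs)] (le_n 2) F) as [(xs & Fx & Ex) C].
  split.
  - destruct xs as [|[l cs] [|[f' bs'] [|]]]; try discriminate.
    injection Ex as E1 E2 E3 E4. destruct cs as [|c' [|]]; try discriminate.
    injection E2 as E2. exists c', f', bs'. destruct Fx as (_ & F1 & F2).
    split; [split; auto|auto].
  - intros c1 f1 bs1 c2 f2 bs2 (K1 & K1') I1 J1 L1 (K2 & K2') I2 J2 L2.
    assert (K : clos_refl_sym_trans _ (fun u v =>
      (is_decomposition D a u /\ map (map_row P) u = [(cleft c, [c]); (f, bs)]) /\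
      (is_decomposition D a v /\ map (map_row P) v = [(cleft c, [c]); (f, bs)]) /\
      exists sig, decomp_hom D a u v sig /\
         Forall (fun s => ftarr P (fst s) = tid (fob P (tdom (fst s))) /\
                          Forall (fun c => fcell P c = cid (ctgt (fcell P c))) (snd s)) sig)
      [(cleft c1, [c1]); (f1, bs1)] [(cleft c2, [c2]); (f2, bs2)]).
    { apply C; (split; [simpl; auto|]); unfold map_row; simpl; rewrite <- f_cleft.
      - rewrite I1, J1, L1. reflexivity.
      - rewrite I2, J2, L2. reflexivity. }
    (* The fallback branch is dummy: every decomposition over the given one has a single bottom cell
       and one further layer. *)
    apply (crst_map (S := step_c) (h := fun l => match l with
      | [(_, [c]); (f, bs)] => (c, f, bs) | _ => (a, f1, []) end)) in K; [exact K|].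
    clear - AD TD. intros u v ((Fu & Eu) & (Fv & Ev) & sig & (Hl & Hb & He) & Hv).
    destruct u as [|[l1 k1] [|[f1' bs1'] [|]]]; try discriminate.
    destruct v as [|[l2 k2] [|[f2' bs2'] [|]]]; try discriminate.
    destruct k1 as [|x1 [|]]; try discriminate. destruct k2 as [|x2 [|]]; try discriminate.
    destruct sig as [|[m ss] [|]]; try discriminate.
    pose proof (Hb 0 (le_n 1)) as (B1 & B2 & B3 & B4 & B5 & B6).
    pose proof (He 0 (Nat.lt_0_2)) as E0. pose proof (He 1 (le_n 2)) as E1.
    simpl in B1, B2, B3, B4, B5, B6. cbn [nth app fst snd rowcomp_full] in E0, E1. clear Hl Hb He.
    destruct Fu as (-> & U1 & U2), Fv as (-> & V1 & V2).
    unfold iface in B3, B4; simpl in B3, B4. rewrite app_nil_r in B3, B4.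
    assert (C2 : composable D x2 m ss) by (split; [|split]; assumption).

    (* The first equation makes [x1] the composite of [x2] with [(m, ss)]. The second makes the
       layer [(f2', bs2')] the composite of [(m, ss)] with [(f1', bs1')]. *)
    pose proof (f_equal snd E0) as E0'. pose proof (f_equal snd E1) as E1'.
    apply (f_equal fst) in E1. unfold rowcomp_full in E0', E1, E1'.
    cbn [fst snd] in E0', E1, E1'. clear E0. simpl in U2, V2.
    rewrite (vrow_comp_single C2) in E0'.
    rewrite <- U2 in E0'. rewrite (ax_comp_tgt AD U1) in E0'.
    rewrite (vrow_comp_single (composable_idl TD x1)) in E0'.
    rewrite (ax_comp_idl AD) in E0' by apply (composable_idl TD). injection E0' as E0'.
    assert (X1 : tdom (cleft a) = tdom f2').
    { rewrite <- V2, (ax_comp_left AD V1), (ax_tcomp_dom AD); [reflexivity|apply V1]. }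
    assert (X2 : csrc a = concat (map (@csrc D) bs2')).
    { rewrite <- V2. apply (ax_comp_src AD V1). }
    rewrite X1 in E1, E1'. rewrite X2 in E1'.
    rewrite (vrow_comp_idr AD) in E1' by apply V1. rewrite (ax_tcomp_idl AD) in E1.
    apply Forall_inv in Hv. destruct Hv as [Hv1 Hv2]. simpl in Hv1, Hv2.
    rewrite E0' in U1 |- *.
    exists x2, m, ss, f1', bs1'. split; [exact C2|].
    split; [apply (composable_stack TD _ _ C2), U1|].
    split; [exact Hv1|split; [exact Hv2|]]. rewrite E1, E1'. auto.
Qed.

Lemma step_t_inv x z x' z' : step_t (x, z) (x', z') ->
  (tcod x = tdom z /\ tcod x' = tdom z') /\ tcomp x z = tcomp x' z' /\
  ftarr P x = ftarr P x' /\ ftarr P z = ftarr P z'.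
Proof.
  intros (y & m & w & H1 & H2 & Hv & E1 & E2). injection E1 as -> ->. injection E2 as -> ->.
  rewrite (ax_tcomp_dom AD), (ax_tcomp_cod AD), !f_tcomp by assumption.
  split; [auto|]. split; [symmetry; apply (ax_tcomp_assoc AD); assumption|].
  rewrite Hv. split.
  - rewrite <- H1, <- f_tcod. symmetry. apply (ax_tcomp_idr AE).
  - assert (X : fob P (tdom m) = tdom (ftarr P w)).
    { rewrite f_tdom, <- H2, <- !f_tcod, Hv. rewrite (ax_tid_cod AE). reflexivity. }
    rewrite X. apply (ax_tcomp_idl AE).
Qed.

Lemma vert_t_cod m : vert_t m -> fob P (tcod m) = fob P (tdom m).
Proof. intros H. rewrite <- f_tcod, H. apply (ax_tid_cod AE). Qed.

Lemma vert_t_eq m : vert_t m -> ftarr P m = tid (fob P (tcod m)).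
Proof. intros H. rewrite (vert_t_cod H). exact H. Qed.

Lemma vert_c_src s : vert_c s -> map (flarr P) (csrc s) = [flarr P (ctgt s)].
Proof. intros H. rewrite <- f_csrc, H, (ax_cid_src AE), f_ctgt. reflexivity. Qed.

(** Supplies the unarity that [decomp_hom] demands and [step_c] does not mention: [P] preserves
    arities and identity multicells are unary. *)
Lemma vert_c_unary s : vert_c s -> length (csrc s) = 1.
Proof.
  intros H. apply vert_c_src in H. rewrite <- (length_map (flarr P)), H. reflexivity.
Qed.

Lemma vert_row_cells ss : Forall vert_c ss ->
  map (fcell P) ss = map (@cid E) (map (flarr P) (map (@ctgt D) ss)).
Proof.
  induction 1 as [|s ss H _ IH]; simpl; [reflexivity|]. rewrite IH, H, f_ctgt. reflexivity.
Qed.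

Lemma vert_row_srcs ss : Forall vert_c ss ->
  map (flarr P) (concat (map (@csrc D) ss)) = map (flarr P) (map (@ctgt D) ss).
Proof.
  induction 1 as [|s ss H _ IH]; simpl; [reflexivity|].
  rewrite map_app, IH, (vert_c_src H). reflexivity.
Qed.

(** [P] turns a vertical row into a row of identity multicells, which the unit law for rows removes;
    the next lemma is the mirror case. *)
Lemma vert_row_below f bs m ss : stack D f bs m ss -> vert_t m -> Forall vert_c ss ->
  ftarr P (tcomp m f) = ftarr P f /\
  map (fcell P) (vrow_comp D m bs ss) = map (fcell P) bs.
Proof.
  intros Hs Hm Hss. assert (X : fob P (tcod m) = tdom (ftarr P f)).
  { rewrite f_tdom. f_equal. apply Hs. }
  split.
  - rewrite f_tcomp, (vert_t_eq Hm), X by apply Hs. apply (ax_tcomp_idl AE).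
  - etransitivity; [apply (vmap_row_comp MP TD Hs)|]. simpl.
    rewrite (vert_t_eq Hm), X, (vert_row_cells Hss).
    destruct Hs as (H & _ & H1 & _). rewrite H1.
    rewrite <- (vmap_srcs MP). apply (vrow_comp_idr AE).
    apply (vmap_row_ok MP), H.
Qed.

Lemma vert_row_above m ss f bs : stack D m ss f bs -> vert_t m -> Forall vert_c ss ->
  ftarr P (tcomp f m) = ftarr P f /\
  map (fcell P) (vrow_comp D f ss bs) = map (fcell P) bs.
Proof.
  intros Hs Hm Hss. assert (X : fob P (tdom m) = tcod (ftarr P f)).
  { rewrite f_tcod. f_equal. symmetry. apply Hs. }
  split.
  - rewrite f_tcomp, Hm, X by apply Hs. apply (ax_tcomp_idr AE).
  - etransitivity; [apply (vmap_row_comp MP TD Hs)|]. simpl.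
    rewrite (vert_row_cells Hss), <- (vert_row_srcs Hss).
    destruct Hs as (_ & H & H1 & _). rewrite <- H1.
    rewrite <- (vmap_tgts MP). apply (vrow_comp_idl AE (f := ftarr P f)).
    apply (vmap_row_ok MP), H.
Qed.

Lemma vert_cell_below c m ss : composable D c m ss -> vert_t m -> Forall vert_c ss ->
  fcell P (ccomp c m ss) = fcell P c.
Proof.
  intros H Hm Hs. destruct (vert_row_below (stack_single H) Hm Hs) as [_ K].
  rewrite (vrow_comp_single H) in K. injection K; auto.
Qed.

Lemma step_c_inv c f bs c' f' bs' : step_c (c, f, bs) (c', f', bs') ->
  (composable D c f bs /\ composable D c' f' bs') /\ ccomp c f bs = ccomp c' f' bs' /\
  fcell P c = fcell P c' /\ ftarr P f = ftarr P f' /\ map (fcell P) bs = map (fcell P) bs'.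
Proof.
  intros (d & m & ss & g & ds & H1 & H2 & Hm & Hs & E1 & E2).
  injection E1 as -> -> ->. injection E2 as -> -> ->.
  pose proof (proj2 (composable_stack TD _ _ H1) H2) as H3.
  split; [split; [exact H3|apply (composable_comp TD H1 H2)]|].
  split; [apply (ax_comp_assoc AD H1 H3)|].
  split; [apply vert_cell_below; assumption|].
  destruct (vert_row_above H2 Hm Hs) as [K1 K2]. split; symmetry; assumption.
Qed.

End HeightTwo.

(** * Decompositions of arbitrary height *)

Definition crst_on (X : Type) (Ob : X -> Prop) (Hom : X -> X -> Prop) :=
  clos_refl_sym_trans X (fun u v => Ob u /\ Ob v /\ Hom u v).

Lemma crst_on_map (A B : Type) (Oa : A -> Prop) (Ra : A -> A -> Prop) (Obb : B -> Prop)
  (Rb : B -> B -> Prop) (h : A -> B) :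
  (forall x, Oa x -> Obb (h x)) ->
  (forall x y, Oa x -> Oa y -> Ra x y -> Rb (h x) (h y)) ->
  forall x y, crst_on Oa Ra x y -> crst_on Obb Rb (h x) (h y).
Proof.
  intros Ho H. apply crst_map. intros x y (H1 & H2 & H3). auto.
Qed.

Lemma nonempty_connected_mono (X : Type) (Ob : X -> Prop) (H H' : X -> X -> Prop) :
  (forall x y, Ob x -> Ob y -> H x y -> H' x y) ->
  nonempty_connected Ob H -> nonempty_connected Ob H'.
Proof.
  intros Hi [He Hc]. split; [exact He|]. intros x y Hx Hy.
  apply (crst_on_map (h := fun u => u) (Oa := Ob) (Ra := H)); auto. apply Hc; assumption.
Qed.

Section Heights.
Context {V : vdc}.
Let AV := vaxioms V.
Let TV := vdc_axioms_typing AV.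

Definition src_row (a : cell V) : row V := (tid (tdom (cleft a)), map (@cid V) (csrc a)).
Definition tgt_row (a : cell V) : row V := (tid (lsrc (ctgt a)), [cid (ctgt a)]).

(** Recursive form of [decomp_hom], suited to appending layers. [s0] is the interface row before the
    first remaining layer. Unlike [sig] in [decomp_hom], [ss] includes the final identity row, so it
    is as long as [Ps]. *)
Fixpoint ladder (s0 : row V) (Ps Qs ss : list (row V)) : Prop :=
  match Ps, Qs, ss with
  | [], [], [] => True
  | p :: Ps', q :: Qs', s :: ss' =>
      rowcomp_full V s0 p = rowcomp_full V q s /\ unary_row_between V s p q /\
      ladder s Ps' Qs' ss'
  | _, _, _ => False
  end.

Lemma ladder_nth d Ps : forall s0 Qs ss, ladder s0 Ps Qs ss ->
  length ss = length Ps /\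
  forall j, j < length Ps ->
    unary_row_between V (nth j ss d) (nth j Ps d) (nth j Qs d) /\
    rowcomp_full V (nth j (s0 :: ss) d) (nth j Ps d) =
    rowcomp_full V (nth j Qs d) (nth j ss d).
Proof.
  induction Ps as [|p Ps IH]; intros s0 [|q Qs] [|s ss]; simpl; try tauto.
  - intros _. split; [reflexivity|]. intros j Hj. lia.
  - intros (H1 & H2 & H3). destruct (IH _ _ _ H3) as [L K]. split; [congruence|].
    intros [|j] Hj; [auto|]. apply K. lia.
Qed.

Lemma ladder_hom a Ps Qs sig : ladder (tgt_row a) Ps Qs (sig ++ [src_row a]) ->
  decomp_hom V a Ps Qs sig.
Proof.
  intros H. destruct (ladder_nth (tgt_row a) H) as [L K]. rewrite length_app in L. simpl in L.
  split; [lia|split].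
  - intros i Hi. assert (Hi' : i < length Ps) by lia. destruct (K i Hi') as [K1 _].
    rewrite app_nth1 in K1 by assumption. exact K1.
  - intros full j Hj. destruct (K j Hj) as [_ K2]. exact K2.
Qed.

Lemma ladder_app s0 Ps Qs ss s Ps' Qs' ss' : ladder s0 Ps Qs (ss ++ [s]) ->
  ladder s Ps' Qs' ss' -> ladder s0 (Ps ++ Ps') (Qs ++ Qs') ((ss ++ [s]) ++ ss').
Proof.
  revert s0 Qs ss. induction Ps as [|p Ps IH]; intros s0 [|q Qs] [|t ss]; simpl; try tauto.
  - destruct Ps, Qs; simpl; tauto.
  - intros (H1 & H2 & H3) H. split; [exact H1|split; [exact H2|]]. apply (IH _ _ ss H3 H).
Qed.

Lemma rowcomp_id_below f (bs : list (cell V)) x p :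
  vrow_ok V f bs -> x = tcod f -> p = map (@ctgt V) bs ->
  rowcomp_full V (tid x, map (@cid V) p) (f, bs) = (f, bs).
Proof.
  intros H -> ->. unfold rowcomp_full; cbn [fst snd].
  rewrite (ax_tcomp_idr AV), (vrow_comp_idl AV H). reflexivity.
Qed.

Lemma rowcomp_id_above f (bs : list (cell V)) x p :
  vrow_ok V f bs -> x = tdom f -> p = concat (map (@csrc V) bs) ->
  rowcomp_full V (f, bs) (tid x, map (@cid V) p) = (f, bs).
Proof.
  intros H -> ->. unfold rowcomp_full; cbn [fst snd].
  rewrite (ax_tcomp_idl AV), (vrow_comp_idr AV H). reflexivity.
Qed.

Lemma id_row_between x p y (r r' : row V) : lpath_ok (@lsrc V) (@ltgt V) x p y ->
  iface V r = p -> iface V r' = p -> tdom (fst r) = x -> tdom (fst r') = x ->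
  unary_row_between V (tid x, map (@cid V) p) r r'.
Proof.
  intros H E1 E2 E3 E4. split; [|split; [|split; [|split; [|split]]]]; simpl.
  - eapply (cid_row_ok TV), H.
  - apply Forall_forall. intros c Hc. apply in_map_iff in Hc. destruct Hc as (u & <- & _).
    rewrite (ax_cid_src AV). reflexivity.
  - rewrite E1. apply (cid_row_src TV).
  - rewrite E2. apply (cid_row_tgt TV).
  - rewrite E3. apply (ax_tid_dom AV).
  - rewrite E4. apply (ax_tid_cod AV).
Qed.

Lemma layers_ok_snoc rows f bs c a : layers_ok V c (rows ++ [(f, bs)]) a <->
  exists acc, layers_ok V c rows acc /\ composable V acc f bs /\ ccomp acc f bs = a.
Proof.
  revert c; induction rows as [|[g cs] rows IH]; intros c; simpl.
  - split.
    + intros [H1 H2]. exists c; auto.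
    + intros (acc & <- & H). exact H.
  - rewrite IH. firstorder.
Qed.

(** The composite is accumulated from the target side, so it is the last layer, at the source end,
    that splits off and leaves a decomposition of height two. *)
Lemma is_decomposition_snoc ls f bs a : ls <> [] ->
  is_decomposition V a (ls ++ [(f, bs)]) <->
  exists acc, is_decomposition V acc ls /\ composable V acc f bs /\ ccomp acc f bs = a.
Proof.
  intros Hn. destruct ls as [|[g cs] ls]; [congruence|]. simpl.
  destruct cs as [|c [|]]; [|rewrite layers_ok_snoc|]; firstorder.
Qed.

Lemma is_decomposition_single f bs a : is_decomposition V a [(f, bs)] <->
  f = cleft a /\ bs = [a].
Proof.
  simpl. destruct bs as [|c [|]]; split; try tauto; try (intros [_ H]; discriminate).
  - intros [-> ->]; auto.
  - intros [-> H]. injection H as ->. auto.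
Qed.

Lemma last_layer_ends ls f bs a : is_decomposition V a (ls ++ [(f, bs)]) ->
  vrow_ok V f bs /\ tdom f = tdom (cleft a) /\ concat (map (@csrc V) bs) = csrc a.
Proof.
  destruct ls as [|l ls].
  - intros H. apply is_decomposition_single in H. destruct H as [-> ->].
    simpl. rewrite app_nil_r. repeat split.
  - intros H. apply is_decomposition_snoc in H; [|discriminate].
    destruct H as (acc & _ & H & <-). split; [apply H|].
    rewrite (ax_comp_left AV H), (ax_tcomp_dom AV) by apply H.
    split; [reflexivity|]. symmetry. apply (ax_comp_src AV H).
Qed.

End Heights.

(** * Reduction of height to two *)

Section Reduction.
Context {D E : vdc} (P : vdf D E).
Let AD := vaxioms D.
Let TD := vdc_axioms_typing AD.
Let AE := vaxioms E.
Let TE := vdc_axioms_typing AE.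

Definition vert_row (s : row D) : Prop := vert_t P (fst s) /\ Forall (vert_c P) (snd s).

Lemma vert_t_tid x : vert_t P (tid x).
Proof. unfold vert_t. rewrite f_tid, (ax_tid_dom AD). reflexivity. Qed.

Lemma vert_c_cid u : vert_c P (cid u).
Proof. unfold vert_c. rewrite f_cid, (ax_cid_tgt AE). reflexivity. Qed.

Lemma vert_row_ids x p : vert_row (tid x, map (@cid D) p).
Proof.
  split; [apply vert_t_tid|]. simpl. apply Forall_forall. intros c Hc.
  apply in_map_iff in Hc. destruct Hc as (u & <- & _). apply vert_c_cid.
Qed.

Definition dec_over (a : cell D) (g ls : list (row _)) : Prop :=
  is_decomposition D a ls /\ map (map_row P) ls = g.

Definition vert_ladder (a : cell D) (ls ls' : list (row D)) : Prop :=
  exists sig, ladder (tgt_row a) ls ls' (sig ++ [src_row a]) /\ Forall vert_row sig.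

(** The identity row that bounded the morphism at the source of [c] becomes an interior interface,
    and the new layer is mapped to itself. *)
Lemma vert_ladder_snoc c a ls ls' f bs : is_decomposition D c ls -> ls <> [] ->
  composable D c f bs -> ccomp c f bs = a -> vert_ladder c ls ls' ->
  vert_ladder a (ls ++ [(f, bs)]) (ls' ++ [(f, bs)]).
Proof.
  intros Hd Hn H <- (sig & Hl & Hv).
  exists (sig ++ [src_row c]). split.
  - apply ladder_app; [|simpl; split; [|split; [|exact I]]].
    + unfold tgt_row. rewrite (ax_comp_tgt AD H). exact Hl.
    + unfold src_row.
      rewrite rowcomp_id_below; [|apply H|symmetry; apply H|symmetry; apply H].
      rewrite rowcomp_id_above; [reflexivity|apply H| |apply (ax_comp_src AD H)].
      rewrite (ax_comp_left AD H). apply (ax_tcomp_dom AD), H.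
    + assert (X : tdom (cleft (ccomp c f bs)) = tdom f).
      { rewrite (ax_comp_left AD H). apply (ax_tcomp_dom AD), H. }
      eapply id_row_between; [apply (ax_cell_path AD)| | | |];
        unfold iface; simpl; rewrite ?(ax_comp_src AD H); congruence.
  - apply Forall_app; split; [exact Hv|]. constructor; [apply vert_row_ids|constructor].
Qed.

Lemma vert_ladder_refl c ls : is_decomposition D c ls -> ls <> [] -> vert_ladder c ls ls.
Proof.
  revert c. induction ls as [|[f bs] ls IH] using rev_ind; intros c H Hn; [congruence|].
  destruct ls as [|l ls].
  - pose proof H as H'. apply is_decomposition_single in H'. destruct H' as [-> ->].
    exists []. split; [|constructor]. simpl. split; [|split; [|exact I]].
    + change (tgt_row c) with ((tid (lsrc (ctgt c)), map (@cid D) [ctgt c]) : row D).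
      unfold src_row. rewrite rowcomp_id_below, rowcomp_id_above;
        try reflexivity; try (split; [reflexivity|exact I]).
      * simpl. rewrite app_nil_r. reflexivity.
      * apply (ax_cell_tgt_src AD).
    + eapply id_row_between; [apply (ax_cell_path AD)| | | |]; unfold iface; simpl;
        rewrite ?app_nil_r; reflexivity.
  - apply is_decomposition_snoc in H; [|discriminate].
    destruct H as (acc & H1 & H2 & H3).
    apply (vert_ladder_snoc H1); try assumption; [discriminate|]. apply IH; [exact H1|discriminate].
Qed.

(* Moving a vertical row [(m, ss)] from the bottom of the layer [(h, hs)] to the top
   of the next layer. *)
Lemma vert_ladder_shift a c l0 h hs m ss f bs :
  is_decomposition D c (l0 ++ [(h, hs)]) -> stack D h hs m ss -> stack D m ss f bs ->
  vert_t P m -> Forall (vert_c P) ss ->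
  composable D c (tcomp f m) (vrow_comp D f ss bs) ->
  ccomp c (tcomp f m) (vrow_comp D f ss bs) = a ->
  vert_ladder a ((l0 ++ [rowcomp_full D (h, hs) (m, ss)]) ++ [(f, bs)])
    ((l0 ++ [(h, hs)]) ++ [rowcomp_full D (m, ss) (f, bs)]).
Proof.
  intros Hd S1 S2 Hm Hs Hc <-.
  assert (Sa := stack_row_ok TD S1). assert (Sb := stack_row_ok TD S2).
  set (a := ccomp c (tcomp f m) (vrow_comp D f ss bs)).
  assert (Xd : tdom (cleft a) = tdom f).
  { unfold a. rewrite (ax_comp_left AD Hc).
    rewrite (ax_tcomp_dom AD) by apply Hc. apply (ax_tcomp_dom AD), S2. }
  assert (Xs : csrc a = concat (map (@csrc D) bs)).
  { unfold a. rewrite (ax_comp_src AD Hc). apply (stack_row_src TD S2). }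
  (* The last two rungs, for any incoming interface row that acts as an identity; below it is the
     target row of [a] or the source row of the layers in [l0]. *)
  assert (L2 : forall s0, rowcomp_full D s0 (rowcomp_full D (h, hs) (m, ss)) =
      rowcomp_full D (h, hs) (m, ss) ->
    ladder s0 [rowcomp_full D (h, hs) (m, ss); (f, bs)]
      [(h, hs); rowcomp_full D (m, ss) (f, bs)] ([(m, ss)] ++ [src_row a])).
  { intros s0 E0. simpl. split; [exact E0|split; [|split; [|split; [|exact I]]]].
    - split; [apply S2|split; [|split; [|split; [|split]]]].
      + revert Hs. apply Forall_impl. intros s. apply vert_c_unary.
      + symmetry. apply (stack_row_src TD S1).
      + apply S1.
      + simpl. rewrite (ax_tcomp_dom AD); [reflexivity|apply S1].
      + apply S1.
    - unfold src_row. symmetry. apply rowcomp_id_above; [exact Sb| |].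
      + rewrite Xd. symmetry. apply (ax_tcomp_dom AD), S2.
      + rewrite Xs. symmetry. apply (stack_row_src TD S2).
    - eapply id_row_between; [apply (ax_cell_path AD)| | | |]; unfold iface; simpl.
      + symmetry; exact Xs.
      + rewrite Xs. apply (stack_row_src TD S2).
      + symmetry; exact Xd.
      + rewrite Xd. apply (ax_tcomp_dom AD), S2. }
  assert (Hv : vert_row (m, ss)) by (split; assumption).
  rewrite <- !app_assoc. simpl app at 2 4.
  destruct l0 as [|l l0].
  - exists [(m, ss)]. split; [|constructor; [exact Hv|constructor]].
    apply L2. apply is_decomposition_single in Hd. destruct Hd as [-> ->].
    change (tgt_row a) with ((tid (lsrc (ctgt a)), map (@cid D) [ctgt a]) : row D).
    assert (Ct : ctgt a = ctgt c) by apply (ax_comp_tgt AD Hc).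
    apply rowcomp_id_below; [exact Sa| |].
    + simpl. rewrite Ct, (ax_cell_tgt_src AD). symmetry. apply (ax_tcomp_cod AD), S1.
    + etransitivity; [|symmetry; apply (stack_row_tgt TD S1)]. rewrite Ct; reflexivity.
  - apply is_decomposition_snoc in Hd; [|discriminate].
    destruct Hd as (acc & H1 & H2 & H3).
    assert (Hn : l :: l0 <> []) by discriminate.
    destruct (vert_ladder_refl H1 Hn) as (sig & Hl & Hsig).
    exists ((sig ++ [src_row acc]) ++ [(m, ss)]). split.
    + rewrite <- app_assoc. apply ladder_app.
      * unfold tgt_row, a. rewrite (ax_comp_tgt AD Hc), <- H3, (ax_comp_tgt AD H2). exact Hl.
      * apply L2. unfold src_row. apply rowcomp_id_below; [exact Sa| |].
        -- symmetry. etransitivity; [apply (ax_tcomp_cod AD), S1|apply H2].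
        -- symmetry. etransitivity; [apply (stack_row_tgt TD S1)|apply H2].
    + repeat (apply Forall_app; split); auto. constructor; [apply vert_row_ids|constructor].
Qed.

Lemma map_row_snoc ls r g y : map (map_row P) (ls ++ [r]) = g ++ [y] <->
  map (map_row P) ls = g /\ map_row P r = y.
Proof.
  rewrite map_app. simpl. split.
  - intros H. apply app_inj_tail in H. exact H.
  - intros [-> ->]; reflexivity.
Qed.

Lemma dec_over_snoc a g y ls : g <> [] -> dec_over a (g ++ [y]) ls ->
  exists ls0 f bs c, ls = ls0 ++ [(f, bs)] /\ dec_over c g ls0 /\ ls0 <> [] /\
    composable D c f bs /\ a = ccomp c f bs /\ map_row P (f, bs) = y.
Proof.
  intros Hg [H1 H2]. destruct ls as [|[f bs] ls _] using rev_ind.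
  - destruct g; discriminate.
  - apply map_row_snoc in H2. destruct H2 as [H2 H3].
    assert (Hn : ls <> []) by (intros ->; simpl in H2; congruence).
    apply is_decomposition_snoc in H1; [|exact Hn].
    destruct H1 as (c & H4 & H5 & H6).
    exists ls, f, bs, c. unfold dec_over. auto 10.
Qed.

(** Induction on the height, removing the layer at the source end. A zigzag of height-two
    decompositions is refined to one of full height. In each step the moving row is composed with
    the last layer of a decomposition of the cell [d] below it, and then shifted across by
    [vert_ladder_shift]. Different choices of decomposition are linked by the induction
    hypothesis. *)
Lemma vert_connected (TC : two_decompositions P) g : g <> [] -> forall a,
  is_decomposition E (fcell P a) g -> nonempty_connected (dec_over a g) (vert_ladder a).
Proof.
  induction g as [|[f bs] g IH] using rev_ind; intros Hn a Hg; [congruence|].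
  clear Hn. destruct g as [|l g].
  - apply is_decomposition_single in Hg. destruct Hg as [-> ->]. split.
    + exists [(cleft a, [a])]. split; [simpl; auto|]. simpl. rewrite f_cleft. reflexivity.
    + assert (U : forall ls, dec_over a ([] ++ [(cleft (fcell P a), [fcell P a])]) ls ->
        ls = [(cleft a, [a])]).
      { intros ls [H1 H2]. destruct ls as [|[h hs] [|]]; try discriminate.
        apply is_decomposition_single in H1. destruct H1 as [-> ->]. reflexivity. }
      intros ls ls' H H'. rewrite (U _ H), (U _ H'). apply rst_refl.
  - set (g0 := l :: g) in *. assert (Hn : g0 <> []) by discriminate.
    apply is_decomposition_snoc in Hg; [|exact Hn].
    destruct Hg as (c & Hc & Hf & Ha). specialize (IH Hn). symmetry in Ha.
    destruct (TC a c f bs Hf Ha) as [(c' & f' & bs' & (K1 & K2) & K3 & K4 & K5) Conn].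
    assert (Ext : forall x y k ls, dec_over x g0 ls -> composable D x y k ->
      a = ccomp x y k -> ftarr P y = f -> map (fcell P) k = bs ->
      ls <> [] /\ dec_over a (g0 ++ [(f, bs)]) (ls ++ [(y, k)])).
    { intros x y k ls [H1 H2] H3 H4 H5 H6. assert (H7 : ls <> []) by (intros ->; discriminate).
      split; [exact H7|]. split.
      - apply is_decomposition_snoc; [exact H7|]. exists x; auto.
      - apply map_row_snoc. split; [exact H2|]. unfold map_row; simpl; congruence. }
    split.
    { destruct (IH c') as [(ls & Hls) _]; [congruence|].
      exists (ls ++ [(f', bs')]). eapply Ext; eassumption. }
    set (good := fun t : cell D * tarr D * list (cell D) => let '(x, y, k) := t in
      stack_of a x y k /\ fcell P x = c /\ ftarr P y = f /\ map (fcell P) k = bs).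
    (* With the last layer fixed, the induction hypothesis for [x] connects any two decompositions
       of the rest. *)
    assert (Same : forall x y k ls ls', good (x, y, k) -> dec_over x g0 ls -> dec_over x g0 ls' ->
      crst_on (dec_over a (g0 ++ [(f, bs)])) (vert_ladder a) (ls ++ [(y, k)]) (ls' ++ [(y, k)])).
    { intros x y k ls ls' ((G1 & G2) & G3 & G4 & G5) H H'.
      assert (Hx : is_decomposition E (fcell P x) g0) by congruence.
      pose proof (proj2 (IH x Hx) ls ls' H H') as Cx.
      apply (crst_on_map (h := fun q => q ++ [(y, k)]) (Oa := dec_over x g0)
        (Ra := vert_ladder x)); [| |exact Cx].
      - intros q Hq. eapply Ext; eassumption.
      - intros q q' Hq Hq' Hqq. apply (vert_ladder_snoc (c := x)); auto.
        + apply Hq.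
        + eapply Ext; eassumption. }
    assert (Step : forall p q, clos_refl_sym_trans _ (step_c P) p q -> good p -> good q ->
      forall ls ls', dec_over (fst (fst p)) g0 ls -> dec_over (fst (fst q)) g0 ls' ->
      crst_on (dec_over a (g0 ++ [(f, bs)])) (vert_ladder a)
        (ls ++ [(snd (fst p), snd p)]) (ls' ++ [(snd (fst q), snd q)])).
    { assert (Gstep : forall p q, step_c P p q -> (good p <-> good q)).
      { intros [[x y] k] [[x' y'] k'] H. apply step_c_inv in H.
        destruct H as ((H1 & H2) & H3 & H4 & H5 & H6). unfold good, stack_of.
        rewrite H3, H4, H5, H6. tauto. }
      assert (Gcrst : forall p q, clos_refl_sym_trans _ (step_c P) p q -> (good p <-> good q)).
      { intros p q H. induction H; [apply Gstep; assumption|tauto|tauto|tauto]. }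
      intros p q H. induction H as [p q H|p|p q H IHs|p q r H IHs H' IHs']; intros Gp Gq ls ls' Hp Hq.
      - destruct p as [[x y] k], q as [[x' y'] k']. simpl in *.
        pose proof H as Hinv. apply step_c_inv in Hinv.
        destruct H as (d & m & ss & g' & ds & C1 & C2 & Hm & Hs & E1 & E2).
        injection E1 as -> -> ->. injection E2 as -> -> ->.
        destruct ls' as [|[h hs] l0 _] using rev_ind; [destruct Hq; discriminate|].
        assert (Sh : stack D h hs m ss).
        { destruct (last_layer_ends (proj1 Hq)) as (X1 & X2 & X3).
          split; [exact X1|split; [apply C1|]]. rewrite X2, X3. split; apply C1. }
        (* A decomposition of [d] yields one of [ccomp d m ss] over the same layers, since composing
           [(h, hs)] with a vertical row does not change its image. *)
        assert (Hz : dec_over (ccomp d m ss) g0 (l0 ++ [rowcomp_full D (h, hs) (m, ss)])).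
        { destruct Hq as [Q1 Q2]. split.
          - destruct l0 as [|l1 l0].
            + apply is_decomposition_single in Q1. destruct Q1 as [-> ->].
              apply is_decomposition_single. simpl fst; simpl snd. split.
              * symmetry. apply (ax_comp_left AD C1).
              * apply vrow_comp_single, C1.
            + apply is_decomposition_snoc in Q1; [|discriminate].
              destruct Q1 as (acc & Q3 & Q4 & Q5).
              apply is_decomposition_snoc; [discriminate|].
              exists acc. split; [exact Q3|]. split; [apply (composable_comp TD Q4 Sh)|].
              rewrite <- Q5. symmetry. apply (ax_comp_assoc AD Q4).
              rewrite Q5. exact C1.
          - rewrite <- Q2, !map_app. simpl. f_equal. f_equal.
            unfold map_row; cbn [fst snd rowcomp_full].
            destruct (vert_row_below Sh Hm Hs) as [-> ->]. reflexivity. }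
        eapply rst_trans; [apply (Same _ _ _ _ _ Gp Hp Hz)|].
        apply rst_step. destruct Gp as ((G1 & G2) & G3 & G4 & G5).
        destruct Gq as ((G1' & G2') & G3' & G4' & G5').
        split; [eapply Ext; eassumption|split; [eapply Ext; eassumption|]].
        apply (vert_ladder_shift (proj1 Hq) Sh C2 Hm Hs G1'). congruence.
      - destruct p as [[x y] k]. apply (Same _ _ _ _ _ Gp Hp Hq).
      - apply rst_sym, IHs; assumption.
      - assert (Gm : good q) by (apply (Gcrst _ _ H), Gp).
        destruct q as [[x y] k].
        (* The intermediate pair needs some full decomposition through which both halves pass;
           nonemptiness in the induction hypothesis gives one. *)
        destruct (IH x) as [(ls0 & Hls0) _].
        { destruct Gm as (_ & -> & _). exact Hc. }
        eapply rst_trans; [apply IHs; eassumption|apply IHs'; eassumption]. }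
    intros ls ls' H H'.
    destruct (dec_over_snoc Hn H) as (l1 & f1 & b1 & c1 & -> & D1 & N1 & P1 & Q1 & R1).
    destruct (dec_over_snoc Hn H') as (l2 & f2 & b2 & c2 & -> & D2 & N2 & P2 & Q2 & R2).
    injection R1 as R1 R1'. injection R2 as R2 R2'.
    (* Layers determine their iterated composite, so a cell decomposed over [g0] has the same image
       as the composite [c] of [g0]. *)
    assert (Det : forall x ls, dec_over x g0 ls -> fcell P x = c).
    { clear - Hc AE TE. intros x ls [H <-].
      assert (K : is_decomposition E (fcell P x) (map (map_row P) ls)).
      { destruct ls as [|[h [|h1 [|]]] ls]; try contradiction. destruct H as [-> H].
        simpl. split; [symmetry; apply f_cleft|]. clear Hc. revert h1 H.
        induction ls as [|[k ks] ls IH]; intros h1 H; simpl in *; [congruence|].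
        destruct H as [H1 H2]. split; [apply (vmap_composable (vmap_of_vdf P) H1)|].
        rewrite <- (f_ccomp P H1). apply IH, H2. }
      revert K Hc. generalize (fcell P x) (map (map_row P) ls). clear.
      intros y [|[h [|h1 [|]]] ls]; simpl; try tauto. intros [_ H] [_ H'].
      revert h1 H H'. induction ls as [|[k ks] ls IH]; simpl; intros h1 H H'; [congruence|].
      eapply IH; [apply H|apply H']. }
    apply (Step (c1, f1, b1) (c2, f2, b2)); try assumption.
    + apply Conn; try assumption; try (split; assumption); eapply Det; eassumption.
    + split; [split; assumption|]. split; [eapply Det; eassumption|auto].
    + split; [split; assumption|]. split; [eapply Det; eassumption|auto].
Qed.

Lemma lifts_decompositions_of_two : two_decompositions P -> lifts_decompositions P.
Proof.
  intros TC a g Hl Hg. assert (Hn : g <> []) by (intros ->; simpl in Hl; lia).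
  apply (nonempty_connected_mono (H := vert_ladder a)); [|apply vert_connected; assumption].
  intros ls ls' _ _ (sig & H1 & H2). exists sig. split; [apply ladder_hom, H1|exact H2].
Qed.

End Reduction.

(** * Factorizations of arbitrary length *)

Section Lengths.
Context {V : vdc}.
Let AV := vaxioms V.

Fixpoint fladder (m0 : tarr V) (xs ys ms : list (tarr V)) : Prop :=
  match xs, ys, ms with
  | [], [], [] => True
  | x :: xs', y :: ys', m :: ms' =>
      tcomp x m = tcomp m0 y /\ (tdom m = tcod x /\ tcod m = tcod y) /\ fladder m xs' ys' ms'
  | _, _, _ => False
  end.

Lemma fladder_nth d xs : forall m0 ys ms, fladder m0 xs ys ms ->
  length ms = length xs /\
  forall j, j < length xs ->
    (tdom (nth j ms d) = tcod (nth j xs d) /\ tcod (nth j ms d) = tcod (nth j ys d)) /\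
    tcomp (nth j xs d) (nth j ms d) = tcomp (nth j (m0 :: ms) d) (nth j ys d).
Proof.
  induction xs as [|x xs IH]; intros m0 [|y ys] [|m ms]; simpl; try tauto.
  - intros _. split; [reflexivity|]. intros j Hj. lia.
  - intros (H1 & H2 & H3). destruct (IH _ _ _ H3) as [L K]. split; [congruence|].
    intros [|j] Hj; [auto|]. apply K. lia.
Qed.

Lemma fladder_hom a xs ys ms : fladder (tid (tdom a)) xs ys (ms ++ [tid (tcod a)]) ->
  fact_hom V a xs ys ms.
Proof.
  intros H. destruct (fladder_nth a H) as [L K]. rewrite length_app in L. simpl in L.
  split; [lia|split].
  - intros i Hi. assert (Hi' : i < length xs) by lia. destruct (K i Hi') as [K1 _].
    rewrite app_nth1 in K1 by assumption. exact K1.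
  - intros full j Hj. destruct (K j Hj) as [_ K2]. exact K2.
Qed.

Lemma fladder_app m0 xs ys ms m xs' ys' ms' : fladder m0 xs ys (ms ++ [m]) ->
  fladder m xs' ys' ms' -> fladder m0 (xs ++ xs') (ys ++ ys') ((ms ++ [m]) ++ ms').
Proof.
  revert m0 ys ms. induction xs as [|x xs IH]; intros m0 [|y ys] [|n ms]; simpl; try tauto.
  - destruct xs, ys; simpl; tauto.
  - intros (H1 & H2 & H3) H. split; [exact H1|split; [exact H2|]]. apply (IH _ _ ms H3 H).
Qed.

Lemma tchain_ends fs : forall f y, tchain V (tcod f) fs y ->
  tdom (fold_left (@tcomp V) fs f) = tdom f /\ tcod (fold_left (@tcomp V) fs f) = y.
Proof.
  induction fs as [|g fs IH]; simpl; intros f y H; [auto|].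
  destruct H as [H1 H2]. rewrite <- (ax_tcomp_cod AV f g) in H2 by auto.
  destruct (IH _ _ H2) as [K1 K2]. rewrite K1, (ax_tcomp_dom AV) by auto. auto.
Qed.

Lemma tchain_snoc fs f : forall x y, tchain V x (fs ++ [f]) y <->
  tchain V x fs (tdom f) /\ tcod f = y.
Proof.
  induction fs as [|g fs IH]; simpl; intros x y; [intuition congruence|].
  rewrite IH. tauto.
Qed.

Lemma is_factorization_snoc fs f a : fs <> [] ->
  is_factorization V a (fs ++ [f]) <->
  exists b, is_factorization V b fs /\ tcod b = tdom f /\ tcomp b f = a.
Proof.
  destruct fs as [|g fs]; [congruence|]. intros _. unfold is_factorization.
  simpl. rewrite fold_left_app, tchain_snoc. simpl. split.
  - intros ((H1 & H2 & H3) & H4). destruct (tchain_ends H2) as [K1 K2].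
    exists (fold_left (@tcomp V) fs g). rewrite K1, K2. auto.
  - intros (b & ((H1 & H2) & H3) & H4 & H5). subst a. rewrite H3.
    rewrite (ax_tcomp_dom AV), (ax_tcomp_cod AV) by assumption.
    rewrite <- H4. auto.
Qed.

Lemma is_factorization_single f a : is_factorization V a [f] <-> f = a.
Proof.
  unfold is_factorization. simpl. split; [tauto|]. intros ->; auto.
Qed.

Lemma last_factor_cod fs f a : is_factorization V a (fs ++ [f]) -> tcod f = tcod a.
Proof. intros [H _]. apply tchain_snoc in H. apply H. Qed.

End Lengths.

(** * Reduction of length to two *)

Section FactReduction.
Context {D E : vdc} (P : vdf D E).
Let AD := vaxioms D.
Let AE := vaxioms E.

Definition fact_over (a : tarr D) g ls : Prop :=
  is_factorization D a ls /\ map (ftarr P) ls = g.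

Definition vert_fladder (a : tarr D) (xs ys : list (tarr D)) : Prop :=
  exists ms, fladder (tid (tdom a)) xs ys (ms ++ [tid (tcod a)]) /\ Forall (vert_t P) ms.

Lemma vert_fladder_snoc b a xs ys f : tcod b = tdom f -> tcomp b f = a ->
  vert_fladder b xs ys -> vert_fladder a (xs ++ [f]) (ys ++ [f]).
Proof.
  intros H <- (ms & Hl & Hv). rewrite <- (ax_tcomp_dom AD _ _ H) in Hl.
  exists (ms ++ [tid (tcod b)]). split.
  - apply fladder_app; [exact Hl|]. simpl.
    rewrite (ax_tcomp_cod AD), (ax_tid_dom AD), (ax_tid_cod AD), (ax_tcomp_idr AD) by assumption.
    rewrite H, (ax_tcomp_idl AD). auto.
  - apply Forall_app; split; [exact Hv|]. constructor; [apply vert_t_tid|constructor].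
Qed.

Lemma vert_fladder_refl a fs : is_factorization D a fs -> fs <> [] -> vert_fladder a fs fs.
Proof.
  revert a. induction fs as [|f fs IH] using rev_ind; intros a H Hn; [congruence|].
  destruct fs as [|g fs].
  - apply is_factorization_single in H. subst f. exists []. split; [|constructor]. simpl.
    rewrite (ax_tcomp_idl AD), (ax_tcomp_idr AD), (ax_tid_dom AD), (ax_tid_cod AD). auto.
  - apply is_factorization_snoc in H; [|discriminate].
    destruct H as (b & H1 & H2 & H3).
    apply (vert_fladder_snoc H2 H3), IH; [exact H1|discriminate].
Qed.

Lemma vert_fladder_shift a x l0 h m z :
  is_factorization D x (l0 ++ [h]) -> tcod x = tdom m -> tcod m = tdom z -> vert_t P m ->
  a = tcomp x (tcomp m z) ->
  vert_fladder a ((l0 ++ [h]) ++ [tcomp m z]) ((l0 ++ [tcomp h m]) ++ [z]).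
Proof.
  intros Hd H1 H2 Hm Ha.
  assert (Hh : tcod h = tdom m) by (rewrite (last_factor_cod Hd); exact H1).
  assert (Ca : tcod a = tcod z).
  { rewrite Ha, !(ax_tcomp_cod AD); try assumption; try reflexivity.
    rewrite (ax_tcomp_dom AD); assumption. }
  assert (Da : tdom a = tdom x).
  { rewrite Ha. apply (ax_tcomp_dom AD). rewrite (ax_tcomp_dom AD); assumption. }
  assert (L2 : forall m0, tcomp m0 (tcomp h m) = tcomp h m ->
    fladder m0 [h; tcomp m z] [tcomp h m; z] ([m] ++ [tid (tcod a)])).
  { intros m0 E0. simpl. rewrite E0, Ca, (ax_tid_dom AD), (ax_tid_cod AD).
    rewrite !(ax_tcomp_cod AD) by assumption.
    rewrite <- (ax_tcomp_cod AD m z) at 1 by assumption. rewrite (ax_tcomp_idr AD). auto 10. }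
  rewrite <- !app_assoc. simpl app at 2 4.
  destruct l0 as [|l l0].
  - exists [m]. split; [|constructor; [exact Hm|constructor]].
    apply L2. apply is_factorization_single in Hd. subst h.
    rewrite Da, <- (ax_tcomp_dom AD x m H1). apply (ax_tcomp_idl AD).
  - apply is_factorization_snoc in Hd; [|discriminate].
    destruct Hd as (b & K1 & K2 & K3).
    assert (Hn : l :: l0 <> []) by discriminate.
    destruct (vert_fladder_refl K1 Hn) as (ms & Hl & Hms).
    exists ((ms ++ [tid (tcod b)]) ++ [m]). split.
    + rewrite <- app_assoc. apply fladder_app.
      * rewrite Da, <- K3, (ax_tcomp_dom AD) by exact K2. exact Hl.
      * apply L2. rewrite K2, <- (ax_tcomp_dom AD h m Hh). apply (ax_tcomp_idl AD).
    + repeat (apply Forall_app; split); auto. constructor; [apply vert_t_tid|constructor].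
Qed.

Lemma map_snoc (A B : Type) (h : A -> B) ls r g y : map h (ls ++ [r]) = g ++ [y] <->
  map h ls = g /\ h r = y.
Proof.
  rewrite map_app. simpl. split.
  - intros H. apply app_inj_tail in H. exact H.
  - intros [-> ->]; reflexivity.
Qed.

(** The argument of [vert_connected] for tight arrows: in a step the vertical arrow [m] is appended
    to the last factor of a factorization of the first component. *)
Lemma vert_fact_connected (TC : two_factorizations P) g : g <> [] -> forall a,
  is_factorization E (ftarr P a) g -> nonempty_connected (fact_over a g) (vert_fladder a).
Proof.
  induction g as [|f g IH] using rev_ind; intros Hn a Hg; [congruence|].
  clear Hn. destruct g as [|l g].
  - apply is_factorization_single in Hg. subst f. split.
    + exists [a]. split; [apply is_factorization_single; reflexivity|reflexivity].
    + assert (U : forall ls, fact_over a ([] ++ [ftarr P a]) ls -> ls = [a]).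
      { intros ls [H1 H2]. destruct ls as [|h [|]]; try discriminate.
        apply is_factorization_single in H1. subst h. reflexivity. }
      intros ls ls' H H'. rewrite (U _ H), (U _ H'). apply rst_refl.
  - set (g0 := l :: g) in *. assert (Hn : g0 <> []) by discriminate.
    apply is_factorization_snoc in Hg; [|exact Hn].
    destruct Hg as (c & Hc & Hf & Ha). specialize (IH Hn). symmetry in Ha.
    destruct (TC a c f Hf Ha) as [(c' & f' & (K1 & K2) & K3 & K4) Conn].
    assert (Ext : forall x y ls, fact_over x g0 ls -> pair_of a x y -> ftarr P y = f ->
      ls <> [] /\ fact_over a (g0 ++ [f]) (ls ++ [y])).
    { intros x y ls [H1 H2] [H3 H4] H5. assert (H7 : ls <> []) by (intros ->; discriminate).
      split; [exact H7|]. split.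
      - apply is_factorization_snoc; [exact H7|]. exists x; auto.
      - apply map_snoc. auto. }
    split.
    { destruct (IH c') as [(ls & Hls) _]; [congruence|].
      exists (ls ++ [f']). eapply Ext; try eassumption. split; assumption. }
    set (good := fun t : tarr D * tarr D =>
      pair_of a (fst t) (snd t) /\ ftarr P (fst t) = c /\ ftarr P (snd t) = f).
    assert (Same : forall x y ls ls', good (x, y) -> fact_over x g0 ls -> fact_over x g0 ls' ->
      crst_on (fact_over a (g0 ++ [f])) (vert_fladder a) (ls ++ [y]) (ls' ++ [y])).
    { intros x y ls ls' (G2 & G3 & G4) H H'. simpl in *.
      assert (Hx : is_factorization E (ftarr P x) g0) by congruence.
      pose proof (proj2 (IH x Hx) ls ls' H H') as Cx.
      apply (crst_on_map (h := fun q => q ++ [y]) (Oa := fact_over x g0)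
        (Ra := vert_fladder x)); [| |exact Cx].
      - intros q Hq. eapply Ext; eassumption.
      - intros q q' Hq Hq' Hqq. destruct G2 as [G G'].
        apply (vert_fladder_snoc (b := x)); auto. }
    assert (Gstep : forall p q, step_t P p q -> (good p <-> good q)).
    { intros [x y] [x' y'] H. apply step_t_inv in H.
      destruct H as ((H1 & H2) & H3 & H4 & H5). unfold good, pair_of; simpl.
      rewrite H3, H4, H5. tauto. }
    assert (Gcrst : forall p q, clos_refl_sym_trans _ (step_t P) p q -> (good p <-> good q)).
    { intros p q H. induction H; [apply Gstep; assumption|tauto|tauto|tauto]. }
    assert (Step : forall p q, clos_refl_sym_trans _ (step_t P) p q -> good p -> good q ->
      forall ls ls', fact_over (fst p) g0 ls -> fact_over (fst q) g0 ls' ->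
      crst_on (fact_over a (g0 ++ [f])) (vert_fladder a) (ls ++ [snd p]) (ls' ++ [snd q])).
    { intros p q H. induction H as [p q H|p|p q H IHs|p q r H IHs H' IHs']; intros Gp Gq ls ls' Hp Hq.
      - destruct p as [x y], q as [x' y']. simpl in *.
        destruct H as (d & m & z & C1 & C2 & Hm & E1 & E2).
        injection E1 as -> ->. injection E2 as -> ->.
        destruct ls as [|h l0 _] using rev_ind; [destruct Hp; discriminate|].
        assert (Hh : tcod h = tdom m) by (rewrite (last_factor_cod (proj1 Hp)); exact C1).
        assert (Hz : fact_over (tcomp d m) g0 (l0 ++ [tcomp h m])).
        { destruct Hp as [Q1 Q2]. split.
          - destruct l0 as [|l1 l0].
            + apply is_factorization_single in Q1. subst h.
              apply is_factorization_single. reflexivity.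
            + apply is_factorization_snoc in Q1; [|discriminate].
              destruct Q1 as (b & Q3 & Q4 & Q5).
              apply is_factorization_snoc; [discriminate|].
              exists b. split; [exact Q3|]. rewrite (ax_tcomp_dom AD) by exact Hh.
              split; [exact Q4|]. rewrite <- Q5. symmetry. apply (ax_tcomp_assoc AD); assumption.
          - rewrite <- Q2, !map_app. simpl. f_equal. f_equal.
            rewrite f_tcomp, Hm, <- Hh, <- f_tcod by exact Hh. apply (ax_tcomp_idr AE). }
        apply rst_trans with ((l0 ++ [tcomp h m]) ++ [z]); [|apply (Same _ _ _ _ Gq Hz Hq)].
        apply rst_step. destruct Gp as (G2 & G3 & G4), Gq as (G2' & G3' & G4').
        split; [eapply Ext; eassumption|split; [eapply Ext; eassumption|]].
        apply (vert_fladder_shift (proj1 Hp) C1 C2 Hm). apply G2.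
      - destruct p as [x y]. apply (Same _ _ _ _ Gp Hp Hq).
      - apply rst_sym, IHs; assumption.
      - assert (Gm : good q) by (apply (Gcrst _ _ H), Gp).
        destruct (IH (fst q)) as [(ls0 & Hls0) _].
        { destruct Gm as (_ & -> & _). exact Hc. }
        eapply rst_trans; [apply IHs; eassumption|apply IHs'; eassumption]. }
    assert (Det : forall x ls, fact_over x g0 ls -> ftarr P x = c).
    { clear - Hc Hn AE AD. intros x ls [[H1 H2] H3]. rewrite <- H3 in Hc, Hn. clear H3.
      destruct ls as [|h ls]; [destruct (Hn eq_refl)|].
      destruct Hc as [_ Hc]. simpl in H1, H2, Hc. rewrite <- H2, <- Hc. destruct H1 as [_ H1].
      clear - H1 AD. revert h H1. generalize (tcod x) as y.
      induction ls as [|k ls IH]; simpl; intros y h H; [reflexivity|].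
      destruct H as [H1 H2]. rewrite <- f_tcomp by auto. apply (IH y).
      rewrite (ax_tcomp_cod AD) by auto. exact H2. }
    assert (Inv : forall ls, fact_over a (g0 ++ [f]) ls -> exists ls0 x y, ls = ls0 ++ [y] /\
      fact_over x g0 ls0 /\ good (x, y)).
    { intros ls [H1 H2]. destruct ls as [|y ls _] using rev_ind; [destruct g0; discriminate|].
      apply map_snoc in H2. destruct H2 as [H2 H3].
      assert (Hn' : ls <> []) by (intros ->; simpl in H2; congruence).
      apply is_factorization_snoc in H1; [|exact Hn'].
      destruct H1 as (b & H4 & H5 & H6). exists ls, b, y.
      assert (O : fact_over b g0 ls) by (split; assumption).
      split; [reflexivity|split; [exact O|]]. split; [split; simpl; auto|].
      split; [apply (Det _ _ O)|exact H3]. }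
    intros ls ls' H H'.
    destruct (Inv _ H) as (l1 & x1 & y1 & -> & O1 & G1).
    destruct (Inv _ H') as (l2 & x2 & y2 & -> & O2 & G2).
    apply (Step (x1, y1) (x2, y2)); try assumption.
    destruct G1 as (A1 & A2 & A3), G2 as (B1 & B2 & B3). apply Conn; assumption.
Qed.

Lemma lifts_factorizations_of_two : two_factorizations P -> lifts_factorizations P.
Proof.
  intros TC a g Hl Hg. assert (Hn : g <> []) by (intros ->; simpl in Hl; lia).
  apply (nonempty_connected_mono (H := vert_fladder a)); [|apply vert_fact_connected; assumption].
  intros ls ls' _ _ (ms & H1 & H2). exists ms. split; [apply fladder_hom, H1|exact H2].
Qed.

End FactReduction.

(** * The exponential *)

Fixpoint rel3 (A B C : Type) (R : A -> B -> C -> Prop) (l : list A) (m : list B) (n : list C)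
  : Prop :=
  match l, m, n with
  | [], [], [] => True
  | a :: l', b :: m', c :: n' => R a b c /\ rel3 R l' m' n'
  | _, _, _ => False
  end.

Lemma rel3_length A B C (R : A -> B -> C -> Prop) l m n :
  rel3 R l m n -> length l = length m /\ length l = length n.
Proof.
  revert m n; induction l as [|a l IH]; intros [|b m] [|c n]; simpl; try tauto.
  intros [_ H]. destruct (IH _ _ H). split; congruence.
Qed.

Lemma rel3_app A B C (R : A -> B -> C -> Prop) l m n l' m' n' :
  rel3 R l m n -> rel3 R l' m' n' -> rel3 R (l ++ l') (m ++ m') (n ++ n').
Proof.
  revert m n; induction l as [|a l IH]; intros [|b m] [|c n]; simpl; try tauto.
  intros [H H1] H2. auto.
Qed.

Lemma rel3_app_inv A B C (R : A -> B -> C -> Prop) l l' m m' n :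
  length l = length m -> rel3 R (l ++ l') (m ++ m') n ->
  exists n1 n2, n = n1 ++ n2 /\ rel3 R l m n1 /\ rel3 R l' m' n2.
Proof.
  revert m n; induction l as [|a l IH]; intros [|b m] n; try discriminate; simpl.
  - intros _ H. exists [], n; auto.
  - intros L. destruct n as [|c n]; [tauto|]. intros [H H1].
    destruct (IH m n) as (n1 & n2 & -> & K1 & K2); [congruence|exact H1|].
    exists (c :: n1), n2. auto.
Qed.

Lemma rel3_unique A B C (R : A -> B -> C -> Prop) l m n n' :
  Forall (fun a => forall b c c', R a b c -> R a b c' -> c = c') l ->
  rel3 R l m n -> rel3 R l m n' -> n = n'.
Proof.
  intros H; revert m n n'; induction H as [|a l Ha _ IH]; intros [|b m] [|c n] [|c' n'];
    simpl; try tauto.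
  intros [H1 H2] [H3 H4]. f_equal; eauto.
Qed.

Lemma rel3_concat A B C A' B' C' (R : A -> B -> C -> Prop) (S : A' -> B' -> C' -> Prop)
  (f : A' -> list A) (g : B' -> list B) (h : C' -> list C) l m n :
  (forall a b c, In a l -> S a b c -> rel3 R (f a) (g b) (h c)) -> rel3 S l m n ->
  rel3 R (concat (map f l)) (concat (map g m)) (concat (map h n)).
Proof.
  intros H; revert m n; induction l as [|a l IH]; intros [|b m] [|c n]; simpl; try tauto.
  intros [H1 H2]. apply rel3_app; [apply H; simpl; auto|]. apply IH; [|exact H2].
  intros; apply H; simpl; auto.
Qed.

Lemma rel3_map A B C A' B' C' (R : A -> B -> C -> Prop) (S : A' -> B' -> C' -> Prop)
  (f : A' -> A) (g : B' -> B) (h : C' -> C) l m n :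
  (forall a b c, In a l -> S a b c -> R (f a) (g b) (h c)) -> rel3 S l m n ->
  rel3 R (map f l) (map g m) (map h n).
Proof.
  intros H; revert m n; induction l as [|a l IH]; intros [|b m] [|c n]; simpl; try tauto.
  intros [H1 H2]. split; [apply H; simpl; auto|]. apply IH; [|exact H2].
  intros; apply H; simpl; auto.
Qed.

Definition graph_on (A B : Type) (dom : A -> Prop) (rel : A -> B -> Prop) : Prop :=
  (forall a b, rel a b -> dom a) /\ (forall a, dom a -> exists b, rel a b) /\
  (forall a b b', rel a b -> rel a b' -> b = b').

(** A total relation inside a single-valued one with the same domain exhausts it. Hence every
    equation in the exponential comes down to one inclusion of graphs. *)
Lemma graph_on_ext (A B : Type) (dom : A -> Prop) (r r' : A -> B -> Prop) :
  graph_on dom r -> graph_on dom r' -> (forall a b, r a b -> r' a b) -> r = r'.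
Proof.
  intros (H1 & H2 & H3) (H1' & H2' & H3') H.
  apply functional_extensionality; intros a. apply functional_extensionality; intros b.
  apply propositional_extensionality; split; [apply H|].
  intros K. destruct (H2 a (H1' _ _ K)) as [b' Kb]. rewrite (H3' _ _ _ K (H _ _ Kb)). exact Kb.
Qed.

Section Exponential.
Context {D E : vdc} (P : vdf D E) (TF : two_factorizations P) (TC : two_decompositions P)
  (Y : vdc).
Let AD := vaxioms D.
Let TD := vdc_axioms_typing AD.
Let AE := vaxioms E.
Let TE := vdc_axioms_typing AE.
Let AY := vaxioms Y.
Let TY := vdc_axioms_typing AY.

(* An arrow or multicell of the exponential over [e] is a function from the part of
   [D] over [e] to [Y], stored as its graph; objects and loose arrows also carry the
   action on the vertical arrows, respectively the vertical unary multicells. *)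
Record eob := EOb { eo : ob E; ro : ob D -> ob Y -> Prop; rv : tarr D -> tarr Y -> Prop }.
Record etarr := ETarr { et : tarr E; sT : eob; tT : eob; rt : tarr D -> tarr Y -> Prop }.
Record elarr := ELarr { el : larr E; sL : eob; tL : eob;
  rl : larr D -> larr Y -> Prop; ru : cell D -> cell Y -> Prop }.
Record ecell := ECell { ec : cell E; cS : list elarr; cT : elarr; cL : etarr; cR : etarr;
  rc : cell D -> cell Y -> Prop }.

Lemma eob_ext X X' : eo X = eo X' -> ro X = ro X' -> rv X = rv X' -> X = X'.
Proof. destruct X, X'; simpl; congruence. Qed.
Lemma etarr_ext F F' : et F = et F' -> sT F = sT F' -> tT F = tT F' -> rt F = rt F' -> F = F'.
Proof. destruct F, F'; simpl; congruence. Qed.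
Lemma elarr_ext U U' : el U = el U' -> sL U = sL U' -> tL U = tL U' -> rl U = rl U' ->
  ru U = ru U' -> U = U'.
Proof. destruct U, U'; simpl; congruence. Qed.
Lemma ecell_ext A A' : ec A = ec A' -> cS A = cS A' -> cT A = cT A' -> cL A = cL A' ->
  cR A = cR A' -> rc A = rc A' -> A = A'.
Proof. destruct A, A'; simpl; congruence. Qed.

Definition etid (X : eob) : etarr := ETarr (tid (eo X)) X X (rv X).
Definition etcomp (F G : etarr) : etarr :=
  ETarr (tcomp (et F) (et G)) (sT F) (tT G)
    (fun a y => exists x z yx yz, pair_of a x z /\ rt F x yx /\ rt G z yz /\ y = tcomp yx yz).
Definition ecid (U : elarr) : ecell :=
  ECell (cid (el U)) [U] U (etid (sL U)) (etid (tL U)) (ru U).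
Definition eccomp (A : ecell) (F : etarr) (Bs : list ecell) : ecell :=
  ECell (ccomp (ec A) (et F) (map ec Bs)) (concat (map cS Bs)) (cT A)
    (etcomp F (cL A)) (etcomp (row_end cR F Bs) (cR A))
    (fun d y => exists a f bs ya yf ybs, stack_of d a f bs /\
       rc A a ya /\ rt F f yf /\ rel3 rc Bs bs ybs /\ y = ccomp ya yf ybs).

Definition exp_data : vdc_data := {|
  ob := eob; tarr := etarr; larr := elarr; cell := ecell;
  tdom := sT; tcod := tT; tid := etid; tcomp := etcomp;
  lsrc := sL; ltgt := tL; csrc := cS; ctgt := cT; cleft := cL; cright := cR;
  cid := ecid; ccomp := eccomp |}.

(** Compatibility with vertical arrows is stated as the inclusions [okt_l] and [okt_r] of the unit
    composites: [etid] is the action on vertical arrows, so naturality and the unit laws coincide.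
    Goodness of the endpoints is left to [okT], because [okO] itself asks this condition of
    [etid X]. *)
Record okT0 (F : etarr) : Prop := {
  okt_graph : graph_on (fun t => ftarr P t = et F) (rt F);
  okt_dom : tdom (et F) = eo (sT F);
  okt_cod : tcod (et F) = eo (tT F);
  okt_rdom : forall t y, rt F t y -> ro (sT F) (tdom t) (tdom y);
  okt_rcod : forall t y, rt F t y -> ro (tT F) (tcod t) (tcod y);
  okt_l : forall t y, rt (etcomp (etid (sT F)) F) t y -> rt F t y;
  okt_r : forall t y, rt (etcomp F (etid (tT F))) t y -> rt F t y
}.

(** A functor from the fibre of [P] over [eo X] to the tight arrows of [Y]: preservation of
    composites is [okt_l] for [etid X]. *)
Record okO (X : eob) : Prop := {
  oko_graph : graph_on (fun d => fob P d = eo X) (ro X);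
  oko_id : okT0 (etid X);
  oko_tid : forall d y, ro X d y -> rv X (tid d) (tid y)
}.

Definition okT (F : etarr) : Prop := okO (sT F) /\ okO (tT F) /\ okT0 F.

Record okC0 (A : ecell) : Prop := {
  okc_graph : graph_on (fun c => fcell P c = ec A) (rc A);
  okc_src : csrc (ec A) = map el (cS A);
  okc_tgt : ctgt (ec A) = el (cT A);
  okc_left : cleft (ec A) = et (cL A);
  okc_right : cright (ec A) = et (cR A);
  okc_path : lpath_ok sL tL (sT (cL A)) (cS A) (sT (cR A));
  okc_tsrc : sL (cT A) = tT (cL A);
  okc_ttgt : tL (cT A) = tT (cR A);
  okc_rsrc : forall c y, rc A c y -> rel3 rl (cS A) (csrc c) (csrc y);
  okc_rtgt : forall c y, rc A c y -> rl (cT A) (ctgt c) (ctgt y);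
  okc_rleft : forall c y, rc A c y -> rt (cL A) (cleft c) (cleft y);
  okc_rright : forall c y, rc A c y -> rt (cR A) (cright c) (cright y);
  okc_below : forall c y, rc (eccomp (ecid (cT A)) (cL A) [A]) c y -> rc A c y;
  okc_above : forall c y,
    rc (eccomp A (etid (sT (cL A))) (map ecid (cS A))) c y -> rc A c y
}.

Record okL (U : elarr) : Prop := {
  okl_s : okO (sL U);
  okl_t : okO (tL U);
  okl_src : lsrc (el U) = eo (sL U);
  okl_tgt : ltgt (el U) = eo (tL U);
  okl_graph : graph_on (fun u => flarr P u = el U) (rl U);
  okl_rsrc : forall u y, rl U u y -> ro (sL U) (lsrc u) (lsrc y);
  okl_rtgt : forall u y, rl U u y -> ro (tL U) (ltgt u) (ltgt y);
  okl_id : okC0 (ecid U);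
  okl_cid : forall u y, rl U u y -> ru U (cid u) (cid y)
}.

Record okC (A : ecell) : Prop := {
  okc_S : Forall okL (cS A);
  okc_T : okL (cT A);
  okc_L : okT (cL A);
  okc_R : okT (cR A);
  okc_0 : okC0 A
}.

Lemma okT_tid X : okO X -> okT (etid X).
Proof. intros H. split; [exact H|split; [exact H|apply (oko_id H)]]. Qed.

Lemma okC_cid U : okL U -> okC (ecid U).
Proof.
  intros H. split; simpl.
  - constructor; [exact H|constructor].
  - exact H.
  - apply okT_tid, (okl_s H).
  - apply okT_tid, (okl_t H).
  - apply (okl_id H).
Qed.

Lemma graph_dom A B (dom : A -> Prop) (r : A -> B -> Prop) a b :
  graph_on dom r -> r a b -> dom a.
Proof. intros (H & _); apply H. Qed.

Lemma graph_total A B (dom : A -> Prop) (r : A -> B -> Prop) a :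
  graph_on dom r -> dom a -> exists b, r a b.
Proof. intros (_ & H & _); apply H. Qed.

Lemma graph_fun A B (dom : A -> Prop) (r : A -> B -> Prop) a b b' :
  graph_on dom r -> r a b -> r a b' -> b = b'.
Proof. intros (_ & _ & H); apply H. Qed.

(** * Tight composition in the exponential *)

Section TightComposite.
Context (F G : etarr) (okF : okT F) (okG : okT G) (FG : tT F = sT G).

Lemma tcomp_base : tcod (et F) = tdom (et G).
Proof.
  destruct okF as (_ & _ & F0), okG as (_ & _ & G0).
  rewrite (okt_cod F0), (okt_dom G0), FG. reflexivity.
Qed.

Lemma tcomp_rel x z yx yz : rt F x yx -> rt G z yz -> tcod x = tdom z -> tcod yx = tdom yz.
Proof.
  destruct okF as (_ & OF & F0), okG as (_ & _ & G0). intros Hx Hz H.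
  apply (okt_rcod F0) in Hx. apply (okt_rdom G0) in Hz. rewrite <- FG, <- H in Hz.
  apply (graph_fun (oko_graph OF) Hx Hz).
Qed.

Definition val_t (p : tarr D * tarr D) (y : tarr Y) : Prop :=
  tcod (fst p) = tdom (snd p) /\
  exists yx yz, rt F (fst p) yx /\ rt G (snd p) yz /\ y = tcomp yx yz.

Lemma val_t_fun p y y' : val_t p y -> val_t p y' -> y = y'.
Proof.
  destruct okF as (_ & _ & F0), okG as (_ & _ & G0).
  intros (_ & yx & yz & H1 & H2 & ->) (_ & yx' & yz' & H1' & H2' & ->).
  rewrite (graph_fun (okt_graph F0) H1 H1'), (graph_fun (okt_graph G0) H2 H2'). reflexivity.
Qed.

(** Both values are the composite of [yx], [ym], [yz], where [ym] is the action of the middle object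
    on the vertical arrow. [okt_l] for [G] and [okt_r] for [F] produce the two bracketings. *)
Lemma val_t_step p q : step_t P p q -> ftarr P (fst p) = et F -> ftarr P (snd p) = et G ->
  exists y, val_t p y /\ val_t q y.
Proof.
  destruct p as [p1 p2], q as [q1 q2]. intros Hs Hp1 Hp2. pose proof Hs as Hi.
  apply step_t_inv in Hi. destruct Hi as ((C1 & C2) & _ & I1 & I2).
  destruct Hs as (x & m & z & H1 & H2 & Hm & E1 & E2).
  injection E1 as -> ->. injection E2 as -> ->. simpl in *.
  destruct okF as (OF1 & OF & F0), okG as (_ & _ & G0).
  destruct (graph_total (okt_graph F0) Hp1) as [yx Hx].
  destruct (graph_total (a := z) (okt_graph G0)) as [yz Hz]; [congruence|].
  assert (Xm : ftarr P m = et (etid (tT F))).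
  { rewrite Hm, <- H1, <- f_tcod, Hp1. simpl. f_equal. apply (okt_cod F0). }
  destruct (graph_total (okt_graph (oko_id OF)) Xm) as [ym Hym]. simpl in Hym.
  assert (Exm : rt F (tcomp x m) (tcomp yx ym)).
  { apply (okt_r F0). exists x, m, yx, ym. repeat split; assumption. }
  assert (Emz : rt G (tcomp m z) (tcomp ym yz)).
  { apply (okt_l G0). exists m, z, ym, yz. rewrite <- FG. repeat split; assumption. }
  assert (T1 : tcod yx = tdom ym).
  { apply (okt_rcod F0) in Hx. apply (okt_rdom (oko_id OF)) in Hym. simpl in Hym.
    rewrite <- H1 in Hym. apply (graph_fun (oko_graph OF) Hx Hym). }
  assert (T2 : tcod ym = tdom yz).
  { apply (okt_rdom G0) in Hz. apply (okt_rcod (oko_id OF)) in Hym. simpl in Hym.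
    rewrite FG, H2 in Hym. rewrite FG in OF. apply (graph_fun (oko_graph OF) Hym Hz). }
  exists (tcomp yx (tcomp ym yz)). split.
  - split; [exact C1|]. exists yx, (tcomp ym yz). auto.
  - split; [exact C2|]. exists (tcomp yx ym), yz. split; [exact Exm|split; [exact Hz|]].
    symmetry. apply (ax_tcomp_assoc AY); assumption.
Qed.

(** No assumption on where the pairs lie: away from the bases of [F] and [G] neither side has a
    value, and a step preserves the images. *)
Lemma val_t_crst p q : clos_refl_sym_trans _ (step_t P) p q -> forall y, val_t p y <-> val_t q y.
Proof.
  destruct okF as (_ & _ & F0), okG as (_ & _ & G0).
  induction 1 as [p q H|p|p q _ IH|p q r _ IH1 _ IH2]; intros y.
  - assert (O : val_t p y \/ val_t q y -> ftarr P (fst p) = et F /\ ftarr P (snd p) = et G).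
    { destruct p as [p1 p2], q as [q1 q2].
      pose proof H as Hi. apply step_t_inv in Hi. destruct Hi as (_ & _ & I1 & I2). simpl.
      rewrite I1, I2 at 1. intros [(_ & yx & yz & K1 & K2 & _)|(_ & yx & yz & K1 & K2 & _)];
        simpl in *; apply (graph_dom (okt_graph F0)) in K1;
        apply (graph_dom (okt_graph G0)) in K2; split; congruence. }
    split; intros Hv.
    + destruct O as [O1 O2]; [auto|]. destruct (val_t_step H O1 O2) as (y0 & V1 & V2).
      rewrite (val_t_fun Hv V1). exact V2.
    + destruct O as [O1 O2]; [auto|]. destruct (val_t_step H O1 O2) as (y0 & V1 & V2).
      rewrite (val_t_fun Hv V2). exact V1.
  - reflexivity.
  - symmetry; apply IH.
  - rewrite IH1; apply IH2.
Qed.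

Lemma etcomp_graph : graph_on (fun t => ftarr P t = et (etcomp F G)) (rt (etcomp F G)).
Proof.
  destruct okF as (_ & _ & F0), okG as (_ & _ & G0). split; [|split].
  - intros a y (x & z & yx & yz & (H & ->) & H1 & H2 & _). simpl.
    rewrite f_tcomp by assumption. f_equal.
    + apply (graph_dom (okt_graph F0) H1).
    + apply (graph_dom (okt_graph G0) H2).
  - intros a Ha. destruct (TF tcomp_base Ha) as [(x & z & Hp & Hx & Hz) _].
    destruct (graph_total (okt_graph F0) Hx) as [yx Kx].
    destruct (graph_total (okt_graph G0) Hz) as [yz Kz].
    exists (tcomp yx yz), x, z, yx, yz. auto.
  - intros a y y' (x & z & yx & yz & Hp & H1 & H2 & ->) (x' & z' & yx' & yz' & Hp' & H1' & H2' & ->).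
    assert (Ha : ftarr P a = tcomp (et F) (et G)).
    { destruct Hp as (Hp & ->). rewrite f_tcomp by assumption. f_equal.
      + apply (graph_dom (okt_graph F0) H1).
      + apply (graph_dom (okt_graph G0) H2). }
    destruct (TF tcomp_base Ha) as [_ C].
    assert (K : clos_refl_sym_trans _ (step_t P) (x, z) (x', z')).
    { apply C; try assumption;
      first [apply (graph_dom (okt_graph F0) H1)|apply (graph_dom (okt_graph F0) H1')|
             apply (graph_dom (okt_graph G0) H2)|apply (graph_dom (okt_graph G0) H2')]. }
    apply (val_t_fun (p := (x', z'))).
    + apply (val_t_crst K). split; [apply Hp|]. exists yx, yz; auto.
    + split; [apply Hp'|]. exists yx', yz'; auto.
Qed.

Lemma okT_tcomp : okT (etcomp F G).
Proof.
  pose proof okF as (OF1 & OF2 & F0). pose proof okG as (OG1 & OG2 & G0).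
  split; [exact OF1|split; [exact OG2|]].
  split; simpl.
  - exact etcomp_graph.
  - rewrite (ax_tcomp_dom AE) by exact tcomp_base. apply (okt_dom F0).
  - rewrite (ax_tcomp_cod AE) by exact tcomp_base. apply (okt_cod G0).
  - intros t y (x & z & yx & yz & (H & ->) & H1 & H2 & ->).
    rewrite (ax_tcomp_dom AD), (ax_tcomp_dom AY); [apply (okt_rdom F0 H1)| |exact H].
    apply (tcomp_rel H1 H2 H).
  - intros t y (x & z & yx & yz & (H & ->) & H1 & H2 & ->).
    rewrite (ax_tcomp_cod AD), (ax_tcomp_cod AY); [apply (okt_rcod G0 H2)| |exact H].
    apply (tcomp_rel H1 H2 H).
  - intros t y (v & w & yv & yw & (H & ->) & H1 & (x & z & yx & yz & (H' & ->) & H3 & H4 & ->) & ->).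
    rewrite (ax_tcomp_dom AD) in H by assumption.
    exists (tcomp v x), z, (tcomp yv yx), yz.
    assert (T1 : tcod yv = tdom yx).
    { apply (okt_rdom F0) in H3. apply (okt_rcod (oko_id OF1)) in H1. simpl in H1.
      rewrite H in H1. apply (graph_fun (oko_graph OF1) H1 H3). }
    split; [split|split; [|split; [exact H4|]]].
    + rewrite (ax_tcomp_cod AD) by exact H. exact H'.
    + symmetry. apply (ax_tcomp_assoc AD); assumption.
    + apply (okt_l F0). exists v, x, yv, yx. repeat split; assumption.
    + symmetry. apply (ax_tcomp_assoc AY); [exact T1|]. apply (tcomp_rel H3 H4 H').
  - intros t y (w & v & yw & yv & (H & ->) & (x & z & yx & yz & (H' & ->) & H3 & H4 & ->) & H1 & ->).
    rewrite (ax_tcomp_cod AD) in H by assumption.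
    exists x, (tcomp z v), yx, (tcomp yz yv).
    assert (T1 : tcod yz = tdom yv).
    { apply (okt_rcod G0) in H4. apply (okt_rdom (oko_id OG2)) in H1. simpl in H1.
      rewrite <- H in H1. apply (graph_fun (oko_graph OG2) H4 H1). }
    split; [split|split; [exact H3|split]].
    + rewrite (ax_tcomp_dom AD) by exact H. exact H'.
    + apply (ax_tcomp_assoc AD); assumption.
    + apply (okt_r G0). exists z, v, yz, yv. repeat split; assumption.
    + apply (ax_tcomp_assoc AY); [|exact T1]. apply (tcomp_rel H3 H4 H').
Qed.

End TightComposite.

Lemma etarr_eq F G : et F = et G -> sT F = sT G -> tT F = tT G -> okT0 F -> okT0 G ->
  (forall t y, rt F t y -> rt G t y) -> F = G.
Proof.
  intros H1 H2 H3 F0 G0 H. assert (R : rt F = rt G).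
  { apply (graph_on_ext (okt_graph F0)); [|exact H]. rewrite H1. apply (okt_graph G0). }
  apply etarr_ext; assumption.
Qed.

Lemma ecell_eq A B : ec A = ec B -> cS A = cS B -> cT A = cT B -> cL A = cL B -> cR A = cR B ->
  okC0 A -> okC0 B -> (forall c y, rc A c y -> rc B c y) -> A = B.
Proof.
  intros H1 H2 H3 H4 H5 A0 B0 H. assert (R : rc A = rc B).
  { apply (graph_on_ext (okc_graph A0)); [|exact H]. rewrite H1. apply (okc_graph B0). }
  apply ecell_ext; assumption.
Qed.

Lemma okt_fun F : okT F -> forall t y y', rt F t y -> rt F t y' -> y = y'.
Proof. intros (_ & _ & F0) t y y'. apply (graph_fun (okt_graph F0)). Qed.

Lemma okc_fun A : okC A -> forall c y y', rc A c y -> rc A c y' -> y = y'.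
Proof. intros H c y y'. apply (graph_fun (okc_graph (okc_0 H))). Qed.

Lemma okl_fun U : okL U -> forall c y y', rl U c y -> rl U c y' -> y = y'.
Proof. intros H c y y'. apply (graph_fun (okl_graph H)). Qed.

Lemma row_rel_ends Bs : Forall okC Bs -> forall F f yf bs ys, okT F -> vrow_ok exp_data F Bs ->
  vrow_ok D f bs -> rt F f yf -> rel3 rc Bs bs ys ->
  vrow_ok Y yf ys /\
  rt (vrow_end exp_data F Bs) (vrow_end D f bs) (vrow_end Y yf ys) /\
  okT (vrow_end exp_data F Bs).
Proof.
  induction 1 as [|B Bs HB _ IH]; intros F f yf [|b bs] [|y ys] HF RF Rf Hf Hr;
    simpl in Hr; try tauto.
  destruct RF as [<- RF], Rf as [<- Rf], Hr as [Hb Hr].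
    pose proof (okc_rleft (okc_0 HB) Hb) as Hl.
    pose proof (okc_rright (okc_0 HB) Hb) as Hrr.
    rewrite (okt_fun HF Hf Hl).
    destruct (IH _ _ _ _ _ (okc_R HB) RF Rf Hrr Hr) as (I1 & I2 & I3).
    split; [split; [reflexivity|exact I1]|]. split; [exact I2|exact I3].
Qed.

Lemma row_rel_src Bs bs ys : Forall okC Bs -> rel3 rc Bs bs ys ->
  rel3 rl (concat (map cS Bs)) (concat (map (@csrc D) bs)) (concat (map (@csrc Y) ys)).
Proof.
  intros H. apply rel3_concat. intros B b y HB. rewrite Forall_forall in H.
  apply (okc_rsrc (okc_0 (H _ HB))).
Qed.

Lemma row_rel_tgt Bs bs ys : Forall okC Bs -> rel3 rc Bs bs ys ->
  rel3 rl (map cT Bs) (map (@ctgt D) bs) (map (@ctgt Y) ys).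
Proof.
  intros H. apply rel3_map. intros B b y HB. rewrite Forall_forall in H.
  apply (okc_rtgt (okc_0 (H _ HB))).
Qed.

Lemma row_rel_base Bs bs ys : Forall okC Bs -> rel3 rc Bs bs ys ->
  map (fcell P) bs = map ec Bs.
Proof.
  intros H; revert bs ys; induction H as [|B Bs HB _ IH]; intros [|b bs] [|y ys]; simpl; try tauto.
  intros [H1 H2]. f_equal; [apply (graph_dom (okc_graph (okc_0 HB)) H1)|apply (IH _ _ H2)].
Qed.

Lemma row_rel_exists Bs bs : Forall okC Bs -> map (fcell P) bs = map ec Bs ->
  exists ys, rel3 rc Bs bs ys.
Proof.
  intros H; revert bs; induction H as [|B Bs HB _ IH]; intros [|b bs]; simpl; try discriminate.
  - intros _. exists []; exact I.
  - intros K. injection K as K1 K2. destruct (IH _ K2) as [ys Hys].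
    destruct (graph_total (okc_graph (okc_0 HB)) K1) as [y Hy]. exists (y :: ys); split; assumption.
Qed.

Lemma row_rel_fun Bs bs ys ys' : Forall okC Bs -> rel3 rc Bs bs ys -> rel3 rc Bs bs ys' -> ys = ys'.
Proof.
  intros H. apply rel3_unique. revert H. apply Forall_impl. intros B HB. apply (okc_fun HB).
Qed.

(** Boundaries of values are values of boundaries. Matching boundaries in [D] and in the exponential
    therefore have equal values, by single-valuedness. *)
Lemma comp_rel A F Bs a f bs ya yf ys : okC A -> okT F -> Forall okC Bs ->
  composable exp_data A F Bs -> composable D a f bs ->
  rc A a ya -> rt F f yf -> rel3 rc Bs bs ys -> composable Y ya yf ys.
Proof.
  intros HA HF HB (R1 & R2 & R3) (K1 & K2 & K3) Ha Hf Hb.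
  destruct (row_rel_ends HB HF R1 K1 Hf Hb) as (I1 & _).
  split; [exact I1|split].
  - pose proof (row_rel_tgt HB Hb) as H1. pose proof (okc_rsrc (okc_0 HA) Ha) as H2.
    simpl in R2. rewrite R2, K2 in H1. revert H1 H2. apply rel3_unique.
    pose proof (okc_S HA) as HS. revert HS. apply Forall_impl. intros U HU. apply (okl_fun HU).
  - destruct HF as (_ & OF & F0). destruct (okc_L HA) as (_ & _ & L0).
    apply (okt_rcod F0) in Hf. apply (okc_rleft (okc_0 HA)) in Ha. apply (okt_rdom L0) in Ha.
    simpl in R3. rewrite <- R3, <- K3 in Ha. apply (graph_fun (oko_graph OF) Hf Ha).
Qed.

Lemma row_base_ok F Bs : Forall okC Bs -> vrow_ok exp_data F Bs ->
  vrow_ok E (et F) (map ec Bs).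
Proof.
  intros H; revert F; induction H as [|B Bs HB _ IH]; simpl; intros F R; [exact I|].
  destruct R as [<- R]. split; [apply (okc_left (okc_0 HB))|].
  rewrite (okc_right (okc_0 HB)). apply IH, R.
Qed.

Lemma row_base_end F Bs : Forall okC Bs ->
  row_end (@cright E) (et F) (map ec Bs) = et (row_end cR F Bs).
Proof.
  intros H; revert F; induction H as [|B Bs HB _ IH]; simpl; intros F; [reflexivity|].
  rewrite (okc_right (okc_0 HB)). apply IH.
Qed.

Lemma row_base_tgt Bs : Forall okC Bs -> map (@ctgt E) (map ec Bs) = map el (map cT Bs).
Proof.
  induction 1 as [|B Bs HB _ IH]; simpl; [reflexivity|].
  rewrite IH, (okc_tgt (okc_0 HB)); reflexivity.
Qed.

Lemma row_base_src Bs : Forall okC Bs ->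
  concat (map (@csrc E) (map ec Bs)) = map el (concat (map cS Bs)).
Proof.
  induction 1 as [|B Bs HB _ IH]; simpl; [reflexivity|].
  rewrite IH, (okc_src (okc_0 HB)), map_app; reflexivity.
Qed.

Lemma comp_base A F Bs : okC A -> okT F -> Forall okC Bs -> composable exp_data A F Bs ->
  composable E (ec A) (et F) (map ec Bs).
Proof.
  intros HA (_ & _ & F0) HB (R1 & R2 & R3). split; [apply row_base_ok; assumption|split].
  - rewrite row_base_tgt by assumption. simpl in R2. rewrite R2.
    symmetry. apply (okc_src (okc_0 HA)).
  - rewrite (okt_cod F0), (okc_left (okc_0 HA)). destruct (okc_L HA) as (_ & _ & L0).
    rewrite (okt_dom L0). f_equal. exact R3.
Qed.

Lemma row_base_comp Bs : Forall okC Bs -> forall G Cs, Forall okC Cs ->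
  map ec (vrow_comp exp_data G Bs Cs) = vrow_comp E (et G) (map ec Bs) (map ec Cs).
Proof.
  unfold vrow_comp. induction 1 as [|B Bs HB _ IH]; intros G Cs HC; simpl; [reflexivity|].
  rewrite (okc_src (okc_0 HB)), length_map, firstn_map, skipn_map.
  rewrite <- (firstn_skipn (length (cS B)) Cs) in HC. apply Forall_app in HC.
  destruct HC as [H1 H2]. rewrite IH by exact H2. rewrite row_base_end by exact H1. reflexivity.
Qed.

Lemma exp_tgt_path G Cs : Forall okC Cs -> vrow_ok exp_data G Cs ->
  lpath_ok sL tL (tT G) (map cT Cs) (tT (row_end cR G Cs)).
Proof.
  intros H; revert G. induction H as [|C Cs HC _ IH]; simpl; intros G S; [reflexivity|].
  destruct S as [<- S]. split; [apply (okc_tsrc (okc_0 HC))|].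
  rewrite (okc_ttgt (okc_0 HC)). apply IH, S.
Qed.

Lemma exp_src_path G Cs : Forall okC Cs -> vrow_ok exp_data G Cs ->
  lpath_ok sL tL (sT G) (concat (map cS Cs)) (sT (row_end cR G Cs)).
Proof.
  intros H; revert G. induction H as [|C Cs HC _ IH]; simpl; intros G S; [reflexivity|].
  destruct S as [<- S]. eapply lpath_app; [apply (okc_path (okc_0 HC))|]. apply IH, S.
Qed.

Lemma exp_ids_ok x p y : lpath_ok sL tL x p y ->
  row_ok cL cR (etid x) (map ecid p) /\ row_end cR (etid x) (map ecid p) = etid y.
Proof.
  revert x; induction p as [|u p IH]; simpl; intros x H.
  - subst; auto.
  - destruct H as [<- H]. destruct (IH _ H) as [H1 H2]. auto.
Qed.

Lemma exp_comp_end A F Bs : okC A -> Forall okC Bs -> composable exp_data A F Bs ->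
  tT (row_end cR F Bs) = sT (cR A).
Proof.
  intros HA HB (H & H1 & H2). pose proof (exp_tgt_path HB H) as Hp.
  simpl in H1, H2. rewrite H1, H2 in Hp. eapply lpath_end_unique; [exact Hp|].
  apply (okc_path (okc_0 HA)).
Qed.

Lemma exp_ids_tgt p : map cT (map ecid p) = p.
Proof. induction p as [|u p IH]; simpl; congruence. Qed.

Lemma exp_ids_src p : concat (map cS (map ecid p)) = p.
Proof. induction p as [|u p IH]; simpl; congruence. Qed.

Lemma exp_stack_idr F Bs : Forall okC Bs -> vrow_ok exp_data F Bs ->
  stack exp_data F Bs (etid (sT F)) (map ecid (concat (map cS Bs))).
Proof.
  intros HB H. split; [exact H|split; [|split; [|reflexivity]]].
  - apply (exp_ids_ok (exp_src_path HB H)).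
  - apply exp_ids_tgt.
Qed.

Lemma exp_stack_idl F Bs : Forall okC Bs -> vrow_ok exp_data F Bs ->
  stack exp_data (etid (tT F)) (map ecid (map cT Bs)) F Bs.
Proof.
  intros HB H. split; [|split; [exact H|split; [|reflexivity]]].
  - apply (exp_ids_ok (exp_tgt_path HB H)).
  - symmetry. apply exp_ids_src.
Qed.

Lemma okC_ids p : Forall okL p -> Forall okC (map ecid p).
Proof. induction 1; simpl; constructor; [apply okC_cid; assumption|assumption]. Qed.

Lemma okL_srcs Bs : Forall okC Bs -> Forall okL (concat (map cS Bs)).
Proof.
  induction 1 as [|B Bs HB _ IH]; simpl; [constructor|].
  apply Forall_app; split; [apply (okc_S HB)|exact IH].
Qed.

Lemma okT_row_end Bs : Forall okC Bs -> forall F, okT F -> okT (row_end cR F Bs).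
Proof.
  induction 1 as [|B Bs HB _ IH]; simpl; intros F HF; [exact HF|]. apply IH, (okc_R HB).
Qed.

Lemma exp_composable_idr A : okC A ->
  composable exp_data A (etid (sT (cL A))) (map ecid (cS A)).
Proof.
  intros HA. split; [|split; [|reflexivity]].
  - apply (exp_ids_ok (okc_path (okc_0 HA))).
  - apply exp_ids_tgt.
Qed.

(** With [row_above], the unit inclusions for whole rows, needed because a vertical move across an
    interface touches every cell of the row. *)
Lemma row_below Bs : Forall okC Bs -> forall F bs ys, vrow_ok exp_data F Bs ->
  rel3 rc (vrow_comp exp_data F (map ecid (map cT Bs)) Bs) bs ys -> rel3 rc Bs bs ys.
Proof.
  unfold vrow_comp. induction 1 as [|B Bs HB _ IH]; simpl; intros F [|b bs] [|y ys] H; try tauto.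
  destruct H as [<- H]. intros [H1 H2]. split; [apply (okc_below (okc_0 HB) H1)|].
  apply (IH _ _ _ H H2).
Qed.

Lemma row_above Bs : Forall okC Bs -> forall F bs ys, vrow_ok exp_data F Bs ->
  rel3 rc (vrow_comp exp_data (etid (sT F)) Bs (map ecid (concat (map cS Bs)))) bs ys ->
  rel3 rc Bs bs ys.
Proof.
  unfold vrow_comp. induction 1 as [|B Bs HB _ IH]; simpl; intros F [|b bs] [|y ys] H; try tauto.
  destruct H as [<- H]. rewrite map_app.
  rewrite <- (length_map ecid (cS B)).
  rewrite firstn_app, skipn_app, Nat.sub_diag, firstn_all, skipn_all, firstn_O, app_nil_r.
  simpl. intros [H1 H2]. split; [apply (okc_above (okc_0 HB) H1)|].
  rewrite (proj2 (exp_ids_ok (okc_path (okc_0 HB)))) in H2. apply (IH _ _ _ H H2).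
Qed.

Lemma row_comp_rel f bs g cs : stack D f bs g cs -> forall Bs ybs F G Cs ycs yg,
  Forall okC Bs -> Forall okC Cs -> okT G -> stack exp_data F Bs G Cs ->
  rel3 rc Bs bs ybs -> rel3 rc Cs cs ycs -> rt G g yg ->
  rel3 rc (vrow_comp exp_data G Bs Cs) (vrow_comp D g bs cs) (vrow_comp Y yg ybs ycs).
Proof.
  revert f bs g cs.
  apply (stack_rec TD (Q := fun f bs g cs => forall Bs ybs F G Cs ycs yg,
  Forall okC Bs -> Forall okC Cs -> okT G -> stack exp_data F Bs G Cs ->
  rel3 rc Bs bs ybs -> rel3 rc Cs cs ycs -> rt G g yg ->
  rel3 rc (vrow_comp exp_data G Bs Cs) (vrow_comp D g bs cs) (vrow_comp Y yg ybs ycs))).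
  - intros f g _ [|B Bs] [|y ybs] F G Cs ycs yg; simpl; tauto.
  - intros b bs g c1 c2 Hc Hs IH [|B Bs] [|yb ybs] F G Cs ycs yg HB HC HG S Hb Hc' Hg;
      simpl in Hb; try tauto.
    destruct Hb as [Hb Hbs]. inversion HB as [|? ? HB1 HB2]; subst.
    destruct S as (S1 & S2 & S3 & S4). destruct S1 as [<- S1].
    simpl in S3. destruct (map_eq_app _ _ _ _ S3) as (C1 & C2 & -> & E1 & E2).
    (* The cells [B], [b] and [yb] have the same arity, so the three row composites cut their upper
       rows at the same place. *)
    pose proof (okc_rsrc (okc_0 HB1) Hb) as Hsrc. apply rel3_length in Hsrc.
    destruct Hsrc as [L1 L2].
    assert (LC : length C1 = length (cS B)) by (rewrite <- E1, length_map; reflexivity).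
    assert (Lc : length c1 = length (csrc b)) by apply (composable_length Hc).
    destruct (rel3_app_inv (l := C1) (l' := C2) (m := c1) (m' := c2) (R := rc) (n := ycs))
      as (y1 & y2 & -> & Hy1 & Hy2); [congruence|exact Hc'|].
    assert (Ly : length y1 = length (csrc yb)).
    { apply rel3_length in Hy1. destruct Hy1. congruence. }
    apply Forall_app in HC. destruct HC as [HC1 HC2].
    destruct (proj1 (vrow_ok_app (V := exp_data) G C1 C2) S2) as [S5 S6].
    destruct (row_rel_ends HC1 HG S5 (proj1 Hc) Hg Hy1) as (K1 & K2 & K3).
    rewrite (vrow_comp_cons (V := exp_data) _ _ _ LC).
    rewrite (vrow_comp_cons _ _ _ Lc), (vrow_comp_cons _ _ _ Ly).
    split.
    + exists b, g, c1, yb, yg, y1. split; [split; [exact Hc|reflexivity]|]. auto.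
    + apply (IH Bs ybs (cR B) (vrow_end exp_data G C1) C2 y2 (vrow_end Y yg y1)); try assumption.
      split; [exact S1|split; [exact S6|split; [exact E2|]]].
      clear - S5 S4 E1 HB1 HC1. simpl in *.
      pose proof (exp_tgt_path HC1 S5) as Hp.
      rewrite E1, S4 in Hp. eapply lpath_end_unique; [exact Hp|].
      apply (okc_path (okc_0 HB1)).
Qed.

(** * Multicell composition in the exponential *)

Section CellComposite.
Context (A : ecell) (F : etarr) (Bs : list ecell) (okA : okC A) (okF : okT F)
  (okB : Forall okC Bs) (Cp : composable exp_data A F Bs).

Definition val_c (p : cell D * tarr D * list (cell D)) (y : cell Y) : Prop :=
  let '(c, f, bs) := p in composable D c f bs /\
  exists yc yf ys, rc A c yc /\ rt F f yf /\ rel3 rc Bs bs ys /\ y = ccomp yc yf ys.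

Definition over_c (p : cell D * tarr D * list (cell D)) : Prop :=
  let '(c, f, bs) := p in fcell P c = ec A /\ ftarr P f = et F /\ map (fcell P) bs = map ec Bs.

Lemma val_c_fun p y y' : val_c p y -> val_c p y' -> y = y'.
Proof.
  destruct p as [[c f] bs].
  intros (_ & yc & yf & ys & H1 & H2 & H3 & ->) (_ & yc' & yf' & ys' & H1' & H2' & H3' & ->).
  rewrite (okc_fun okA H1 H1'), (okt_fun okF H2 H2'), (row_rel_fun okB H3 H3'). reflexivity.
Qed.

Lemma val_c_over p y : val_c p y -> over_c p.
Proof.
  destruct p as [[c f] bs]. intros (_ & yc & yf & ys & H1 & H2 & H3 & _).
  split; [|split].
  - apply (graph_dom (okc_graph (okc_0 okA)) H1).
  - destruct okF as (_ & _ & F0). apply (graph_dom (okt_graph F0) H2).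
  - apply (row_rel_base okB H3).
Qed.

(** The three layers [c], [(m, ss)], [(f, bs)] have values composable in [Y], the middle ones by the
    action on vertical arrows and multicells. [okc_above] absorbs the middle value into that of [c],
    [okt_r] and [row_below] absorb it into those of the upper layer, and associativity in [Y]
    compares the results. *)
Lemma val_c_step p q : step_c P p q -> over_c p -> exists y, val_c p y /\ val_c q y.
Proof.
  destruct p as [[p1 p2] p3], q as [[q1 q2] q3]. intros Hs (O1 & O2 & O3). pose proof Hs as Hi.
  apply step_c_inv in Hi. destruct Hi as ((C1 & C2) & _ & I1 & I2 & I3).
  destruct Hs as (c & m & ss & f & bs & H1 & H2 & Hm & Hss & E1 & E2).
  injection E1 as -> -> ->. injection E2 as -> -> ->.
  pose proof okF as (OF1 & OF & F0). pose proof Cp as (R1 & R2 & R3). simpl in R2, R3.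
  pose proof (okC_ids (okc_S okA)) as okI.
  pose proof (exp_composable_idr okA) as Ci.
  assert (Oc : fcell P c = ec A) by congruence.
  destruct (graph_total (okc_graph (okc_0 okA)) Oc) as [yc Hc].
  assert (Xm : ftarr P m = et (etid (sT (cL A)))).
  { rewrite (vert_t_eq Hm). destruct H1 as (_ & _ & ->).
    rewrite <- f_tdom, <- f_cleft, Oc, (okc_left (okc_0 okA)). simpl. f_equal.
    destruct (okc_L okA) as (_ & _ & L0). apply (okt_dom L0). }
  destruct (graph_total (okt_graph (oko_id (proj1 (okc_L okA)))) Xm) as [ym Hym].
  destruct (row_rel_exists (Bs := map ecid (cS A)) (bs := ss) okI) as [yss Hyss].
  { rewrite (vert_row_cells Hss). destruct H1 as (_ & -> & _).
    rewrite <- f_csrc, Oc, (okc_src (okc_0 okA)), !map_map. reflexivity. }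
  destruct (graph_total (okt_graph F0) O2) as [yf Hf].
  destruct (row_rel_exists okB O3) as [ybs Hbs].
  assert (Hcm : rc A (ccomp c m ss) (ccomp yc ym yss)).
  { apply (okc_above (okc_0 okA)). exists c, m, ss, yc, ym, yss.
    split; [split; [exact H1|reflexivity]|]. auto. }
  assert (Hfm : rt F (tcomp f m) (tcomp yf ym)).
  { apply (okt_r F0). exists f, m, yf, ym. split; [split; [apply H2|reflexivity]|].
    rewrite R3. auto. }
  assert (Hbm : rel3 rc Bs (vrow_comp D f ss bs) (vrow_comp Y yf yss ybs)).
  { apply (row_below okB R1).
    (* By composability the identities on the sources of [A] are the identities on the targets of
       [Bs], so [ss] has a value on either side of the interface. *)
    apply (row_comp_rel (F := etid (tT F)) H2); try assumption.
    - rewrite R2. exact okI.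
    - apply exp_stack_idl; assumption.
    - rewrite R2. exact Hyss. }
  assert (K1 : composable Y yc ym yss).
  { apply (comp_rel okA (okT_tid (proj1 (okc_L okA))) okI Ci H1 Hc Hym Hyss). }
  assert (K2 : composable Y (ccomp yc ym yss) yf ybs).
  { apply (comp_rel okA okF okB Cp C1 Hcm Hf Hbs). }
  exists (ccomp (ccomp yc ym yss) yf ybs). split.
  - split; [exact C1|]. exists (ccomp yc ym yss), yf, ybs. auto.
  - split; [exact C2|]. exists yc, (tcomp yf ym), (vrow_comp Y yf yss ybs).
    split; [exact Hc|split; [exact Hfm|split; [exact Hbm|]]].
    apply (ax_comp_assoc AY K1 K2).
Qed.

Lemma val_c_crst p q : clos_refl_sym_trans _ (step_c P) p q -> forall y, val_c p y <-> val_c q y.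
Proof.
  induction 1 as [p q H|p|p q _ IH|p q r _ IH1 _ IH2]; intros y.
  - assert (O : over_c q -> over_c p).
    { destruct p as [[p1 p2] p3], q as [[q1 q2] q3].
      pose proof H as Hi. apply step_c_inv in Hi. destruct Hi as (_ & _ & I1 & I2 & I3).
      unfold over_c. rewrite I1, I2, I3. tauto. }
    split; intros Hv.
    + destruct (val_c_step H (val_c_over Hv)) as (y0 & V1 & V2).
      rewrite (val_c_fun Hv V1). exact V2.
    + destruct (val_c_step H (O (val_c_over Hv))) as (y0 & V1 & V2).
      rewrite (val_c_fun Hv V2). exact V1.
  - reflexivity.
  - symmetry; apply IH.
  - rewrite IH1; apply IH2.
Qed.

Lemma eccomp_base c f bs : composable D c f bs -> over_c (c, f, bs) ->
  fcell P (ccomp c f bs) = ec (eccomp A F Bs).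
Proof. intros H (H1 & H2 & H3). rewrite (f_ccomp P H), H1, H2, H3. reflexivity. Qed.

Lemma eccomp_graph : graph_on (fun c => fcell P c = ec (eccomp A F Bs)) (rc (eccomp A F Bs)).
Proof.
  assert (V : forall d y, rc (eccomp A F Bs) d y <->
    exists c f bs, d = ccomp c f bs /\ val_c (c, f, bs) y).
  { intros d y; split.
    - intros (c & f & bs & ya & yf & ys & (H & ->) & H1 & H2 & H3 & ->).
      exists c, f, bs. split; [reflexivity|]. split; [exact H|]. exists ya, yf, ys; auto.
    - intros (c & f & bs & -> & H & ya & yf & ys & H1 & H2 & H3 & ->).
      exists c, f, bs, ya, yf, ys. repeat split; try assumption; apply H. }
  pose proof (comp_base okA okF okB Cp) as Cb.
  split; [|split].
  - intros d y H. apply V in H. destruct H as (c & f & bs & -> & H).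
    apply eccomp_base; [apply H|apply (val_c_over H)].
  - intros d Hd. destruct (TC Cb Hd) as [(c & f & bs & (Hs & ->) & O1 & O2 & O3) _].
    destruct (graph_total (okc_graph (okc_0 okA)) O1) as [yc Hc].
    destruct okF as (_ & _ & F0). destruct (graph_total (okt_graph F0) O2) as [yf Hf].
    destruct (row_rel_exists okB O3) as [ybs Hbs].
    exists (ccomp yc yf ybs). apply V. exists c, f, bs. split; [reflexivity|].
    split; [exact Hs|]. exists yc, yf, ybs; auto.
  - intros d y y' H H'. apply V in H, H'.
    destruct H as (c & f & bs & -> & H), H' as (c' & f' & bs' & E' & H').
    pose proof (val_c_over H) as O. pose proof (eccomp_base (proj1 H) O) as B.
    destruct (TC Cb B) as [_ C]. destruct O as (O1 & O2 & O3).
    destruct (val_c_over H') as (O1' & O2' & O3').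
    apply (val_c_fun (p := (c', f', bs'))); [|exact H'].
    refine (proj1 (val_c_crst (C _ _ _ _ _ _ _ O1 O2 O3 _ O1' O2' O3') y) H).
    + split; [apply H|reflexivity].
    + split; [apply H'|exact E'].
Qed.

Lemma okC_comp : okC (eccomp A F Bs).
Proof.
  pose proof Cp as (R1 & R2 & R3). simpl in R2, R3.
  pose proof okF as (OF1 & OF2 & F0).
  pose proof (comp_base okA okF okB Cp) as Cb.
  pose proof (exp_comp_end okA okB Cp) as End.
  pose proof (okT_row_end okB okF) as okEnd.
  assert (CY : forall a f bs ya yf ys, composable D a f bs -> rc A a ya -> rt F f yf ->
    rel3 rc Bs bs ys -> composable Y ya yf ys).
  { intros a f bs ya yf ys H H1 H2 H3. apply (comp_rel okA okF okB Cp H H1 H2 H3). }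
  split; simpl.
  - apply okL_srcs, okB.
  - apply (okc_T okA).
  - apply okT_tcomp; [exact okF|apply (okc_L okA)|exact R3].
  - apply okT_tcomp; [exact okEnd|apply (okc_R okA)|exact End].
  - split; simpl.
    + apply eccomp_graph.
    + rewrite (ax_comp_src AE Cb). apply row_base_src, okB.
    + rewrite (ax_comp_tgt AE Cb). apply (okc_tgt (okc_0 okA)).
    + rewrite (ax_comp_left AE Cb), (okc_left (okc_0 okA)). reflexivity.
    + rewrite (ax_comp_right AE Cb), (okc_right (okc_0 okA)).
      unfold vrow_end. rewrite row_base_end by exact okB. reflexivity.
    + apply (exp_src_path okB R1).
    + apply (okc_tsrc (okc_0 okA)).
    + apply (okc_ttgt (okc_0 okA)).
    + intros d y (a & f & bs & ya & yf & ys & (H & ->) & H1 & H2 & H3 & ->).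
      rewrite (ax_comp_src AD H), (ax_comp_src AY (CY _ _ _ _ _ _ H H1 H2 H3)).
      apply (row_rel_src okB H3).
    + intros d y (a & f & bs & ya & yf & ys & (H & ->) & H1 & H2 & H3 & ->).
      rewrite (ax_comp_tgt AD H), (ax_comp_tgt AY (CY _ _ _ _ _ _ H H1 H2 H3)).
      apply (okc_rtgt (okc_0 okA) H1).
    + intros d y (a & f & bs & ya & yf & ys & (H & ->) & H1 & H2 & H3 & ->).
      rewrite (ax_comp_left AD H), (ax_comp_left AY (CY _ _ _ _ _ _ H H1 H2 H3)).
      exists f, (cleft a), yf, (cleft ya). split; [split; [apply H|reflexivity]|].
      split; [exact H2|split; [|reflexivity]]. apply (okc_rleft (okc_0 okA) H1).
    + intros d y (a & f & bs & ya & yf & ys & (H & ->) & H1 & H2 & H3 & ->).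
      rewrite (ax_comp_right AD H), (ax_comp_right AY (CY _ _ _ _ _ _ H H1 H2 H3)).
      exists (vrow_end D f bs), (cright a), (vrow_end Y yf ys), (cright ya).
      split; [split; [apply (composable_end TD H)|reflexivity]|].
      split; [|split; [|reflexivity]].
      * exact (proj1 (proj2 (row_rel_ends okB okF R1 (proj1 H) H2 H3))).
      * apply (okc_rright (okc_0 okA) H1).
    (* A vertical multicell [v] at the target of the composite is absorbed into [a] alone, by
       rebracketing and [okc_below] for [A]. *)
    + intros d y (v & l & ds & yv & yl & yds & (K & ->) & K1 & K2 & K3 & ->).
      destruct ds as [|d [|]], yds as [|yd [|]]; simpl in K3; try tauto.
      destruct K3 as [K3 _].
      assert (Kl : l = cleft d) by (symmetry; apply K).
      destruct K3 as (a & f & bs & ya & yf & ys & (H & ->) & H1 & H2 & H3 & ->).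
      pose proof (CY _ _ _ _ _ _ H H1 H2 H3) as HY.
      pose proof (okc_rleft (okc_0 okA) H1) as Hl.
      assert (Kv : composable D v (cleft a) [a]).
      { apply composable_single.
        - destruct K as (_ & K & _). rewrite <- K. simpl. rewrite (ax_comp_tgt AD H). reflexivity.
        - destruct K as (_ & _ & K). rewrite <- K, Kl, (ax_comp_left AD H).
          symmetry. apply (ax_tcomp_cod AD), H. }
      assert (HvA : rc A (ccomp v (cleft a) [a]) (ccomp yv (cleft ya) [ya])).
      { apply (okc_below (okc_0 okA)). exists v, (cleft a), [a], yv, (cleft ya), [ya].
        split; [split; [exact Kv|reflexivity]|]. simpl. auto. }
      assert (okU : okC (ecid (cT A))) by apply okC_cid, (okc_T okA).
      assert (Kvy : composable Y yv (cleft ya) [ya]).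
      { refine (comp_rel (Bs := [A]) okU (okc_L okA) _ _ Kv K1 Hl _).
        - constructor; [exact okA|constructor].
        - split; [split; [reflexivity|exact I]|split; [reflexivity|]].
          symmetry. apply (okc_tsrc (okc_0 okA)).
        - simpl; auto. }
      assert (Eyl : yl = cleft (ccomp ya yf ys)).
      { rewrite (ax_comp_left AY HY).
        refine (okt_fun (okT_tcomp okF (okc_L okA) R3) K2 _).
        exists f, (cleft a), yf, (cleft ya). rewrite Kl, (ax_comp_left AD H).
        split; [split; [apply H|reflexivity]|auto]. }
      exists (ccomp v (cleft a) [a]), f, bs, (ccomp yv (cleft ya) [ya]), yf, ys.
      pose proof (stack_single H) as Sa. pose proof (stack_single HY) as Sy.
      split; [split|split; [exact HvA|split; [exact H2|split; [exact H3|]]]].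
      * apply (composable_stack TD _ _ Kv), Sa.
      * rewrite (ax_comp_assoc AD Kv) by (apply (composable_stack TD _ _ Kv), Sa).
        rewrite (vrow_comp_single H), Kl, (ax_comp_left AD H). reflexivity.
      * rewrite (ax_comp_assoc AY Kvy) by (apply (composable_stack TY _ _ Kvy), Sy).
        rewrite (vrow_comp_single HY), Eyl, (ax_comp_left AY HY). reflexivity.
    (* A vertical row at the sources is absorbed into the upper layer, by [row_above] for [Bs] and
       [okt_l] for [F]. *)
    + intros d y (d0 & m & vs & yd & ym & yvs & (K & ->) & K1 & K2 & K3 & ->).
      destruct K1 as (a & f & bs & ya & yf & ys & (H & ->) & H1 & H2 & H3 & ->).
      pose proof (CY _ _ _ _ _ _ H H1 H2 H3) as HY.
      pose proof (proj1 (composable_stack TD _ _ H) K) as S.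
      pose proof (exp_stack_idr okB R1) as Se.
      pose proof (okC_ids (okL_srcs okB)) as okI.
      assert (K3' : rel3 rc Bs (vrow_comp D m bs vs) (vrow_comp Y ym ys yvs)).
      { apply (row_above okB R1).
        apply (row_comp_rel (F := F) S); try assumption. apply okT_tid, OF1. }
      assert (Hmf : rt F (tcomp m f) (tcomp ym yf)).
      { apply (okt_l F0). exists m, f, ym, yf. split; [split; [apply S|reflexivity]|]. auto. }
      assert (KY : composable Y (ccomp ya yf ys) ym yvs).
      { apply (composable_stack TY _ _ HY).
        destruct (row_rel_ends okB okF R1 (proj1 H) H2 H3) as (Y1 & _).
        destruct (row_rel_ends okI (okT_tid OF1) (proj1 (proj2 Se)) (proj1 K) K2 K3) as (Y2 & _).
        split; [exact Y1|split; [exact Y2|split]].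
        - pose proof (row_rel_tgt okI K3) as T1. pose proof (row_rel_src okB H3) as T2.
          rewrite exp_ids_tgt in T1. rewrite (proj1 (proj2 (proj2 S))) in T1.
          revert T1 T2. apply rel3_unique. pose proof (okL_srcs okB) as HS. revert HS.
          apply Forall_impl. intros U HU. apply (okl_fun HU).
        - apply (okt_rdom F0) in H2. apply (okt_rcod (oko_id OF1)) in K2. simpl in K2.
          rewrite (proj2 (proj2 (proj2 S))) in K2. apply (graph_fun (oko_graph OF1) K2 H2). }
      exists a, (tcomp m f), (vrow_comp D m bs vs), ya, (tcomp ym yf), (vrow_comp Y ym ys yvs).
      split; [split|split; [exact H1|split; [exact Hmf|split; [exact K3'|]]]].
      * apply (composable_comp TD H S).
      * apply (ax_comp_assoc AD H K).
      * apply (ax_comp_assoc AY HY KY).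
Qed.

End CellComposite.

Lemma exp_sub_typing : sub_typing (V := exp_data) okO okT okL okC.
Proof.
  split; simpl.
  - intros f H; apply H.
  - intros f H; apply H.
  - apply okT_tid.
  - intros f g Hf Hg H. apply okT_tcomp; assumption.
  - intros u H; apply (okl_s H).
  - intros u H; apply (okl_t H).
  - intros c H; apply (okc_S H).
  - intros c H; apply (okc_T H).
  - intros c H; apply (okc_L H).
  - intros c H; apply (okc_R H).
  - apply okC_cid.
  - intros a f bs Ha Hf Hb H. apply okC_comp; assumption.
  - reflexivity.
  - reflexivity.
  - reflexivity.
  - reflexivity.
  - intros f Hf. pose proof Hf as (O1 & O2 & F0).
    apply etarr_eq; try reflexivity; simpl.
    + rewrite <- (okt_dom F0). apply (ax_tcomp_idl AE).
    + apply okT_tcomp; [apply okT_tid, O1|exact Hf|reflexivity].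
    + exact F0.
    + apply (okt_l F0).
  - intros f Hf. pose proof Hf as (O1 & O2 & F0).
    apply etarr_eq; try reflexivity; simpl.
    + rewrite <- (okt_cod F0). apply (ax_tcomp_idr AE).
    + apply okT_tcomp; [exact Hf|apply okT_tid, O2|reflexivity].
    + exact F0.
    + apply (okt_r F0).
  - intros f g h Hf Hg Hh H H'.
    apply etarr_eq; try reflexivity; simpl.
    + apply (ax_tcomp_assoc AE); apply tcomp_base; assumption.
    + apply okT_tcomp; [apply okT_tcomp; assumption|assumption|assumption].
    + apply okT_tcomp; [assumption|apply okT_tcomp; assumption|assumption].
    + intros t y (t1 & z & y1 & yz & (K & ->) & (x & w & yx & yw & (K' & ->) & H1 & H2 & ->) & H3 & ->).
      rewrite (ax_tcomp_cod AD) in K by assumption.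
      exists x, (tcomp w z), yx, (tcomp yw yz).
      pose proof (tcomp_rel Hf Hg H H1 H2 K') as T1.
      pose proof (tcomp_rel Hg Hh H' H2 H3 K) as T2.
      split; [split|split; [exact H1|split]].
      * rewrite (ax_tcomp_dom AD); assumption.
      * apply (ax_tcomp_assoc AD); assumption.
      * exists w, z, yw, yz. split; [split; [exact K|reflexivity]|auto].
      * apply (ax_tcomp_assoc AY); assumption.
  - intros c H; apply (okc_path (okc_0 H)).
  - intros c H; apply (okc_tsrc (okc_0 H)).
  - intros c H; apply (okc_ttgt (okc_0 H)).
  - reflexivity.
  - reflexivity.
  - reflexivity.
  - reflexivity.
  - reflexivity.
  - reflexivity.
  - reflexivity.
  - reflexivity.
Qed.

Lemma exp_sub_laws : sub_laws (V := exp_data) okT okC.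
Proof.
  split.
  - intros B H (G1 & G2 & H1 & H2 & H3 & H4). apply ecell_eq; try assumption.
    + pose proof (composable_idl TE (ec B)) as K.
      rewrite (okc_tgt (okc_0 G2)), (okc_left (okc_0 G2)) in K. apply (ax_comp_idl AE _ K).
    + apply (okc_0 G1).
    + apply (okc_0 G2).
    + apply (okc_below (okc_0 G2)).
  - intros B H (G1 & G2 & H1 & H2 & H3 & H4). apply ecell_eq; try assumption.
    + pose proof (ax_comp_idr AE (ec B)) as K.
      rewrite (okc_left (okc_0 G2)), (okc_src (okc_0 G2)) in K.
      destruct (okc_L G2) as (_ & _ & L0). rewrite (okt_dom L0) in K.
      etransitivity; [|exact K]. simpl. rewrite !map_map. reflexivity.
    + apply (okc_0 G1).
    + apply (okc_0 G2).
    + apply (okc_above (okc_0 G2)).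
  - intros A F Bs G Cs HA HF HB HG HC C1 S C2 C3 HAB HBC (G1 & G2 & H1 & H2 & H3 & H4).
    apply ecell_eq; try assumption.
    + simpl. rewrite (row_base_comp HB G HC).
      pose proof (comp_base HA HF HB C1) as K1.
      pose proof (comp_base HAB HG HC C2) as K2.
      apply (ax_comp_assoc AE K1 K2).
    + apply (okc_0 G1).
    + apply (okc_0 G2).
    + intros d y (d0 & g & cs & yd & yg & ycs & (K & ->) & K1 & K2 & K3 & ->).
      destruct K1 as (a & f & bs & ya & yf & ys & (H & ->) & K4 & K5 & K6 & ->).
      pose proof (comp_rel HA HF HB C1 H K4 K5 K6) as HY.
      pose proof (proj1 (composable_stack TD _ _ H) K) as SD.
      assert (KAB : rc (eccomp A F Bs) (ccomp a f bs) (ccomp ya yf ys)).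
      { exists a, f, bs, ya, yf, ys. split; [split; [exact H|reflexivity]|auto]. }
      pose proof (comp_rel HAB HG HC C2 K KAB K2 K3) as KY.
      exists a, (tcomp g f), (vrow_comp D g bs cs), ya, (tcomp yg yf), (vrow_comp Y yg ys ycs).
      split; [split|split; [exact K4|split; [|split]]].
      * apply (composable_comp TD H SD).
      * apply (ax_comp_assoc AD H K).
      * exists g, f, yg, yf. split; [split; [apply SD|reflexivity]|auto].
      * apply (row_comp_rel SD HB HC HG S K6 K3 K2).
      * apply (ax_comp_assoc AY HY KY).
Qed.

Definition exp_vdc : vdc := sub_vdc exp_sub_typing exp_sub_laws.

End Exponential.

(** * Evaluation and transposition *)

Section Transposition.
Context {D E : vdc} (P : vdf D E) (TF : two_factorizations P) (TC : two_decompositions P)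
  (Y : vdc).
Let ST := exp_sub_typing TF TC Y.
Let R := exp_vdc TF TC Y.

Definition exp_proj : vdf R E.
Proof.
  refine (@Vdf R E (fun X => eo (proj1_sig X)) (fun F => et (proj1_sig F))
    (fun U => el (proj1_sig U)) (fun A => ec (proj1_sig A)) _ _ _ _ _ _ _ _ _ _ _ _).
  - intros [F HF]. apply HF.
  - intros [F HF]. apply HF.
  - reflexivity.
  - intros F G H. exact (f_equal (@et _ _ _) (sub_tcomp_val (ST := ST) H)).
  - intros [U HU]. apply (okl_src HU).
  - intros [U HU]. apply (okl_tgt HU).
  - intros [A HA]. etransitivity; [apply (okc_src (okc_0 HA))|].
    etransitivity; [apply f_equal; symmetry; apply (list_sig_val (st_csrc ST HA))|].
    rewrite map_map. reflexivity.
  - intros [A HA]. apply (okc_tgt (okc_0 HA)).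
  - intros [A HA]. apply (okc_left (okc_0 HA)).
  - intros [A HA]. apply (okc_right (okc_0 HA)).
  - reflexivity.
  - intros A F Bs H. etransitivity; [exact (f_equal (@ec _ _ _) (sub_comp_val (ST := ST) H))|].
    simpl. rewrite map_map. reflexivity.
Defined.

(** Turns graphs back into functions: the counit has to produce elements of [Y]. *)
Definition pick (A B : Type) (dom : A -> Prop) (rel : A -> B -> Prop) (H : graph_on dom rel) a
  (Ha : dom a) : B := proj1_sig (constructive_indefinite_description _ (graph_total H Ha)).

Lemma pick_rel (A B : Type) (dom : A -> Prop) (rel : A -> B -> Prop) (H : graph_on dom rel) a
  (Ha : dom a) : rel a (pick H Ha).
Proof. apply (proj2_sig (constructive_indefinite_description _ (graph_total H Ha))). Qed.

Let B := pb_vdc exp_proj P.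
Let p1 : vdf B R := pb_fst exp_proj P.
Let p2 : vdf B D := pb_snd exp_proj P.

Definition ev_o (p : ob B) : ob Y :=
  pick (oko_graph (proj2_sig (fob p1 p))) (a := fob p2 p) (eq_sym (proj2_sig p)).
Definition ev_t (p : tarr B) : tarr Y :=
  pick (okt_graph (proj2 (proj2 (proj2_sig (ftarr p1 p))))) (a := ftarr p2 p)
    (eq_sym (proj2_sig p)).
Definition ev_l (p : larr B) : larr Y :=
  pick (okl_graph (proj2_sig (flarr p1 p))) (a := flarr p2 p) (eq_sym (proj2_sig p)).
Definition ev_c (p : cell B) : cell Y :=
  pick (okc_graph (okc_0 (proj2_sig (fcell p1 p)))) (a := fcell p2 p) (eq_sym (proj2_sig p)).

Lemma ev_o_rel p : ro (proj1_sig (fob p1 p)) (fob p2 p) (ev_o p).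
Proof. exact (pick_rel (oko_graph (proj2_sig (fob p1 p))) _). Qed.
Lemma ev_t_rel p : rt (proj1_sig (ftarr p1 p)) (ftarr p2 p) (ev_t p).
Proof. exact (pick_rel (okt_graph (proj2 (proj2 (proj2_sig (ftarr p1 p))))) _). Qed.
Lemma ev_l_rel p : rl (proj1_sig (flarr p1 p)) (flarr p2 p) (ev_l p).
Proof. exact (pick_rel (okl_graph (proj2_sig (flarr p1 p))) _). Qed.
Lemma ev_c_rel p : rc (proj1_sig (fcell p1 p)) (fcell p2 p) (ev_c p).
Proof. exact (pick_rel (okc_graph (okc_0 (proj2_sig (fcell p1 p)))) _). Qed.

Lemma ev_o_unique p y : ro (proj1_sig (fob p1 p)) (fob p2 p) y -> ev_o p = y.
Proof. apply (graph_fun (oko_graph (proj2_sig (fob p1 p)))), ev_o_rel. Qed.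
Lemma ev_t_unique p y : rt (proj1_sig (ftarr p1 p)) (ftarr p2 p) y -> ev_t p = y.
Proof. apply (okt_fun (proj2_sig (ftarr p1 p))), ev_t_rel. Qed.
Lemma ev_l_unique p y : rl (proj1_sig (flarr p1 p)) (flarr p2 p) y -> ev_l p = y.
Proof. apply (okl_fun (proj2_sig (flarr p1 p))), ev_l_rel. Qed.
Lemma ev_c_unique p y : rc (proj1_sig (fcell p1 p)) (fcell p2 p) y -> ev_c p = y.
Proof. apply (okc_fun (proj2_sig (fcell p1 p))), ev_c_rel. Qed.

Definition exp_ev : vdf B Y.
Proof.
  refine (@Vdf B Y ev_o ev_t ev_l ev_c _ _ _ _ _ _ _ _ _ _ _ _).
  - intros p. symmetry. apply ev_o_unique.
    apply (okt_rdom (proj2 (proj2 (proj2_sig (ftarr p1 p)))) (ev_t_rel p)).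
  - intros p. symmetry. apply ev_o_unique.
    apply (okt_rcod (proj2 (proj2 (proj2_sig (ftarr p1 p)))) (ev_t_rel p)).
  - intros p. apply ev_t_unique.
    apply (oko_tid (proj2_sig (fob p1 p)) (ev_o_rel p)).
  - intros p q H. apply ev_t_unique.
    assert (C1 : tcod (ftarr p1 p) = tdom (ftarr p1 q)) by (rewrite f_tcod, f_tdom, H; reflexivity).
    rewrite (f_tcomp p1 _ _ H), (f_tcomp p2 _ _ H).
    refine (eq_ind_r (fun F => rt F _ _) _ (sub_tcomp_val (ST := ST) C1)).
    exists (ftarr p2 p), (ftarr p2 q), (ev_t p), (ev_t q).
    split; [split; [rewrite f_tcod, f_tdom, H; reflexivity|reflexivity]|].
    split; [apply ev_t_rel|split; [apply ev_t_rel|reflexivity]].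
  - intros p. symmetry. apply ev_o_unique.
    apply (okl_rsrc (proj2_sig (flarr p1 p)) (ev_l_rel p)).
  - intros p. symmetry. apply ev_o_unique.
    apply (okl_rtgt (proj2_sig (flarr p1 p)) (ev_l_rel p)).
  - intros p. pose proof (okc_rsrc (okc_0 (proj2_sig (fcell p1 p))) (ev_c_rel p)) as H.
    rewrite (f_csrc p2) in H.
    assert (K : map (@proj1_sig _ _) (map (flarr p1) (csrc p)) = cS (proj1_sig (fcell p1 p))).
    { rewrite <- (f_csrc p1). apply list_sig_val. }
    rewrite <- K in H. refine (rel3_unique _ H _).
    + rewrite K. pose proof (okc_S (proj2_sig (fcell p1 p))) as HS. revert HS.
      apply Forall_impl. intros U HU. apply (okl_fun HU).
    + clear. induction (csrc p) as [|u l IH]; simpl; [exact I|]. split; [apply ev_l_rel|exact IH].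
  - intros p. symmetry. apply ev_l_unique.
    apply (okc_rtgt (okc_0 (proj2_sig (fcell p1 p))) (ev_c_rel p)).
  - intros p. symmetry. apply ev_t_unique.
    apply (okc_rleft (okc_0 (proj2_sig (fcell p1 p))) (ev_c_rel p)).
  - intros p. symmetry. apply ev_t_unique.
    apply (okc_rright (okc_0 (proj2_sig (fcell p1 p))) (ev_c_rel p)).
  - intros p. apply ev_c_unique.
    apply (okl_cid (proj2_sig (flarr p1 p)) (ev_l_rel p)).
  - intros p q ps H. apply ev_c_unique.
    pose proof (vmap_composable (vmap_of_vdf p1) H) as H1.
    pose proof (vmap_composable (vmap_of_vdf p2) H) as H2.
    rewrite (f_ccomp p1 H), (f_ccomp p2 H).
    refine (eq_ind_r (fun F => rc F _ _) _ (sub_comp_val (ST := ST) H1)).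
    exists (fcell p2 p), (ftarr p2 q), (map (fcell p2) ps), (ev_c p), (ev_t q), (map ev_c ps).
    split; [split; [exact H2|reflexivity]|].
    split; [apply ev_c_rel|split; [apply ev_t_rel|split; [|reflexivity]]].
    clear. induction ps as [|u l IH]; simpl; [exact I|]. split; [apply ev_c_rel|exact IH].
Defined.

Section Transpose.
Context (X : vdc) (x : vdf X E) (g : vdf (pb_vdc x P) Y).
Let AX := vaxioms X.
Let TX := vdc_axioms_typing AX.

Definition gr_o a d y : Prop := exists pf : fob x a = fob P d, fob g (pbo pf) = y.
Definition gr_t a d y : Prop := exists pf : ftarr x a = ftarr P d, ftarr g (pbt pf) = y.
Definition gr_l a d y : Prop := exists pf : flarr x a = flarr P d, flarr g (pbl pf) = y.
Definition gr_c a d y : Prop := exists pf : fcell x a = fcell P d, fcell g (pbc pf) = y.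

(** Currying of [g]. The action on vertical arrows is the curried value at the identity of [a];
    likewise [tr_l] takes its action on vertical multicells from [cid u]. *)
Definition tr_o a : @eob D E Y := EOb (fob x a) (gr_o a) (gr_t (tid a)).
Definition tr_t f : @etarr D E Y := ETarr (ftarr x f) (tr_o (tdom f)) (tr_o (tcod f)) (gr_t f).
Definition tr_l u : @elarr D E Y :=
  ELarr (flarr x u) (tr_o (lsrc u)) (tr_o (ltgt u)) (gr_l u) (gr_c (cid u)).
Definition tr_c c : @ecell D E Y :=
  ECell (fcell x c) (map tr_l (csrc c)) (tr_l (ctgt c)) (tr_t (cleft c)) (tr_t (cright c)) (gr_c c).

Lemma gr_o_graph a : graph_on (fun d => fob P d = fob x a) (gr_o a).
Proof.
  split; [|split].
  - intros d y (pf & _). auto.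
  - intros d H. exists (fob g (pbo (eq_sym H))), (eq_sym H). reflexivity.
  - intros d y y' (pf & <-) (pf' & <-). rewrite (proof_irrelevance _ pf pf'). reflexivity.
Qed.

Lemma gr_t_graph a : graph_on (fun d => ftarr P d = ftarr x a) (gr_t a).
Proof.
  split; [|split].
  - intros d y (pf & _). auto.
  - intros d H. exists (ftarr g (pbt (eq_sym H))), (eq_sym H). reflexivity.
  - intros d y y' (pf & <-) (pf' & <-). rewrite (proof_irrelevance _ pf pf'). reflexivity.
Qed.

Lemma gr_l_graph a : graph_on (fun d => flarr P d = flarr x a) (gr_l a).
Proof.
  split; [|split].
  - intros d y (pf & _). auto.
  - intros d H. exists (flarr g (pbl (eq_sym H))), (eq_sym H). reflexivity.
  - intros d y y' (pf & <-) (pf' & <-). rewrite (proof_irrelevance _ pf pf'). reflexivity.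
Qed.

Lemma gr_c_graph a : graph_on (fun d => fcell P d = fcell x a) (gr_c a).
Proof.
  split; [|split].
  - intros d y (pf & _). auto.
  - intros d H. exists (fcell g (pbc (eq_sym H))), (eq_sym H). reflexivity.
  - intros d y y' (pf & <-) (pf' & <-). rewrite (proof_irrelevance _ pf pf'). reflexivity.
Qed.

Lemma gr_o_eq (q : ob (pb_vdc x P)) : gr_o (fst (proj1_sig q)) (snd (proj1_sig q)) (fob g q).
Proof. exists (proj2_sig q). f_equal. apply sig_inj. symmetry. apply surjective_pairing. Qed.
Lemma gr_t_eq (q : tarr (pb_vdc x P)) : gr_t (fst (proj1_sig q)) (snd (proj1_sig q)) (ftarr g q).
Proof. exists (proj2_sig q). f_equal. apply sig_inj. symmetry. apply surjective_pairing. Qed.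
Lemma gr_l_eq (q : larr (pb_vdc x P)) : gr_l (fst (proj1_sig q)) (snd (proj1_sig q)) (flarr g q).
Proof. exists (proj2_sig q). f_equal. apply sig_inj. symmetry. apply surjective_pairing. Qed.
Lemma gr_c_eq (q : cell (pb_vdc x P)) : gr_c (fst (proj1_sig q)) (snd (proj1_sig q)) (fcell g q).
Proof. exists (proj2_sig q). f_equal. apply sig_inj. symmetry. apply surjective_pairing. Qed.

Lemma gr_t_dom f t y : gr_t f t y -> gr_o (tdom f) (tdom t) (tdom y).
Proof. intros (pf & <-). rewrite f_tdom. exact (gr_o_eq (tdom (pbt pf))). Qed.
Lemma gr_t_cod f t y : gr_t f t y -> gr_o (tcod f) (tcod t) (tcod y).
Proof. intros (pf & <-). rewrite f_tcod. exact (gr_o_eq (tcod (pbt pf))). Qed.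
Lemma gr_o_tid a d y : gr_o a d y -> gr_t (tid a) (tid d) (tid y).
Proof. intros (pf & <-). rewrite <- f_tid. exact (gr_t_eq (tid (pbo pf))). Qed.
Lemma gr_l_src f t y : gr_l f t y -> gr_o (lsrc f) (lsrc t) (lsrc y).
Proof. intros (pf & <-). rewrite f_lsrc. exact (gr_o_eq (lsrc (pbl pf))). Qed.
Lemma gr_l_tgt f t y : gr_l f t y -> gr_o (ltgt f) (ltgt t) (ltgt y).
Proof. intros (pf & <-). rewrite f_ltgt. exact (gr_o_eq (ltgt (pbl pf))). Qed.
Lemma gr_l_cid a d y : gr_l a d y -> gr_c (cid a) (cid d) (cid y).
Proof. intros (pf & <-). rewrite <- f_cid. exact (gr_c_eq (cid (pbl pf))). Qed.
Lemma gr_c_left f t y : gr_c f t y -> gr_t (cleft f) (cleft t) (cleft y).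
Proof. intros (pf & <-). rewrite f_cleft. exact (gr_t_eq (cleft (pbc pf))). Qed.
Lemma gr_c_right f t y : gr_c f t y -> gr_t (cright f) (cright t) (cright y).
Proof. intros (pf & <-). rewrite f_cright. exact (gr_t_eq (cright (pbc pf))). Qed.
Lemma gr_c_tgt f t y : gr_c f t y -> gr_l (ctgt f) (ctgt t) (ctgt y).
Proof. intros (pf & <-). rewrite f_ctgt. exact (gr_l_eq (ctgt (pbc pf))). Qed.

Lemma gr_c_src c d y : gr_c c d y -> rel3 (@rl D E Y) (map tr_l (csrc c)) (csrc d) (csrc y).
Proof.
  intros (pf & <-). rewrite (f_csrc g).
  assert (H1 : csrc c = map (flarr (pb_fst x P)) (csrc (pbc pf)))
    by exact (f_csrc (pb_fst x P) (pbc pf)).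
  assert (H2 : csrc d = map (flarr (pb_snd x P)) (csrc (pbc pf)))
    by exact (f_csrc (pb_snd x P) (pbc pf)).
  revert H1 H2. generalize (csrc (pbc pf)). intros l -> ->. clear.
  induction l as [|q l IH]; simpl; [exact I|].
  split; [exact (gr_l_eq q)|exact IH].
Qed.

Lemma gr_t_comp f f' t t' y y' : tcod f = tdom f' -> tcod t = tdom t' ->
  gr_t f t y -> gr_t f' t' y' -> gr_t (tcomp f f') (tcomp t t') (tcomp y y').
Proof.
  intros H H' (pf & <-) (pf' & <-).
  assert (C : tcod (pbt pf) = tdom (pbt pf')).
  { apply sig_inj, injective_projections; assumption. }
  rewrite <- (f_tcomp g _ _ C). pose proof (gr_t_eq (tcomp (pbt pf) (pbt pf'))) as K.
  assert (K1 : fst (proj1_sig (tcomp (pbt pf) (pbt pf'))) = tcomp f f')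
    by exact (f_tcomp (pb_fst x P) _ _ C).
  assert (K2 : snd (proj1_sig (tcomp (pbt pf) (pbt pf'))) = tcomp t t')
    by exact (f_tcomp (pb_snd x P) _ _ C).
  rewrite K1, K2 in K. exact K.
Qed.

Lemma gr_row bs ds ys : rel3 (@rc D E Y) (map tr_c bs) ds ys ->
  exists qs, map (fcell (pb_fst x P)) qs = bs /\ map (fcell (pb_snd x P)) qs = ds /\
    map (fcell g) qs = ys.
Proof.
  revert ds ys; induction bs as [|b bs IH]; intros [|d ds] [|y ys]; simpl; try tauto.
  - intros _. exists []; auto.
  - intros [(pf & <-) H]. destruct (IH _ _ H) as (qs & <- & <- & <-).
    exists (pbc pf :: qs). auto.
Qed.

Lemma gr_c_comp a f bs d t ds y u ys : composable X a f bs -> composable D d t ds ->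
  gr_c a d y -> gr_t f t u -> rel3 (@rc D E Y) (map tr_c bs) ds ys ->
  gr_c (ccomp a f bs) (ccomp d t ds) (ccomp y u ys).
Proof.
  intros H H' (pf & <-) (pf' & <-) Hr. destruct (gr_row Hr) as (qs & <- & <- & <-).
  assert (C : composable (pb_vdc x P) (pbc pf) (pbt pf') qs)
    by (apply pb_composable_intro; assumption).
  rewrite <- (f_ccomp g C). pose proof (gr_c_eq (ccomp (pbc pf) (pbt pf') qs)) as K.
  assert (K1 : fst (proj1_sig (ccomp (pbc pf) (pbt pf') qs)) =
    ccomp a f (map (fcell (pb_fst x P)) qs)) by exact (f_ccomp (pb_fst x P) C).
  assert (K2 : snd (proj1_sig (ccomp (pbc pf) (pbt pf') qs)) =
    ccomp d t (map (fcell (pb_snd x P)) qs)) by exact (f_ccomp (pb_snd x P) C).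
  rewrite K1, K2 in K. exact K.
Qed.

Lemma tr_t_tid a : tr_t (tid a) = etid (tr_o a).
Proof.
  unfold tr_t, etid. simpl. rewrite f_tid, (ax_tid_dom AX), (ax_tid_cod AX). reflexivity.
Qed.

Lemma tr_c_cid u : tr_c (cid u) = ecid (tr_l u).
Proof.
  unfold tr_c, ecid. rewrite (ax_cid_src AX), (ax_cid_tgt AX), (ax_cid_left AX),
    (ax_cid_right AX), f_cid, !tr_t_tid. reflexivity.
Qed.

Lemma okT0_tr f : okT0 P (tr_t f).
Proof.
  split; simpl.
  - apply gr_t_graph.
  - apply f_tdom.
  - apply f_tcod.
  - apply gr_t_dom.
  - apply gr_t_cod.
  - intros t y (v & w & yv & yw & (H & ->) & H1 & H2 & ->).
    simpl in H1. rewrite <- (ax_tcomp_idl AX f). apply gr_t_comp; try assumption.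
    apply (ax_tid_cod AX).
  - intros t y (v & w & yv & yw & (H & ->) & H1 & H2 & ->).
    simpl in H2. rewrite <- (ax_tcomp_idr AX f). apply gr_t_comp; try assumption.
    symmetry. apply (ax_tid_dom AX).
Qed.

Lemma okO_tr a : okO P (tr_o a).
Proof.
  split.
  - apply gr_o_graph.
  - rewrite <- tr_t_tid. apply okT0_tr.
  - apply gr_o_tid.
Qed.

Lemma okT_tr f : okT P (tr_t f).
Proof. split; [apply okO_tr|split; [apply okO_tr|apply okT0_tr]]. Qed.

Lemma tr_lpath p a b : lpath_ok (@lsrc X) (@ltgt X) a p b ->
  lpath_ok (@sL D E Y) (@tL D E Y) (tr_o a) (map tr_l p) (tr_o b).
Proof.
  revert a; induction p as [|u p IH]; simpl; intros a H; [congruence|].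
  destruct H as [<- H]. auto.
Qed.

Lemma okC0_tr c : okC0 P (tr_c c).
Proof.
  split; simpl.
  - apply gr_c_graph.
  - rewrite map_map. apply f_csrc.
  - apply f_ctgt.
  - apply f_cleft.
  - apply f_cright.
  - apply tr_lpath, (ax_cell_path AX).
  - f_equal. apply (ax_cell_tgt_src AX).
  - f_equal. apply (ax_cell_tgt_tgt AX).
  - apply gr_c_src.
  - apply gr_c_tgt.
  - apply gr_c_left.
  - apply gr_c_right.
  - intros d y (v & l & ds & yv & yl & ys & (H & ->) & H1 & H2 & H3 & ->).
    simpl in H1. rewrite <- (ax_comp_idl AX _ (composable_idl TX c)).
    apply gr_c_comp; try assumption. apply (composable_idl TX).
  - intros d y (v & l & ds & yv & yl & ys & (H & ->) & H1 & H2 & H3 & ->).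
    simpl in H1, H2. rewrite <- (ax_comp_idr AX c).
    apply gr_c_comp; try assumption; [apply (composable_idr TX)|].
    rewrite !map_map in *. rewrite (map_ext _ _ tr_c_cid). exact H3.
Qed.

Lemma okL_tr u : okL P (tr_l u).
Proof.
  split; simpl.
  - apply okO_tr.
  - apply okO_tr.
  - apply f_lsrc.
  - apply f_ltgt.
  - apply gr_l_graph.
  - apply gr_l_src.
  - apply gr_l_tgt.
  - rewrite <- tr_c_cid. apply okC0_tr.
  - apply gr_l_cid.
Qed.

Lemma okC_tr c : okC P (tr_c c).
Proof.
  split; simpl.
  - apply Forall_forall. intros U HU. apply in_map_iff in HU. destruct HU as (u & <- & _).
    apply okL_tr.
  - apply okL_tr.
  - apply okT_tr.
  - apply okT_tr.
  - apply okC0_tr.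
Qed.

Lemma tr_row_end f bs : row_end (@cR D E Y) (tr_t f) (map tr_c bs) = tr_t (vrow_end X f bs).
Proof.
  unfold vrow_end. revert f; induction bs as [|b bs IH]; simpl; intros f; [reflexivity|apply IH].
Qed.

Lemma tr_composable a f bs : composable X a f bs ->
  composable (@exp_data D E Y) (tr_c a) (tr_t f) (map tr_c bs).
Proof.
  intros (H1 & H2 & H3). split; [|split].
  - clear H2 H3. unfold vrow_ok in *. revert f H1.
    induction bs as [|b bs IH]; simpl; intros f H; [exact I|]. destruct H as [<- H]. auto.
  - simpl. rewrite <- H2, !map_map. reflexivity.
  - simpl. rewrite H3. reflexivity.
Qed.

Lemma tr_tcomp f f' : tcod f = tdom f' -> tr_t (tcomp f f') = etcomp (tr_t f) (tr_t f').
Proof.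
  intros H. symmetry. apply (etarr_eq (P := P)); simpl.
  - symmetry. apply f_tcomp, H.
  - rewrite (ax_tcomp_dom AX) by exact H. reflexivity.
  - rewrite (ax_tcomp_cod AX) by exact H. reflexivity.
  - apply (okT_tcomp TF (F := tr_t f) (G := tr_t f')); try apply okT_tr.
    simpl. rewrite H. reflexivity.
  - apply okT0_tr.
  - intros t y (v & w & yv & yw & (K & ->) & H1 & H2 & ->). apply gr_t_comp; assumption.
Qed.

Lemma tr_ccomp a f bs : composable X a f bs ->
  tr_c (ccomp a f bs) = eccomp (tr_c a) (tr_t f) (map tr_c bs).
Proof.
  intros H. symmetry. apply (ecell_eq (P := P)); simpl.
  - rewrite map_map, (f_ccomp x H). reflexivity.
  - rewrite (ax_comp_src AX H), concat_map, !map_map. reflexivity.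
  - rewrite (ax_comp_tgt AX H). reflexivity.
  - rewrite (ax_comp_left AX H). symmetry. apply tr_tcomp, H.
  - rewrite (ax_comp_right AX H), tr_row_end. symmetry. apply tr_tcomp, (composable_end TX H).
  - apply (okC_comp TF TC (A := tr_c a) (F := tr_t f)).
    + apply okC_tr.
    + apply okT_tr.
    + apply Forall_forall. intros U HU. apply in_map_iff in HU. destruct HU as (u & <- & _).
      apply okC_tr.
    + apply tr_composable, H.
  - apply okC0_tr.
  - intros d y (d0 & t & ds & y0 & yt & ys & (K & ->) & H1 & H2 & H3 & ->).
    apply gr_c_comp; assumption.
Qed.

Definition tr_vmap : vmap X (@exp_data D E Y).
Proof.
  refine (@VMap X (@exp_data D E Y) tr_o tr_t tr_l tr_c _ _ _ _ _ _ _ _ _ _ _ _); try reflexivity.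
  - apply tr_t_tid.
  - apply tr_tcomp.
  - apply tr_c_cid.
  - apply tr_ccomp.
Defined.

Definition transpose : vdf X R :=
  vdf_of_vmap (A := X) (B := R) (sub_lift ST (F := tr_vmap) okO_tr okT_tr okL_tr okC_tr).

Lemma transpose_transposes : transposes exp_ev g transpose.
Proof.
  split; [split; [|split; [|split]]; reflexivity|].
  split; [|split; [|split]]; intros c d H H'.
  - apply (ev_o_unique (p := pbo H')). exists H. reflexivity.
  - apply (ev_t_unique (p := pbt H')). exists H. reflexivity.
  - apply (ev_l_unique (p := pbl H')). exists H. reflexivity.
  - apply (ev_c_unique (p := pbc H')). exists H. reflexivity.
Qed.

Lemma transpose_unique (h : vdf X R) : transposes exp_ev g h -> vdf_eq transpose h.
Proof.
  intros ((T1 & T2 & T3 & T4) & K1 & K2 & K3 & K4).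
  (* A value in the graph of [h f] is the result of evaluating there, which the transposition
     condition equates with a value of [g]. *)
  assert (Rt : forall f, rt (proj1_sig (ftarr h f)) = gr_t f).
  { intros f. pose proof (proj2_sig (ftarr h f)) as (_ & _ & F0).
    apply (graph_on_ext (okt_graph F0)).
    - exact (eq_ind_r (fun e => graph_on (fun t => ftarr P t = e) _) (gr_t_graph f) (T2 f)).
    - intros t y H. assert (H0 : ftarr exp_proj (ftarr h f) = ftarr P t)
        by exact (eq_sym (graph_dom (okt_graph F0) H)).
      assert (H1 : ftarr x f = ftarr P t) by exact (eq_trans (eq_sym (T2 f)) H0).
      exists H1. rewrite <- (K2 f t H1 H0). apply (ev_t_unique (p := pbt H0)). exact H. }
  assert (Rc : forall f, rc (proj1_sig (fcell h f)) = gr_c f).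
  { intros f. pose proof (okc_0 (proj2_sig (fcell h f))) as F0.
    apply (graph_on_ext (okc_graph F0)).
    - exact (eq_ind_r (fun e => graph_on (fun t => fcell P t = e) _) (gr_c_graph f) (T4 f)).
    - intros t y H. assert (H0 : fcell exp_proj (fcell h f) = fcell P t)
        by exact (eq_sym (graph_dom (okc_graph F0) H)).
      assert (H1 : fcell x f = fcell P t) by exact (eq_trans (eq_sym (T4 f)) H0).
      exists H1. rewrite <- (K4 f t H1 H0). apply (ev_c_unique (p := pbc H0)). exact H. }
  assert (Ro : forall a, ro (proj1_sig (fob h a)) = gr_o a).
  { intros f. pose proof (proj2_sig (fob h f)) as F0.
    apply (graph_on_ext (oko_graph F0)).
    - exact (eq_ind_r (fun e => graph_on (fun t => fob P t = e) _) (gr_o_graph f) (T1 f)).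
    - intros t y H. assert (H0 : fob exp_proj (fob h f) = fob P t)
        by exact (eq_sym (graph_dom (oko_graph F0) H)).
      assert (H1 : fob x f = fob P t) by exact (eq_trans (eq_sym (T1 f)) H0).
      exists H1. rewrite <- (K1 f t H1 H0). apply (ev_o_unique (p := pbo H0)). exact H. }
  assert (Rl : forall a, rl (proj1_sig (flarr h a)) = gr_l a).
  { intros f. pose proof (proj2_sig (flarr h f)) as F0.
    apply (graph_on_ext (okl_graph F0)).
    - exact (eq_ind_r (fun e => graph_on (fun t => flarr P t = e) _) (gr_l_graph f) (T3 f)).
    - intros t y H. assert (H0 : flarr exp_proj (flarr h f) = flarr P t)
        by exact (eq_sym (graph_dom (okl_graph F0) H)).
      assert (H1 : flarr x f = flarr P t) by exact (eq_trans (eq_sym (T3 f)) H0).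
      exists H1. rewrite <- (K3 f t H1 H0). apply (ev_l_unique (p := pbl H0)). exact H. }
  assert (Eo : forall a, tr_o a = proj1_sig (fob h a)).
  { intros a.
    (* Evaluation at objects does not see the vertical action; it is determined because [h]
       preserves identities and the graph of [etid] is that action. *)
    assert (Ev : gr_t (tid a) = rv (proj1_sig (fob h a))) by (rewrite <- Rt, f_tid; reflexivity).
    apply eob_ext; symmetry; [exact (T1 a)|exact (Ro a)|exact (eq_sym Ev)]. }
  assert (Et : forall f, tr_t f = proj1_sig (ftarr h f)).
  { intros f. apply etarr_ext; simpl; rewrite ?Eo; symmetry.
    - exact (T2 f).
    - exact (f_equal (@proj1_sig _ _) (f_tdom h f)).
    - exact (f_equal (@proj1_sig _ _) (f_tcod h f)).
    - exact (Rt f). }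
  assert (El : forall u, tr_l u = proj1_sig (flarr h u)).
  { intros u. apply elarr_ext; simpl; rewrite ?Eo; symmetry.
    - exact (T3 u).
    - exact (f_equal (@proj1_sig _ _) (f_lsrc h u)).
    - exact (f_equal (@proj1_sig _ _) (f_ltgt h u)).
    - exact (Rl u).
    - rewrite <- Rc, f_cid. reflexivity. }
  assert (Ec : forall c, tr_c c = proj1_sig (fcell h c)).
  { intros c. apply ecell_ext; simpl; rewrite ?Et, ?El; symmetry.
    - exact (T4 c).
    - pose proof (f_equal (map (@proj1_sig _ _)) (f_csrc h c)) as E4.
      rewrite map_map, <- (map_ext _ _ El) in E4. etransitivity; [|exact E4].
      symmetry. apply list_sig_val.
    - exact (f_equal (@proj1_sig _ _) (f_ctgt h c)).
    - exact (f_equal (@proj1_sig _ _) (f_cleft h c)).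
    - exact (f_equal (@proj1_sig _ _) (f_cright h c)).
    - exact (Rc c). }
  split; [|split; [|split]]; intros a; apply sig_inj;
    [exact (Eo a)|exact (Et a)|exact (El a)|exact (Ec a)].
Qed.

End Transpose.
End Transposition.

Lemma concretely_exponentiable_of_two (D E : vdc) (P : vdf D E) :
  two_factorizations P -> two_decompositions P -> concretely_exponentiable P.
Proof.
  intros TF TC Y. exists (exp_vdc TF TC Y), (exp_proj TF TC Y), (exp_ev TF TC Y).
  intros X x g. exists (transpose TF TC g). split.
  - apply transpose_transposes.
  - apply transpose_unique.
Qed.

(** * The collage of composable pairs *)

(** Composing with a further arrow respects moves only when it is composable. [I] is that condition;
    it must be invariant in both directions because a zigzag runs along steps both ways. *)
Lemma crst_map_if (A B : Type) (R : A -> A -> Prop) (S : B -> B -> Prop) (I : A -> Prop)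
  (h : A -> B) : (forall x y, R x y -> (I x <-> I y)) ->
  (forall x y, R x y -> I x -> S (h x) (h y)) ->
  forall x y, clos_refl_sym_trans _ R x y -> I x -> clos_refl_sym_trans _ S (h x) (h y).
Proof.
  intros HI H.
  assert (HI' : forall x y, clos_refl_sym_trans _ R x y -> (I x <-> I y)).
  { intros x y K. induction K; [apply HI; assumption|tauto|tauto|tauto]. }
  intros x y K. induction K as [x y K|x|x y K IH|x y z K IH K' IH']; intros Hx.
  - apply rst_step, H; assumption.
  - apply rst_refl.
  - apply rst_sym, IH. apply (HI' _ _ K), Hx.
  - eapply rst_trans; [apply IH, Hx|]. apply IH'. apply (HI' _ _ K), Hx.
Qed.

Lemma crst_class_eq (A : Type) (R : A -> A -> Prop) x y : clos_refl_sym_trans _ R x y ->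
  clos_refl_sym_trans _ R x = clos_refl_sym_trans _ R y.
Proof.
  intros H. apply functional_extensionality. intros z. apply propositional_extensionality.
  split; intros K; [eapply rst_trans; [apply rst_sym, H|exact K]|eapply rst_trans; eassumption].
Qed.

Lemma pred_ext (A : Type) (p q : A -> Prop) : (forall x, p x <-> q x) -> p = q.
Proof.
  intros H. apply functional_extensionality. intros z. apply propositional_extensionality, H.
Qed.

Section Collage.
Context {D E : vdc} (P : vdf D E).
Let AD := vaxioms D.
Let TD := vdc_axioms_typing AD.
Let AE := vaxioms E.

Definition pairs : Type := (tarr D * tarr D)%type.
Definition stacks : Type := (cell D * tarr D * list (cell D))%type.
Definition none (A : Type) : A -> Prop := fun _ => False.
Definition class_t : pairs -> pairs -> Prop := clos_refl_sym_trans _ (step_t P).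
Definition class_c : stacks -> stacks -> Prop := clos_refl_sym_trans _ (step_c P).

(* Objects, arrows and multicells of [D] placed on the levels 0, 1, 2: vertical ones
   within a level, arbitrary ones from level 0 to 1 or from 1 to 2, and from level 0 to
   level 2 only composites labelled by a class of decompositions. *)
Record qtarr := QT { qi : nat; qj : nat; qa : tarr D; qlab : pairs -> Prop }.
Record qcell := QC { ci : nat; cj : nat; ca : cell D; clab : stacks -> Prop }.

(** The three clauses of the label correspond to the middle level: 1, where a new pair is formed; 0,
    where [s] is vertical and joins the first member; 2, where [t] is vertical and joins the second.
    Taking the class of the result makes the label independent of the representative. *)
Definition qtcomp (s t : qtarr) : qtarr := QT (qi s) (qj t) (tcomp (qa s) (qa t)) (fun r =>
  (qi s = 0 /\ qj s = 1 /\ qj t = 2 /\ class_t (qa s, qa t) r) \/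
  (exists x z, qlab t (x, z) /\ class_t (tcomp (qa s) x, z) r) \/
  (exists x z, qlab s (x, z) /\ class_t (x, tcomp z (qa t)) r)).

Definition qleft (c : qcell) : qtarr := QT (ci c) (cj c) (cleft (ca c))
  (fun r => exists a f bs, clab c (a, f, bs) /\ class_t (f, cleft a) r).
Definition qright (c : qcell) : qtarr := QT (ci c) (cj c) (cright (ca c))
  (fun r => exists a f bs, clab c (a, f, bs) /\ class_t (vrow_end D f bs, cright a) r).

(** The row may be empty, so its levels are read from its leftmost tight arrow [f]. In the last
    clause [a] sits within level 2, hence is vertical and unary, and the row is a single labelled
    multicell. *)
Definition qccomp (a : qcell) (f : qtarr) (bs : list qcell) : qcell :=
  QC (qi f) (cj a) (ccomp (ca a) (qa f) (map ca bs)) (fun r =>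
  (qi f = 0 /\ qj f = 1 /\ cj a = 2 /\ class_c (ca a, qa f, map ca bs) r) \/
  (exists c h ds, clab a (c, h, ds) /\
     class_c (c, tcomp (qa f) h, vrow_comp D (qa f) ds (map ca bs)) r) \/
  (exists b c h ds, bs = [b] /\ clab b (c, h, ds) /\
     class_c (ccomp (ca a) (cleft c) [c], h, ds) r)).

Definition collage_data : vdc_data := {|
  ob := nat * ob D; tarr := qtarr; larr := nat * larr D; cell := qcell;
  tdom := fun t => (qi t, tdom (qa t)); tcod := fun t => (qj t, tcod (qa t));
  tid := fun x => QT (fst x) (fst x) (tid (snd x)) (@none _); tcomp := qtcomp;
  lsrc := fun u => (fst u, lsrc (snd u)); ltgt := fun u => (fst u, ltgt (snd u));
  csrc := fun c => map (pair (ci c)) (csrc (ca c)); ctgt := fun c => (cj c, ctgt (ca c));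
  cleft := qleft; cright := qright;
  cid := fun u => QC (fst u) (fst u) (cid (snd u)) (@none _); ccomp := qccomp |}.

Definition pair_in (a : tarr D) (p : pairs) : Prop := pair_of a (fst p) (snd p).
Definition stack_in (a : cell D) (p : stacks) : Prop :=
  stack_of a (fst (fst p)) (snd (fst p)) (snd p).

Inductive okqt : qtarr -> Prop :=
| okqt_vert i a : i <= 2 -> vert_t P a -> okqt (QT i i a (@none _))
| okqt_step i a : i <= 1 -> okqt (QT i (S i) a (@none _))
| okqt_comp a p : pair_in a p -> okqt (QT 0 2 a (class_t p)).

Inductive okqc : qcell -> Prop :=
| okqc_vert i a : i <= 2 -> vert_c P a -> okqc (QC i i a (@none _))
| okqc_step i a : i <= 1 -> okqc (QC i (S i) a (@none _))
| okqc_comp a p : stack_in a p -> okqc (QC 0 2 a (class_c p)).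

Definition okqo (x : nat * ob D) : Prop := fst x <= 2.
Definition okql (u : nat * larr D) : Prop := fst u <= 2.

Lemma step_t_ends p q : step_t P p q ->
  tdom (fst p) = tdom (fst q) /\ tcod (snd p) = tcod (snd q).
Proof.
  intros (x & m & z & H1 & H2 & _ & -> & ->). simpl.
  rewrite (ax_tcomp_dom AD), (ax_tcomp_cod AD) by assumption. auto.
Qed.

Lemma class_t_pair p q a : class_t p q -> pair_in a p <-> pair_in a q.
Proof.
  intros H. induction H as [p q H|p|p q _ IH|p q r _ IH _ IH']; try tauto.
  destruct p as [x z], q as [x' z']. apply step_t_inv in H.
  destruct H as ((H1 & H2) & H3 & _). unfold pair_in, pair_of; simpl. rewrite H3. tauto.
Qed.

Lemma class_t_pre s p q : class_t p q -> tcod s = tdom (fst p) ->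
  class_t (tcomp s (fst p), snd p) (tcomp s (fst q), snd q).
Proof.
  apply (crst_map_if (h := fun p => (tcomp s (fst p), snd p))
    (I := fun p => tcod s = tdom (fst p))).
  - intros x y H. destruct (step_t_ends H) as [H1 _]. rewrite H1. tauto.
  - intros x y (w & m & z & H1 & H2 & Hm & -> & ->) H. simpl in *.
    exists (tcomp s w), m, z. rewrite (ax_tcomp_cod AD) by assumption.
    rewrite (ax_tcomp_assoc AD) by assumption. auto.
Qed.

Lemma class_t_post t p q : class_t p q -> tcod (snd p) = tdom t ->
  class_t (fst p, tcomp (snd p) t) (fst q, tcomp (snd q) t).
Proof.
  apply (crst_map_if (h := fun p => (fst p, tcomp (snd p) t))
    (I := fun p => tcod (snd p) = tdom t)).
  - intros x y H. destruct (step_t_ends H) as [_ H1]. rewrite H1. tauto.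
  - intros x y (w & m & z & H1 & H2 & Hm & -> & ->) H. simpl in *.
    rewrite (ax_tcomp_cod AD) in H by assumption.
    exists w, m, (tcomp z t). rewrite (ax_tcomp_dom AD) by assumption.
    rewrite (ax_tcomp_assoc AD) by assumption. auto.
Qed.

Lemma class_c_stack p q a : class_c p q -> stack_in a p <-> stack_in a q.
Proof.
  intros H. induction H as [p q H|p|p q _ IH|p q r _ IH _ IH']; try tauto.
  destruct p as [[x y] z], q as [[x' y'] z']. apply step_c_inv in H.
  destruct H as ((H1 & H2) & H3 & _). unfold stack_in, stack_of; simpl. rewrite H3. tauto.
Qed.

Lemma class_c_above g cs p q : class_c p q -> stack D (snd (fst p)) (snd p) g cs ->
  class_c (fst (fst p), tcomp g (snd (fst p)), vrow_comp D g (snd p) cs)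
    (fst (fst q), tcomp g (snd (fst q)), vrow_comp D g (snd q) cs).
Proof.
  apply (crst_map_if
    (h := fun p => (fst (fst p), tcomp g (snd (fst p)), vrow_comp D g (snd p) cs))
    (I := fun p => stack D (snd (fst p)) (snd p) g cs)).
  - intros x y (c & m & ss & f & bs & H1 & H2 & _ & _ & -> & ->). simpl.
    pose proof (stack_row_ok TD H2) as R. pose proof (stack_row_src TD H2) as Sr.
    unfold stack. rewrite Sr, (ax_tcomp_dom AD) by apply H2.
    destruct H2 as (_ & H2 & _). tauto.
  - intros x y (c & m & ss & f & bs & H1 & H2 & Hm & Hs & -> & ->) H. simpl in *.
    exists c, m, ss, (tcomp g f), (vrow_comp D g bs cs).
    split; [exact H1|split; [|split; [exact Hm|split; [exact Hs|split; [reflexivity|]]]]].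
    + split; [apply H2|split; [apply (stack_row_ok TD H)|split]].
      * rewrite (stack_row_tgt TD H). apply H2.
      * rewrite (ax_tcomp_cod AD) by apply H. apply H2.
    + rewrite (vrow_comp_assoc AD H2 H), (ax_tcomp_assoc AD); [reflexivity|apply H|apply H2].
Qed.

Lemma class_c_below v p q : class_c p q ->
  composable D v (cleft (fst (fst p))) [fst (fst p)] ->
  class_c (ccomp v (cleft (fst (fst p))) [fst (fst p)], snd (fst p), snd p)
    (ccomp v (cleft (fst (fst q))) [fst (fst q)], snd (fst q), snd q).
Proof.
  apply (crst_map_if
    (h := fun p => (ccomp v (cleft (fst (fst p))) [fst (fst p)], snd (fst p), snd p))
    (I := fun p => composable D v (cleft (fst (fst p))) [fst (fst p)])).
  - intros x y (c & m & ss & f & bs & H1 & H2 & _ & _ & -> & ->). simpl.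
    unfold composable, vrow_ok. simpl.
    rewrite (ax_comp_tgt AD H1), (ax_comp_left AD H1), (ax_tcomp_cod AD) by apply H1. tauto.
  - intros x y (c & m & ss & f & bs & H1 & H2 & Hm & Hs & -> & ->) H. simpl in *.
    assert (Hc : composable D v (cleft c) [c]).
    { destruct H as (_ & K1 & K2). simpl in K1.
      rewrite (ax_comp_tgt AD H1) in K1.
      rewrite (ax_comp_left AD H1), (ax_tcomp_cod AD) in K2 by apply H1.
      apply composable_single; assumption. }
    pose proof (stack_single H1) as S1.
    assert (K : composable D (ccomp v (cleft c) [c]) m ss)
      by (apply (composable_stack TD _ _ Hc), S1).
    exists (ccomp v (cleft c) [c]), m, ss, f, bs.
    split; [exact K|]. split; [exact H2|split; [exact Hm|split; [exact Hs|split; [|reflexivity]]]].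
    rewrite (ax_comp_assoc AD Hc K), (vrow_comp_single H1), (ax_comp_left AD H1). reflexivity.
Qed.

Lemma class_c_left p q : class_c p q ->
  class_t (snd (fst p), cleft (fst (fst p))) (snd (fst q), cleft (fst (fst q))).
Proof.
  apply (crst_map (h := fun p => (snd (fst p), cleft (fst (fst p))))).
  intros x y (c & m & ss & f & bs & H1 & H2 & Hm & Hs & -> & ->). simpl.
  exists f, m, (cleft c). rewrite (ax_comp_left AD H1).
  split; [apply H2|split; [apply H1|auto]].
Qed.

Lemma vert_row_end ss : Forall (vert_c P) ss -> forall m, vert_t P m ->
  vert_t P (vrow_end D m ss).
Proof.
  unfold vrow_end. induction 1 as [|s ss H _ IH]; simpl; intros m Hm; [exact Hm|].
  apply IH. unfold vert_t. rewrite <- f_tdom, <- f_cright, H, (ax_cid_right AE), (ax_tid_dom AE).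
  reflexivity.
Qed.

Lemma class_c_right p q : class_c p q ->
  class_t (vrow_end D (snd (fst p)) (snd p), cright (fst (fst p)))
    (vrow_end D (snd (fst q)) (snd q), cright (fst (fst q))).
Proof.
  apply (crst_map (h := fun p => (vrow_end D (snd (fst p)) (snd p), cright (fst (fst p))))).
  intros x y (c & m & ss & f & bs & H1 & H2 & Hm & Hs & -> & ->). simpl.
  exists (vrow_end D f bs), (vrow_end D m ss), (cright c). rewrite (ax_comp_right AD H1).
  rewrite (stack_row_end TD H2).
  split; [apply (stack_end TD H2)|split; [apply (composable_end TD H1)|]].
  split; [apply vert_row_end; assumption|auto].
Qed.

(** Labels are empty except from level 0 to level 2, and two classes with a common member are equal.
    Each law of the collage thus amounts to exhibiting one shared representative. *)
Lemma qtarr_eq t t' : okqt t -> okqt t' -> qi t = qi t' -> qj t = qj t' -> qa t = qa t' ->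
  (qi t = 0 -> qj t = 2 -> exists r, qlab t r /\ qlab t' r) -> t = t'.
Proof.
  destruct 1 as [i a Hi Ha|i a Hi|a p Hp]; destruct 1 as [i' a' Hi' Ha'|i' a' Hi'|a' p' Hp'];
    simpl; intros E1 E2 E3 H; subst; try lia; try reflexivity.
  destruct (H eq_refl eq_refl) as (r & H1 & H2). f_equal.
  apply crst_class_eq. eapply rst_trans; [exact H1|apply rst_sym, H2].
Qed.

Lemma qcell_eq t t' : okqc t -> okqc t' -> ci t = ci t' -> cj t = cj t' -> ca t = ca t' ->
  (ci t = 0 -> cj t = 2 -> exists r, clab t r /\ clab t' r) -> t = t'.
Proof.
  destruct 1 as [i a Hi Ha|i a Hi|a p Hp]; destruct 1 as [i' a' Hi' Ha'|i' a' Hi'|a' p' Hp'];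
    simpl; intros E1 E2 E3 H; subst; try lia; try reflexivity.
  destruct (H eq_refl eq_refl) as (r & H1 & H2). f_equal.
  apply crst_class_eq. eapply rst_trans; [exact H1|apply rst_sym, H2].
Qed.

Lemma qlab_pair t x z : okqt t -> qlab t (x, z) -> pair_of (qa t) x z.
Proof.
  destruct 1 as [i a Hi Ha|i a Hi|a p Hp]; simpl; try (intros []; fail).
  intros H. apply (class_t_pair _ H) in Hp. exact Hp.
Qed.

Lemma clab_stack t c f bs : okqc t -> clab t (c, f, bs) -> stack_of (ca t) c f bs.
Proof.
  destruct 1 as [i a Hi Ha|i a Hi|a p Hp]; simpl; try (intros []; fail).
  intros H. apply (class_c_stack _ H) in Hp. exact Hp.
Qed.

Lemma qlab_inhabited t : okqt t -> qi t = 0 -> qj t = 2 -> exists x z, qlab t (x, z).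
Proof.
  destruct 1 as [i a Hi Ha|i a Hi|a [x z] Hp]; simpl; intros; try lia.
  exists x, z. apply rst_refl.
Qed.

Lemma clab_inhabited t : okqc t -> ci t = 0 -> cj t = 2 -> exists c f bs, clab t (c, f, bs).
Proof.
  destruct 1 as [i a Hi Ha|i a Hi|a [[c f] bs] Hp]; simpl; intros; try lia.
  exists c, f, bs. apply rst_refl.
Qed.

Lemma vert_t_tcomp s t : tcod s = tdom t -> vert_t P s -> vert_t P t -> vert_t P (tcomp s t).
Proof.
  intros H Hs Ht. unfold vert_t. rewrite (ax_tcomp_dom AD), f_tcomp by assumption.
  rewrite Ht, <- H, <- f_tcod, (ax_tcomp_idr AE). exact Hs.
Qed.

Lemma okqt_tcomp s t : okqt s -> okqt t -> (qj s, tcod (qa s)) = (qi t, tdom (qa t)) ->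
  okqt (qtcomp s t).
Proof.
  intros Hs Ht H. injection H as Hl H.
  (* In each case at most one clause of the label can hold; rewriting it as [none] or as one class
     brings the composite into the form of a constructor of [okqt]. *)
  assert (Hlab : forall l, (forall r, qlab (qtcomp s t) r <-> l r) ->
    qtcomp s t = QT (qi s) (qj t) (tcomp (qa s) (qa t)) l).
  { intros l K. unfold qtcomp. f_equal. apply pred_ext, K. }
  destruct Hs as [i a Hi Ha|i a Hi|a p Hp]; destruct Ht as [i' a' Hi' Ha'|i' a' Hi'|a' p' Hp'];
    simpl in Hl, H, Hlab; subst; try lia.
  - rewrite (Hlab (@none _)); [apply okqt_vert; [lia|apply vert_t_tcomp; assumption]|].
    intros r; split; [|intros []]. intros [K|[(? & ? & [] & _)|(? & ? & [] & _)]]; lia.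
  - rewrite (Hlab (@none _)); [apply okqt_step; lia|].
    intros r; split; [|intros []]. intros [K|[(? & ? & [] & _)|(? & ? & [] & _)]]; lia.
  - rewrite (Hlab (class_t (tcomp a (fst p'), snd p'))).
    + apply okqt_comp. destruct Hp' as [K ->].
      rewrite (ax_tcomp_dom AD) in H by assumption.
      split; simpl; [rewrite (ax_tcomp_cod AD); assumption|].
      symmetry. apply (ax_tcomp_assoc AD); assumption.
    + destruct Hp' as [K ->]. rewrite (ax_tcomp_dom AD) in H by assumption.
      intros r; split.
      * intros [K1|[(x & z & K1 & K2)|(x & z & [] & _)]]; [lia|].
        eapply rst_trans; [apply (class_t_pre K1 H)|exact K2].
      * intros K1. right; left. exists (fst p'), (snd p'). split; [|exact K1].
        rewrite <- surjective_pairing. apply rst_refl.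
  - rewrite (Hlab (@none _)); [apply okqt_step; lia|].
    intros r; split; [|intros []]. intros [K|[(? & ? & [] & _)|(? & ? & [] & _)]]; lia.
  - assert (i = 0) by lia. subst i.
    rewrite (Hlab (class_t (a, a'))).
    + apply okqt_comp. split; [exact H|reflexivity].
    + intros r; split; [|auto 6].
      intros [K|[(? & ? & [] & _)|(? & ? & [] & _)]]. apply K.
  - rewrite (Hlab (class_t (fst p, tcomp (snd p) a'))).
    + apply okqt_comp. destruct Hp as [K ->].
      rewrite (ax_tcomp_cod AD) in H by assumption.
      split; simpl; [rewrite (ax_tcomp_dom AD); assumption|].
      apply (ax_tcomp_assoc AD); assumption.
    + destruct Hp as [K ->]. rewrite (ax_tcomp_cod AD) in H by assumption.
      intros r; split.
      * intros [K1|[(x & z & [] & _)|(x & z & K1 & K2)]]; [lia|].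
        eapply rst_trans; [apply (class_t_post K1 H)|exact K2].
      * intros K1. right; right. exists (fst p), (snd p). split; [|exact K1].
        rewrite <- surjective_pairing. apply rst_refl.
Qed.

Lemma q_row_levels f bs : row_ok qleft qright f bs ->
  Forall (fun b => ci b = qi f /\ cj b = qj f) bs /\
  qi (row_end qright f bs) = qi f /\ qj (row_end qright f bs) = qj f.
Proof.
  revert f; induction bs as [|b bs IH]; simpl; intros f H; [auto|].
  destruct H as [<- H]. destruct (IH _ H) as (H1 & H2 & H3). simpl in *. auto.
Qed.

Lemma q_row_under f bs : row_ok qleft qright f bs -> vrow_ok D (qa f) (map ca bs).
Proof.
  unfold vrow_ok. revert f; induction bs as [|b bs IH]; simpl; intros f H; [exact I|].
  destruct H as [<- H]. split; [reflexivity|apply (IH _ H)].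
Qed.

Lemma q_row_end f bs : qa (row_end qright f bs) = vrow_end D (qa f) (map ca bs).
Proof.
  unfold vrow_end. revert f; induction bs as [|b bs IH]; simpl; intros f; [reflexivity|apply IH].
Qed.

Lemma q_composable a f bs : composable collage_data a f bs ->
  composable D (ca a) (qa f) (map ca bs) /\ qj f = ci a /\
  Forall (fun b => ci b = qi f /\ cj b = qj f) bs.
Proof.
  intros (H1 & H2 & H3). injection H3 as H3 H4. split; [|split].
  - split; [apply q_row_under, H1|split; [|exact H4]].
    apply (f_equal (map snd)) in H2. rewrite map_map in H2. simpl in H2.
    rewrite map_map in H2. simpl in H2. rewrite map_id in H2. rewrite map_map. exact H2.
  - exact H3.
  - apply (q_row_levels H1).
Qed.

Lemma q_stack f bs g cs : stack collage_data f bs g cs ->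
  stack D (qa f) (map ca bs) (qa g) (map ca cs).
Proof.
  intros (H1 & H2 & H3 & H4). injection H4 as _ H4.
  split; [apply q_row_under, H1|split; [apply q_row_under, H2|split; [|exact H4]]].
  apply (f_equal (map snd)) in H3. rewrite map_map in H3. simpl in H3.
  rewrite concat_map, !map_map in H3. simpl in H3.
  rewrite !map_map, H3. f_equal. apply map_ext. intros c. rewrite map_map. apply map_id.
Qed.

Lemma q_row_comp bs : forall g cs,
  map ca (vrow_comp collage_data g bs cs) = vrow_comp D (qa g) (map ca bs) (map ca cs).
Proof.
  unfold vrow_comp. induction bs as [|b bs IH]; intros g cs; simpl; [reflexivity|].
  rewrite length_map, IH, !firstn_map, !skipn_map. f_equal. f_equal.
  exact (q_row_end g (firstn (length (csrc (ca b))) cs)).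
Qed.

Lemma clab_none c : okqc c -> ~ (ci c = 0 /\ cj c = 2) -> clab c = @none _.
Proof. destruct 1; simpl; try reflexivity. tauto. Qed.

Lemma vert_c_ccomp x f b : composable D x f [b] -> vert_c P x -> vert_c P b ->
  vert_c P (ccomp x f [b]) /\ fcell P (ccomp x f [b]) = fcell P b.
Proof.
  intros H Hx Hb. pose proof (vmap_composable (vmap_of_vdf P) H) as K. simpl in K.
  assert (X : fcell P (ccomp x f [b]) = fcell P b).
  { rewrite (f_ccomp P H). simpl. rewrite Hx in K |- *. apply (ax_comp_idl AE _ K). }
  split; [|exact X]. unfold vert_c. rewrite X. exact Hb.
Qed.

Lemma qccomp_eta a f bs l : (forall r, clab (qccomp a f bs) r <-> l r) ->
  qccomp a f bs = QC (qi f) (cj a) (ccomp (ca a) (qa f) (map ca bs)) l.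
Proof. intros H. unfold qccomp. f_equal. apply pred_ext, H. Qed.

Lemma vert_unary_row i x f bs : vert_c P x ->
  composable collage_data (QC i i x (@none _)) f bs -> exists b, bs = [b] /\ qleft b = f.
Proof.
  intros Hx H. destruct (q_composable H) as (H1 & _ & _).
  pose proof (composable_length H1) as L. simpl in L.
  rewrite (vert_c_unary Hx), length_map in L.
  destruct bs as [|b [|]]; try discriminate. exists b. split; [reflexivity|apply H].
Qed.

Lemma composable_lower x f c h ds : composable D c h ds -> composable D x f [ccomp c h ds] ->
  composable D x (cleft c) [c].
Proof.
  intros Hp ([K0 _] & K1 & K2). simpl in K1.
  rewrite (ax_comp_tgt AD Hp) in K1. rewrite <- K0, (ax_comp_left AD Hp) in K2.
  rewrite (ax_tcomp_cod AD) in K2 by apply Hp. apply composable_single; assumption.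
Qed.

Lemma okqc_ccomp a f bs : okqc a -> okqt f -> Forall okqc bs ->
  composable collage_data a f bs -> okqc (qccomp a f bs).
Proof.
  intros Ha Hf Hb C. destruct (q_composable C) as (C1 & Cl & Lv).
  (* All cells of a row share the levels of [f], so the last clause of the label is void unless [f]
     goes from level 0 to level 2. *)
  assert (L3 : ~ (qi f = 0 /\ qj f = 2) -> forall b c h ds, bs = [b] -> ~ clab b (c, h, ds)).
  { intros Hn b c h ds ->. apply Forall_inv in Lv. apply Forall_inv in Hb.
    rewrite (clab_none Hb); [intros []|]. destruct Lv as [-> ->]. exact Hn. }
  destruct Ha as [i x Hi Hx|i x Hi|x p Hp].
  - destruct (vert_unary_row Hx C) as (b & -> & <-).
    apply Forall_inv in Hb. clear Hf L3 Lv. simpl in C1, Cl.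
    destruct Hb as [j b Hj Hb|j b Hj|b p Hp]; simpl in Cl, C1; subst i.
    + rewrite (qccomp_eta (l := @none _)).
      * apply okqc_vert; [exact Hi|]. apply (vert_c_ccomp C1 Hx Hb).
      * simpl. intros r; split; [|intros []].
        intros [K|[(? & ? & ? & [] & _)|(b0 & c' & h' & ds' & Eb & K1 & K2)]]; [lia|].
        injection Eb as <-. exact K1.
    + rewrite (qccomp_eta (l := @none _)).
      * apply okqc_step. exact Hj.
      * simpl. intros r; split; [|intros []].
        intros [K|[(? & ? & ? & [] & _)|(b0 & c' & h' & ds' & Eb & K1 & K2)]]; [lia|].
        injection Eb as <-. exact K1.
    + destruct p as [[c h] ds]. destruct Hp as [Hp E0]. simpl in Hp, E0.
      assert (Cc : composable D x (cleft c) [c]).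
      { apply (composable_lower Hp (f := cleft b)). rewrite E0 in C1 |- *. exact C1. }
      rewrite (qccomp_eta (l := class_c (ccomp x (cleft c) [c], h, ds))).
      * apply okqc_comp. pose proof (stack_single Hp) as S1.
        assert (K : composable D (ccomp x (cleft c) [c]) h ds)
          by (apply (composable_stack TD _ _ Cc), S1).
        split; [exact K|]. simpl.
        rewrite (ax_comp_assoc AD Cc K), (vrow_comp_single Hp), E0, (ax_comp_left AD Hp).
        reflexivity.
      * simpl. intros r; split.
        -- intros [K|[(? & ? & ? & [] & _)|(b0 & c' & h' & ds' & Eb & K1 & K2)]]; [lia|].
           injection Eb as <-. simpl in K1.
           eapply rst_trans; [apply (class_c_below (p := (c, h, ds)) (v := x) K1 Cc)|exact K2].
        -- intros K. right; right. do 4 eexists. split; [reflexivity|].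
           split; [apply rst_refl|exact K].
  - destruct Hf as [j y Hj Hy|j y Hj|y q Hq]; simpl in Cl, C1, Lv; subst; try lia.
    + rewrite (qccomp_eta (l := @none _)).
      * apply okqc_step. exact Hi.
      * simpl. intros r; split; [|intros []].
        intros [K|[(? & ? & ? & [] & _)|(b0 & c' & h' & ds' & Eb & K1 & K2)]]; [lia|].
        apply (L3 ltac:(simpl; lia) _ _ _ _ Eb K1).
    + assert (j = 0) by lia. subst j.
      rewrite (qccomp_eta (l := class_c (x, y, map ca bs))).
      * apply okqc_comp. split; [exact C1|reflexivity].
      * simpl. intros r; split.
        -- intros [K|[(? & ? & ? & [] & _)|(b0 & c' & h' & ds' & Eb & K1 & K2)]]; [apply K|].
           destruct (L3 ltac:(simpl; lia) _ _ _ _ Eb K1).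
        -- intros K. left. auto.
  - destruct Hf as [j y Hj Hy|j y Hj|y q Hq]; simpl in Cl, C1, Lv; subst; try lia.
    destruct p as [[c h] ds]. destruct Hp as [Hp E0]. simpl in Hp, E0. subst x.
    pose proof (proj1 (composable_stack TD _ _ Hp) C1) as S.
    rewrite (qccomp_eta (l := class_c (c, tcomp y h, vrow_comp D y ds (map ca bs)))).
    + apply okqc_comp. split; [apply (composable_comp TD Hp S)|].
      apply (ax_comp_assoc AD Hp C1).
    + simpl. intros r; split.
      * intros [K|[(c' & h' & ds' & K1 & K2)|(b0 & c' & h' & ds' & Eb & K1 & K2)]]; [lia| |].
        -- eapply rst_trans; [apply (class_c_above (p := (c, h, ds)) K1 S)|exact K2].
        -- destruct (L3 ltac:(simpl; lia) _ _ _ _ Eb K1).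
      * intros K. right; left. exists c, h, ds. split; [apply rst_refl|exact K].
Qed.

Lemma vert_c_ends c : vert_c P c -> vert_t P (cleft c) /\ vert_t P (cright c).
Proof.
  intros H. unfold vert_t.
  rewrite <- f_cleft, <- f_cright, <- !f_tdom, <- f_cleft, <- f_cright, H.
  rewrite (ax_cid_left AE), (ax_cid_right AE), !(ax_tid_dom AE). auto.
Qed.

Lemma okqt_left c : okqc c -> okqt (qleft c).
Proof.
  destruct 1 as [i x Hi Hx|i x Hi|x [[a f] bs] [Hp E0]]; unfold qleft; simpl.
  - match goal with |- okqt (QT _ _ _ ?l) => replace l with (@none pairs) end;
      [apply okqt_vert; [exact Hi|apply (vert_c_ends Hx)]|]. symmetry. apply pred_ext.
    intros r; split; [intros (? & ? & ? & [] & _)|intros []].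
  - match goal with |- okqt (QT _ _ _ ?l) => replace l with (@none pairs) end;
      [apply okqt_step; exact Hi|]. symmetry. apply pred_ext.
    intros r; split; [intros (? & ? & ? & [] & _)|intros []].
  - simpl in *.
    match goal with |- okqt (QT _ _ _ ?l) => replace l with (class_t (f, cleft a)) end;
      [|symmetry; apply pred_ext].
    + apply okqt_comp. subst x. split; simpl; [apply Hp|apply (ax_comp_left AD Hp)].
    + intros r; split.
      * intros (c & h & ds & K1 & K2). eapply rst_trans; [apply (class_c_left K1)|exact K2].
      * intros K. exists a, f, bs. split; [apply rst_refl|exact K].
Qed.

Lemma okqt_right c : okqc c -> okqt (qright c).
Proof.
  destruct 1 as [i x Hi Hx|i x Hi|x [[a f] bs] [Hp E0]]; unfold qright; simpl.
  - match goal with |- okqt (QT _ _ _ ?l) => replace l with (@none pairs) end;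
      [apply okqt_vert; [exact Hi|apply (vert_c_ends Hx)]|]. symmetry. apply pred_ext.
    intros r; split; [intros (? & ? & ? & [] & _)|intros []].
  - match goal with |- okqt (QT _ _ _ ?l) => replace l with (@none pairs) end;
      [apply okqt_step; exact Hi|]. symmetry. apply pred_ext.
    intros r; split; [intros (? & ? & ? & [] & _)|intros []].
  - simpl in *.
    match goal with |- okqt (QT _ _ _ ?l) => replace l with (class_t (vrow_end D f bs, cright a)) end;
      [|symmetry; apply pred_ext].
    + apply okqt_comp. subst x.
      split; simpl; [apply (composable_end TD Hp)|apply (ax_comp_right AD Hp)].
    + intros r; split.
      * intros (c & h & ds & K1 & K2). eapply rst_trans; [apply (class_c_right K1)|exact K2].
      * intros K. exists a, f, bs. split; [apply rst_refl|exact K].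
Qed.

Lemma okqt_levels t : okqt t -> qi t <= 2 /\ qj t <= 2 /\ qi t <= qj t.
Proof. destruct 1; simpl; lia. Qed.

Lemma okqc_levels t : okqc t -> ci t <= 2 /\ cj t <= 2 /\ ci t <= cj t.
Proof. destruct 1; simpl; lia. Qed.

Lemma okqt_tid x : okqo x -> okqt (tid (v := collage_data) x).
Proof. intros H. apply okqt_vert; [exact H|apply vert_t_tid]. Qed.

Lemma okqc_cid u : okql u -> okqc (cid (v := collage_data) u).
Proof. intros H. apply okqc_vert; [exact H|apply vert_c_cid]. Qed.

(* The three ways in which a composite can reach from level 0 to level 2. *)
Lemma three_levels i j k : i <= j -> j <= k -> i = 0 -> k = 2 ->
  (i = 0 /\ j = 1 /\ k = 2) \/ (i = 0 /\ j = 0 /\ k = 2) \/ (i = 0 /\ j = 2 /\ k = 2).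
Proof. lia. Qed.

Lemma qleft_comp a f bs : okqc a -> okqt f -> Forall okqc bs -> composable collage_data a f bs ->
  qleft (qccomp a f bs) = qtcomp f (qleft a).
Proof.
  intros Ha Hf Hb C. destruct (q_composable C) as (C1 & Cl & Lv).
  apply qtarr_eq; try reflexivity.
  - apply okqt_left, okqc_ccomp; assumption.
  - apply okqt_tcomp; [exact Hf|apply okqt_left, Ha|apply C].
  - apply (ax_comp_left AD C1).
  - simpl. intros K1 K2.
    destruct (okqt_levels Hf) as (_ & _ & G1). destruct (okqc_levels Ha) as (_ & _ & G2).
    rewrite <- Cl in G2.
    destruct (three_levels G1 G2 K1 K2) as [(_ & L & _)|[(_ & L & _)|(_ & L & _)]].
    + exists (qa f, cleft (ca a)). split.
      * exists (ca a), (qa f), (map ca bs). split; [|apply rst_refl]. left.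
        repeat split; try assumption. apply rst_refl.
      * left. repeat split; try assumption. apply rst_refl.
    + destruct (clab_inhabited Ha) as (c & h & ds & Hc); [congruence|exact K2|].
      exists (tcomp (qa f) h, cleft c). split.
      * do 3 eexists. split; [|apply rst_refl]. right; left. exists c, h, ds.
        split; [exact Hc|apply rst_refl].
      * right; left. exists h, (cleft c). split; [|apply rst_refl].
        exists c, h, ds. split; [exact Hc|apply rst_refl].
    + destruct Ha as [i x Hi Hx|i x Hi|x p Hp]; simpl in Cl, K2; try lia.
      destruct (vert_unary_row Hx C) as (b & -> & <-). apply Forall_inv in Hb.
      destruct (clab_inhabited Hb) as (c & h & ds & Hc); [exact K1|exact L|].
      pose proof (clab_stack Hb Hc) as [Hs E0].
      simpl in *. assert (Cc : composable D x (cleft c) [c]).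
      { apply (composable_lower Hs (f := cleft (ca b))). rewrite <- E0. exact C1. }
      exists (h, cleft (ccomp x (cleft c) [c])). split.
      * do 3 eexists. split; [|apply rst_refl]. right; right. exists b, c, h, ds.
        split; [reflexivity|]. split; [exact Hc|apply rst_refl].
      * right; right. exists h, (cleft c). split.
        -- exists c, h, ds. split; [exact Hc|apply rst_refl].
        -- rewrite (ax_comp_left AD Cc). apply rst_refl.
Qed.

Lemma qright_comp a f bs : okqc a -> okqt f -> Forall okqc bs -> composable collage_data a f bs ->
  okqt (row_end qright f bs) ->
  (qj (row_end qright f bs), tcod (qa (row_end qright f bs))) = (ci a, tdom (cright (ca a))) ->
  qright (qccomp a f bs) = qtcomp (row_end qright f bs) (qright a).
Proof.
  intros Ha Hf Hb C He Hd. destruct (q_composable C) as (C1 & Cl & Lv).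
  destruct (q_row_levels (proj1 C)) as (_ & Ei & Ej).
  apply qtarr_eq; simpl.
  - apply okqt_right, okqc_ccomp; assumption.
  - apply okqt_tcomp; [exact He|apply okqt_right, Ha|exact Hd].
  - symmetry; exact Ei.
  - reflexivity.
  - rewrite q_row_end. apply (ax_comp_right AD C1).
  - intros K1 K2.
    destruct (okqt_levels Hf) as (_ & _ & G1). destruct (okqc_levels Ha) as (_ & _ & G2).
    rewrite <- Cl in G2.
    destruct (three_levels G1 G2 K1 K2) as [(_ & L & _)|[(_ & L & _)|(_ & L & _)]].
    + exists (vrow_end D (qa f) (map ca bs), cright (ca a)). split.
      * exists (ca a), (qa f), (map ca bs). split; [|apply rst_refl]. left.
        repeat split; try assumption. apply rst_refl.
      * left. rewrite Ei, Ej, q_row_end. repeat split; try assumption. apply rst_refl.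
    + destruct (clab_inhabited Ha) as (c & h & ds & Hc); [congruence|exact K2|].
      pose proof (clab_stack Ha Hc) as [Hs E0].
      rewrite E0 in C1. pose proof (proj1 (composable_stack TD _ _ Hs) C1) as S.
      exists (tcomp (vrow_end D (qa f) (map ca bs)) (vrow_end D h ds), cright c). split.
      * do 3 eexists. split; [right; left; exists c, h, ds; split; [exact Hc|apply rst_refl]|].
        rewrite (stack_row_end TD S). apply rst_refl.
      * right; left. exists (vrow_end D h ds), (cright c).
        split; [|rewrite q_row_end; apply rst_refl].
        exists c, h, ds. split; [exact Hc|apply rst_refl].
    + destruct Ha as [i x Hi Hx|i x Hi|x p Hp]; simpl in Cl, K2; try lia.
      destruct (vert_unary_row Hx C) as (b & -> & <-). apply Forall_inv in Hb.
      destruct (clab_inhabited Hb) as (c & h & ds & Hc); [exact K1|exact L|].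
      pose proof (clab_stack Hb Hc) as [Hs E0].
      simpl in *. assert (Cc : composable D x (cleft c) [c]).
      { apply (composable_lower Hs (f := cleft (ca b))). rewrite <- E0. exact C1. }
      exists (vrow_end D h ds, cright (ccomp x (cleft c) [c])). split.
      * do 3 eexists. split; [|apply rst_refl]. right; right. exists b, c, h, ds.
        split; [reflexivity|]. split; [exact Hc|apply rst_refl].
      * right; right. exists (vrow_end D h ds), (cright c). split.
        -- exists c, h, ds. split; [exact Hc|apply rst_refl].
        -- rewrite (ax_comp_right AD Cc). apply rst_refl.
Qed.

Lemma okqt_row_end bs : Forall okqc bs -> forall f, okqt f -> okqt (row_end qright f bs).
Proof.
  induction 1 as [|b bs Hb _ IH]; simpl; intros f Hf; [exact Hf|]. apply IH, okqt_right, Hb.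
Qed.

Lemma qtcomp_assoc f g h : okqt f -> okqt g -> okqt h ->
  (qj f, tcod (qa f)) = (qi g, tdom (qa g)) -> (qj g, tcod (qa g)) = (qi h, tdom (qa h)) ->
  qtcomp (qtcomp f g) h = qtcomp f (qtcomp g h).
Proof.
  intros Hf Hg Hh H1 H2.
  pose proof (okqt_tcomp Hf Hg H1) as Hfg. pose proof (okqt_tcomp Hg Hh H2) as Hgh.
  injection H1 as L1 T1. injection H2 as L2 T2.
  apply qtarr_eq; try reflexivity.
  - apply okqt_tcomp; [exact Hfg|exact Hh|]. simpl. rewrite (ax_tcomp_cod AD) by exact T1. congruence.
  - apply okqt_tcomp; [exact Hf|exact Hgh|]. simpl. rewrite (ax_tcomp_dom AD) by exact T2. congruence.
  - apply (ax_tcomp_assoc AD); assumption.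
  - cbn [qi qj qtcomp]. intros K1 K2.
    destruct (okqt_levels Hf) as (_ & _ & G1). destruct (okqt_levels Hg) as (_ & _ & G2).
    destruct (okqt_levels Hh) as (_ & _ & G3). rewrite <- L1 in G2. rewrite <- L2 in G3.
    (* Levels never decrease, which leaves six cases for the two middle levels. *)
    destruct (qj f) as [|[|[|]]] eqn:Ef; try lia;
    destruct (qj g) as [|[|[|]]] eqn:Eg; try lia.
    + destruct (qlab_inhabited Hh) as (x & z & Hx); [congruence|congruence|].
      pose proof (qlab_pair Hh Hx) as [Tx Ex].
      exists (tcomp (tcomp (qa f) (qa g)) x, z). split.
      * right; left. exists x, z. split; [exact Hx|apply rst_refl].
      * right; left. exists (tcomp (qa g) x), z. split.
        -- right; left. exists x, z. split; [exact Hx|apply rst_refl].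
        -- rewrite (ax_tcomp_assoc AD); [apply rst_refl|exact T1|].
           rewrite T2, Ex. apply (ax_tcomp_dom AD), Tx.
    + exists (tcomp (qa f) (qa g), qa h). split.
      * left. simpl. rewrite Eg. repeat split; try assumption. apply rst_refl.
      * right; left. exists (qa g), (qa h). split; [|apply rst_refl].
        left. repeat split; try assumption; try congruence. apply rst_refl.
    + destruct (qlab_inhabited Hg) as (x & z & Hx); [congruence|congruence|].
      exists (tcomp (qa f) x, tcomp z (qa h)). split.
      * right; right. exists (tcomp (qa f) x), z. split; [|apply rst_refl].
        right; left. exists x, z. split; [exact Hx|apply rst_refl].
      * right; left. exists x, (tcomp z (qa h)). split; [|apply rst_refl].
        right; right. exists x, z. split; [exact Hx|apply rst_refl].
    + exists (tcomp (qa f) (qa g), qa h). split.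
      * left. simpl. rewrite Eg. repeat split; try assumption. apply rst_refl.
      * left. split; [exact K1|split; [exact Ef|split; [exact K2|]]].
        (* Here [g] stays within level 1, so it is vertical. The bracketings give two distinct
           pairs, related by exactly one [step_t]. *)
        apply rst_step. exists (qa f), (qa g), (qa h).
        split; [exact T1|split; [exact T2|split; [|split; reflexivity]]].
        destruct Hg; simpl in *; try lia. assumption.
    + exists (qa f, tcomp (qa g) (qa h)). split.
      * right; right. exists (qa f), (qa g). split; [|apply rst_refl].
        left. repeat split; try assumption. apply rst_refl.
      * left. repeat split; try assumption. apply rst_refl.
    + destruct (qlab_inhabited Hf) as (x & z & Hx); [congruence|congruence|].
      pose proof (qlab_pair Hf Hx) as [Tx Ex].
      exists (x, tcomp (tcomp z (qa g)) (qa h)). split.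
      * right; right. exists x, (tcomp z (qa g)). split; [|apply rst_refl].
        right; right. exists x, z. split; [exact Hx|apply rst_refl].
      * right; right. exists x, z. split; [exact Hx|].
        simpl. rewrite (ax_tcomp_assoc AD); [apply rst_refl| |exact T2].
        rewrite <- T1, Ex. symmetry. apply (ax_tcomp_cod AD), Tx.
Qed.

Lemma collage_sub_typing : sub_typing (V := collage_data) okqo okqt okql okqc.
Proof.
  split; simpl.
  - intros f H. apply (okqt_levels H).
  - intros f H. apply (okqt_levels H).
  - apply okqt_tid.
  - intros f g Hf Hg H. apply okqt_tcomp; assumption.
  - auto.
  - auto.
  - intros c H. apply Forall_forall. intros u Hu. apply in_map_iff in Hu.
    destruct Hu as (v & <- & _). apply (okqc_levels H).
  - intros c H. apply (okqc_levels H).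
  - apply okqt_left.
  - apply okqt_right.
  - apply okqc_cid.
  - apply okqc_ccomp.
  - intros [i x] _; simpl. rewrite (ax_tid_dom AD); reflexivity.
  - intros [i x] _; simpl. rewrite (ax_tid_cod AD); reflexivity.
  - intros f g _ _ H; injection H as _ H. rewrite (ax_tcomp_dom AD) by exact H. reflexivity.
  - intros f g _ _ H; injection H as _ H. rewrite (ax_tcomp_cod AD) by exact H. reflexivity.
  - intros f Hf. assert (Ht : okqt (tid (v := collage_data) (qi f, tdom (qa f))))
      by apply okqt_tid, (okqt_levels Hf).
    apply qtarr_eq; try reflexivity; simpl.
    + apply (okqt_tcomp Ht Hf). simpl. rewrite (ax_tid_cod AD). reflexivity.
    + exact Hf.
    + apply (ax_tcomp_idl AD).
    + intros K1 K2. destruct (qlab_inhabited Hf K1 K2) as (x & z & Hx).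
      pose proof (qlab_pair Hf Hx) as [Tx Ex].
      exists (x, z). split; [|exact Hx]. right; left. exists x, z. split; [exact Hx|].
      rewrite Ex, (ax_tcomp_dom AD), (ax_tcomp_idl AD) by exact Tx. apply rst_refl.
  - intros f Hf. assert (Ht : okqt (tid (v := collage_data) (qj f, tcod (qa f))))
      by apply okqt_tid, (okqt_levels Hf).
    apply qtarr_eq; try reflexivity; simpl.
    + apply (okqt_tcomp Hf Ht). simpl. rewrite (ax_tid_dom AD). reflexivity.
    + exact Hf.
    + apply (ax_tcomp_idr AD).
    + intros K1 K2. destruct (qlab_inhabited Hf K1 K2) as (x & z & Hx).
      pose proof (qlab_pair Hf Hx) as [Tx Ex].
      exists (x, z). split; [|exact Hx]. right; right. exists x, z. split; [exact Hx|].
      rewrite Ex, (ax_tcomp_cod AD), (ax_tcomp_idr AD) by exact Tx. apply rst_refl.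
  - apply qtcomp_assoc.
  - intros c _. pose proof (ax_cell_path AD (ca c)) as H. revert H.
    generalize (tdom (cleft (ca c))) (tdom (cright (ca c))). intros x y.
    revert x. induction (csrc (ca c)) as [|u p IH]; simpl; intros x H; [congruence|].
    destruct H as [<- H]. split; [reflexivity|apply IH, H].
  - intros c _. rewrite (ax_cell_tgt_src AD). reflexivity.
  - intros c _. rewrite (ax_cell_tgt_tgt AD). reflexivity.
  - intros [i u] _; simpl. rewrite (ax_cid_src AD). reflexivity.
  - intros [i u] _; simpl. rewrite (ax_cid_tgt AD). reflexivity.
  - intros [i u] _. unfold qleft; simpl. rewrite (ax_cid_left AD). f_equal.
    apply pred_ext. intros r; split; [intros (? & ? & ? & [] & _)|intros []].
  - intros [i u] _. unfold qright; simpl. rewrite (ax_cid_right AD). f_equal.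
    apply pred_ext. intros r; split; [intros (? & ? & ? & [] & _)|intros []].
  - intros a f bs Ha Hf Hb C. destruct (q_composable C) as (C1 & _ & Lv).
    rewrite (ax_comp_src AD C1). clear - Lv.
    induction Lv as [|b bs [H1 _] _ IH]; simpl; [reflexivity|].
    rewrite map_app, IH, H1. reflexivity.
  - intros a f bs Ha Hf Hb C. destruct (q_composable C) as (C1 & _ & _).
    rewrite (ax_comp_tgt AD C1). reflexivity.
  - apply qleft_comp.
  - intros a f bs Ha Hf Hb C. destruct (q_composable C) as (C1 & Cl & _).
    apply qright_comp; try assumption; [apply okqt_row_end; assumption|].
    rewrite q_row_end, (composable_end TD C1). destruct (q_row_levels (proj1 C)) as (_ & _ & ->).
    rewrite Cl. reflexivity.
Qed.

Lemma collage_sub_laws : sub_laws (V := collage_data) okqt okqc.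
Proof.
  split.
  - intros b C (G1 & G2 & _). destruct (q_composable C) as (C1 & Cl & _). simpl in C1.
    apply qcell_eq; try assumption; try reflexivity.
    + apply (ax_comp_idl AD _ C1).
    + intros K1 K2. simpl in K1, K2.
      destruct (clab_inhabited G2 K1 K2) as (c & h & ds & Hc).
      pose proof (clab_stack G2 Hc) as [Hs E0].
      exists (c, h, ds). split; [|exact Hc]. right; right. exists b, c, h, ds.
      split; [reflexivity|split; [exact Hc|]]. simpl.
      rewrite E0, (ax_comp_tgt AD Hs), (ax_comp_idl AD) by apply (composable_idl TD).
      apply rst_refl.
  - intros a C (G1 & G2 & _). destruct (q_composable C) as (C1 & Cl & _). simpl in C1.
    assert (Ei : map ca (map (@cid collage_data) (map (pair (ci a)) (csrc (ca a)))) =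
      map (@cid D) (csrc (ca a))).
    { rewrite !map_map. reflexivity. }
    apply qcell_eq; try assumption; try reflexivity.
    + etransitivity; [|apply (ax_comp_idr AD)]. exact (f_equal (ccomp (ca a) _) Ei).
    + intros K1 K2. simpl in K1, K2.
      destruct (clab_inhabited G2 K1 K2) as (c & h & ds & Hc).
      pose proof (clab_stack G2 Hc) as [Hs E0].
      exists (c, h, ds). split; [|exact Hc]. right; left. exists c, h, ds.
      split; [exact Hc|]. refine (eq_ind_r (fun l => class_c (_, _, vrow_comp D _ _ l) _) _ Ei).
      simpl.
      rewrite E0, (ax_comp_left AD Hs), (ax_comp_src AD Hs), (ax_tcomp_dom AD) by apply Hs.
      rewrite (ax_tcomp_idl AD), (vrow_comp_idr AD) by apply Hs. apply rst_refl.
  - intros a f bs g cs Ha Hf Hb Hg Hc C1 S C2 C3 Hab Hbc (G1 & G2 & _).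
    destruct (q_composable C1) as (D1 & Cl1 & Lv1).
    destruct (q_composable C2) as (D2 & Cl2 & Lv2).
    pose proof (q_stack S) as DS.
    apply qcell_eq; try assumption; try reflexivity.
    + simpl. rewrite q_row_comp. apply (ax_comp_assoc AD D1 D2).
    + cbn [ci cj ccomp collage_data qccomp tcomp qtcomp qi]. intros K1 K2.
      destruct (okqt_levels Hg) as (_ & _ & L1). destruct (okqt_levels Hf) as (_ & _ & L2).
      destruct (okqc_levels Ha) as (_ & _ & L3). simpl in Cl2.
      rewrite <- Cl2 in L2. rewrite <- Cl1 in L3.
      destruct (qj g) as [|[|[|]]] eqn:Eg; try lia;
      destruct (qj f) as [|[|[|]]] eqn:Ef; try lia.
      * destruct (clab_inhabited Ha) as (c & h & ds & Hd); [congruence|congruence|].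
        pose proof (clab_stack Ha Hd) as [Hs E0]. rewrite E0 in D1.
        pose proof (proj1 (composable_stack TD _ _ Hs) D1) as S1.
        exists (c, tcomp (qa g) (tcomp (qa f) h),
          vrow_comp D (qa g) (vrow_comp D (qa f) ds (map ca bs)) (map ca cs)). split.
        -- right; left. do 3 eexists. split; [|apply rst_refl].
           right; left. exists c, h, ds. split; [exact Hd|apply rst_refl].
        -- right; left. exists c, h, ds. split; [exact Hd|].
           rewrite q_row_comp. simpl. rewrite (vrow_comp_assoc AD S1 DS).
           rewrite (ax_tcomp_assoc AD); [apply rst_refl|apply DS|apply S1].
      * exists (ca a, tcomp (qa g) (qa f), vrow_comp D (qa g) (map ca bs) (map ca cs)). split.
        -- right; left. exists (ca a), (qa f), (map ca bs). split; [|apply rst_refl].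
           left. repeat split; try assumption; try congruence. apply rst_refl.
        -- left. rewrite q_row_comp. simpl. repeat split; try assumption. apply rst_refl.
      * destruct Ha as [i x Hi Hx|i x Hi|x p Hp]; simpl in Cl1, K2; try lia.
        destruct (vert_unary_row Hx C1) as (b & -> & <-). apply Forall_inv in Hb.
        destruct (clab_inhabited Hb) as (c & h & ds & Hd); [simpl in *; congruence|exact Ef|].
        exists (ccomp x (cleft c) [c], tcomp (qa g) h, vrow_comp D (qa g) ds (map ca cs)). split.
        -- right; left. do 3 eexists. split; [|apply rst_refl].
           right; right. exists b, c, h, ds. split; [reflexivity|]. split; [exact Hd|apply rst_refl].
        -- assert (Cb : composable collage_data b g cs).
           { split; [apply S|]. pose proof (proj1 (proj2 (proj2 S))) as Sb. simpl in Sb.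
             rewrite app_nil_r in Sb. split; [exact Sb|apply S]. }
           right; right. exists (qccomp b g cs), c, (tcomp (qa g) h),
             (vrow_comp D (qa g) ds (map ca cs)).
           split; [apply (vrow_comp_single (V := collage_data) Cb)|split; [|apply rst_refl]].
           right; left. exists c, h, ds. split; [exact Hd|apply rst_refl].
      * exists (ca (qccomp a f bs), qa g, map ca cs). split.
        -- left. split; [exact K1|split; [exact Eg|split; [exact K2|apply rst_refl]]].
        -- left. split; [exact K1|split; [exact Ef|split; [exact K2|]]].
           (* The row [(f, bs)] lies within level 1 and is therefore vertical: the two bracketings
              differ by one [step_c]. In the other five cases a common representative is found
              without a move. *)
           rewrite q_row_comp. apply rst_sym, rst_step.
           exists (ca a), (qa f), (map ca bs), (qa g), (map ca cs).
           split; [exact D1|split; [exact DS|]].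
           split; [destruct Hf; simpl in *; try lia; assumption|].
           split; [|split; reflexivity].
           apply Forall_forall. intros y Hy. apply in_map_iff in Hy. destruct Hy as (b & <- & Hy).
           rewrite Forall_forall in Hb, Lv1. specialize (Hb _ Hy). specialize (Lv1 _ Hy).
           destruct Hb; simpl in *; try lia; assumption.
      * destruct Ha as [i x Hi Hx|i x Hi|x p Hp]; simpl in Cl1, K2; try lia.
        destruct (vert_unary_row Hx C1) as (b & -> & <-).
        assert (Cb : composable collage_data b g cs).
        { split; [apply S|]. pose proof (proj1 (proj2 (proj2 S))) as Sb. simpl in Sb.
          rewrite app_nil_r in Sb. split; [exact Sb|apply S]. }
        exists (ccomp x (cleft (ca b)) [ca b], qa g, map ca cs). split.
        -- left. split; [exact K1|split; [exact Eg|split; [exact K2|apply rst_refl]]].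
        -- right; right. exists (qccomp b g cs), (ca b), (qa g), (map ca cs).
           split; [apply (vrow_comp_single (V := collage_data) Cb)|split; [|apply rst_refl]].
           left. split; [exact K1|split; [exact Eg|split; [exact Ef|apply rst_refl]]].
      * destruct Ha as [i x Hi Hx|i x Hi|x p Hp]; simpl in Cl1, K2; try lia.
        destruct (vert_unary_row Hx C1) as (b & -> & <-).
        assert (Cb : composable collage_data b g cs).
        { split; [apply S|]. pose proof (proj1 (proj2 (proj2 S))) as Sb. simpl in Sb.
          rewrite app_nil_r in Sb. split; [exact Sb|apply S]. }
        apply Forall_inv in Hb.
        destruct Hb as [l y Hl Hy|l y Hl|y p Hp]; simpl in Cl2, Ef; try lia.
        destruct (vert_unary_row Hy Cb) as (c & -> & <-). apply Forall_inv in Hc.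
        destruct (clab_inhabited Hc K1 Eg) as (c' & h & ds & Hd).
        pose proof (clab_stack Hc Hd) as [Hs E0].
        destruct (q_composable Cb) as (D3 & _ & _). simpl in D1, D2, D3.
        rewrite E0 in D3, D2.
        pose proof (composable_lower Hs D3) as D4.
        assert (D5 : composable D (ccomp x (cleft y) [y]) (cleft c') [c']).
        { apply (composable_stack TD _ _ D1). apply stack_single, D4. }
        exists (ccomp (ccomp x (cleft y) [y]) (cleft c') [c'], h, ds). split.
        -- right; right. exists c, c', h, ds.
           split; [reflexivity|split; [exact Hd|apply rst_refl]].
        -- right; right.
           exists (qccomp (QC l l y (@none _)) (qleft c) [c]), (ccomp y (cleft c') [c']), h, ds.
           split; [apply (vrow_comp_single (V := collage_data) Cb)|split].
           ++ right; right. exists c, c', h, ds.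
              split; [reflexivity|split; [exact Hd|apply rst_refl]].
           ++ simpl. rewrite (ax_comp_assoc AD D1 D5), (vrow_comp_single D4).
              rewrite (ax_comp_left AD D4). apply rst_refl.
Qed.

Definition collage : vdc := sub_vdc collage_sub_typing collage_sub_laws.

End Collage.

(** * Functors into and between collages *)

Section CollageFunctors.
Context {D E : vdc} (P : vdf D E).
Let AD := vaxioms D.

Definition collage_proj : vdf (collage P) D.
Proof.
  refine (@Vdf (collage P) D (fun x => snd (proj1_sig x)) (fun t => qa (proj1_sig t))
    (fun u => snd (proj1_sig u)) (fun c => ca (proj1_sig c)) _ _ _ _ _ _ _ _ _ _ _ _);
    try reflexivity.
  - intros f g H. exact (f_equal (@qa _) (sub_tcomp_val (ST := collage_sub_typing P) H)).
  - intros c. symmetry.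
    etransitivity; [symmetry; apply (map_map (@proj1_sig _ _) snd)|].
    etransitivity; [apply f_equal; apply list_sig_val|]. simpl. rewrite map_map. apply map_id.
  - intros a f bs H.
    etransitivity; [exact (f_equal (@ca _) (sub_comp_val (ST := collage_sub_typing P) H))|].
    simpl. rewrite map_map. reflexivity.
Defined.

Section Lift.
Context (A : vdc) (F : vdf A D) (lo : ob A -> nat)
  (lo_le : forall x, lo x <= 2)
  (lo_l : forall u : larr A, lo (ltgt u) = lo (lsrc u))
  (lo_t : forall t : tarr A, (lo (tcod t) = lo (tdom t) /\ vert_t P (ftarr F t)) \/
    lo (tcod t) = S (lo (tdom t)))
  (lo_c : forall c : cell A, lo (tcod (cleft c)) = lo (tdom (cleft c)) -> vert_c P (fcell F c)).
Let AA := vaxioms A.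

Definition lift_t (t : tarr A) : qtarr := QT (lo (tdom t)) (lo (tcod t)) (ftarr F t) (@none (pairs (D := D))).
Definition lift_c (c : cell A) : qcell :=
  QC (lo (tdom (cleft c))) (lo (tcod (cleft c))) (fcell F c) (@none (stacks (D := D))).

Lemma lift_path x p y : lpath_ok (@lsrc A) (@ltgt A) x p y ->
  lo x = lo y /\ Forall (fun u => lo (lsrc u) = lo x) p.
Proof.
  revert x; induction p as [|u p IH]; simpl; intros x H; [subst; auto|].
  destruct H as [<- H]. destruct (IH _ H) as [H1 H2]. rewrite lo_l in H1, H2. auto.
Qed.

(** A tight arrow raises the level by at most one, so no composite in [A] leads from level 0 to
    level 2 and all labels can stay empty. *)
Definition lift_vmap : vmap A (collage_data P).
Proof.
  refine (@VMap A (collage_data P) (fun x => (lo x, fob F x)) lift_t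
    (fun u => (lo (lsrc u), flarr F u)) lift_c _ _ _ _ _ _ _ _ _ _ _ _); simpl.
  - intros t. rewrite f_tdom. reflexivity.
  - intros t. rewrite f_tcod. reflexivity.
  - intros x. unfold lift_t. rewrite (ax_tid_dom AA), (ax_tid_cod AA), f_tid. reflexivity.
  - intros f g H. unfold lift_t, qtcomp; simpl.
    rewrite (ax_tcomp_dom AA), (ax_tcomp_cod AA), f_tcomp by exact H. f_equal.
    apply pred_ext. intros r; split; [intros []|].
    intros [(K1 & K2 & K3 & _)|[(? & ? & [] & _)|(? & ? & [] & _)]].
    pose proof (lo_t (tcomp f g)) as K.
    rewrite (ax_tcomp_dom AA), (ax_tcomp_cod AA) in K by exact H. lia.
  - intros u. rewrite f_lsrc. reflexivity.
  - intros u. rewrite f_ltgt, lo_l. reflexivity.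
  - intros c. rewrite f_csrc, !map_map. apply map_ext_in. intros u Hu.
    destruct (lift_path (ax_cell_path AA c)) as [_ H]. rewrite Forall_forall in H.
    rewrite (H _ Hu). reflexivity.
  - intros c. rewrite f_ctgt, (ax_cell_tgt_src AA). reflexivity.
  - intros c. unfold qleft, lift_t; simpl. rewrite f_cleft. f_equal.
    apply pred_ext. intros r; split; [intros (? & ? & ? & [] & _)|intros []].
  - intros c. unfold qright, lift_t; simpl. rewrite f_cright.
    destruct (lift_path (ax_cell_path AA c)) as [<- _].
    rewrite <- (ax_cell_tgt_tgt AA), lo_l, (ax_cell_tgt_src AA). f_equal.
    apply pred_ext. intros r; split; [intros (? & ? & ? & [] & _)|intros []].
  - intros u. unfold lift_c. rewrite f_cid, (ax_cid_left AA), (ax_tid_dom AA), (ax_tid_cod AA).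
    reflexivity.
  - intros a f bs H. unfold lift_c, qccomp; simpl.
    rewrite (f_ccomp F H), (ax_comp_left AA H), map_map.
    rewrite (ax_tcomp_dom AA), (ax_tcomp_cod AA) by apply H. f_equal.
    apply pred_ext. intros r; split; [intros []|].
    intros [(K1 & K2 & K3 & _)|[(? & ? & ? & [] & _)|(b & ? & ? & ? & Eb & K1 & _)]].
    + pose proof (lo_t (cleft (ccomp a f bs))) as K.
      rewrite (ax_comp_left AA H), (ax_tcomp_dom AA), (ax_tcomp_cod AA) in K by apply H. lia.
    + destruct bs as [|b' [|]]; try discriminate. injection Eb as <-. exact K1.
Defined.

Lemma okqt_lift t : okqt P (lift_t t).
Proof.
  unfold lift_t. destruct (lo_t t) as [[-> H]|K].
  - apply okqt_vert; [apply lo_le|exact H].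
  - pose proof (lo_le (tcod t)) as L. rewrite K in L |- *. apply okqt_step. lia.
Qed.

Lemma okqc_lift c : okqc P (lift_c c).
Proof.
  unfold lift_c. pose proof (lo_c (c := c)) as Hc. destruct (lo_t (cleft c)) as [[K H]|K].
  - rewrite K. apply okqc_vert; [apply lo_le|exact (Hc K)].
  - pose proof (lo_le (tcod (cleft c))) as L. rewrite K in L |- *. apply okqc_step. lia.
Qed.

Definition collage_lift : vdf A (collage P) :=
  vdf_of_vmap (A := A) (B := collage P) (sub_lift (collage_sub_typing P) (F := lift_vmap)
    (fun x => lo_le x) okqt_lift (fun u => lo_le (lsrc u)) okqc_lift).

End Lift.

Let Id := vdf_id E.

(** The class generated by the images of all representatives; [class_t_map] shows that these images
    form part of a single class. *)
Definition qtmap (t : qtarr) : qtarr := QT (qi t) (qj t) (ftarr P (qa t))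
  (fun r => exists x z, qlab t (x, z) /\ class_t Id (ftarr P x, ftarr P z) r).
Definition qcmap (c : qcell) : qcell := QC (ci c) (cj c) (fcell P (ca c))
  (fun r => exists a f bs, clab c (a, f, bs) /\
     class_c Id (fcell P a, ftarr P f, map (fcell P) bs) r).

Lemma vert_t_map m : vert_t P m -> vert_t Id (ftarr P m).
Proof. intros H. unfold vert_t in *. simpl. rewrite f_tdom. exact H. Qed.

Lemma vert_c_map c : vert_c P c -> vert_c Id (fcell P c).
Proof. intros H. exact H. Qed.

Lemma class_t_map p q : class_t P p q ->
  class_t Id (ftarr P (fst p), ftarr P (snd p)) (ftarr P (fst q), ftarr P (snd q)).
Proof.
  apply (crst_map (h := fun p => (ftarr P (fst p), ftarr P (snd p)))).
  intros x y (w & m & z & H1 & H2 & Hm & -> & ->). simpl.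
  exists (ftarr P w), (ftarr P m), (ftarr P z).
  rewrite !f_tcomp, !f_tdom, !f_tcod, H1, H2 by assumption.
  repeat split. apply vert_t_map, Hm.
Qed.

Lemma class_c_map p q : class_c P p q ->
  class_c Id (fcell P (fst (fst p)), ftarr P (snd (fst p)), map (fcell P) (snd p))
    (fcell P (fst (fst q)), ftarr P (snd (fst q)), map (fcell P) (snd q)).
Proof.
  apply (crst_map (h := fun p =>
    (fcell P (fst (fst p)), ftarr P (snd (fst p)), map (fcell P) (snd p)))).
  intros x y (c & m & ss & f & bs & H1 & H2 & Hm & Hs & -> & ->). simpl.
  exists (fcell P c), (ftarr P m), (map (fcell P) ss), (ftarr P f), (map (fcell P) bs).
  split; [apply (vmap_composable (vmap_of_vdf P) H1)|].
  split; [apply (vmap_stack (vmap_of_vdf P) H2)|].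
  split; [apply vert_t_map, Hm|].
  split; [apply Forall_map; revert Hs; apply Forall_impl; apply vert_c_map|].
  rewrite (f_ccomp P H1), f_tcomp by apply H2. split; [reflexivity|]. f_equal.
  apply (vmap_row_comp (vmap_of_vdf P) (vdc_axioms_typing AD) H2).
Qed.

Lemma okqt_map t : okqt P t -> okqt Id (qtmap t).
Proof.
  destruct 1 as [i a Hi Ha|i a Hi|a [x z] [Hp E0]]; unfold qtmap; simpl in *.
  - match goal with |- okqt _ (QT _ _ _ ?l) => replace l with (@none (pairs (D := E))) end;
      [apply okqt_vert; [exact Hi|apply vert_t_map, Ha]|].
    symmetry. apply pred_ext. intros r; split; [intros (? & ? & [] & _)|intros []].
  - match goal with |- okqt _ (QT _ _ _ ?l) => replace l with (@none (pairs (D := E))) end;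
      [apply okqt_step; exact Hi|].
    symmetry. apply pred_ext. intros r; split; [intros (? & ? & [] & _)|intros []].
  - match goal with |- okqt _ (QT _ _ _ ?l) =>
      replace l with (class_t Id (ftarr P x, ftarr P z)) end.
    + apply okqt_comp. subst a. split; simpl.
      * rewrite f_tcod, f_tdom, Hp. reflexivity.
      * apply f_tcomp, Hp.
    + symmetry; apply pred_ext. intros r; split.
      * intros (x' & z' & K1 & K2). eapply rst_trans; [apply (class_t_map K1)|exact K2].
      * intros K. exists x, z. split; [apply rst_refl|exact K].
Qed.

Lemma okqc_map t : okqc P t -> okqc Id (qcmap t).
Proof.
  destruct 1 as [i a Hi Ha|i a Hi|a [[c f] bs] [Hp E0]]; unfold qcmap; simpl in *.
  - match goal with |- okqc _ (QC _ _ _ ?l) => replace l with (@none (stacks (D := E))) end;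
      [apply okqc_vert; [exact Hi|apply vert_c_map, Ha]|].
    symmetry. apply pred_ext. intros r; split; [intros (? & ? & ? & [] & _)|intros []].
  - match goal with |- okqc _ (QC _ _ _ ?l) => replace l with (@none (stacks (D := E))) end;
      [apply okqc_step; exact Hi|].
    symmetry. apply pred_ext. intros r; split; [intros (? & ? & ? & [] & _)|intros []].
  - match goal with |- okqc _ (QC _ _ _ ?l) =>
      replace l with (class_c Id (fcell P c, ftarr P f, map (fcell P) bs)) end.
    + apply okqc_comp. subst a. split; simpl.
      * apply (vmap_composable (vmap_of_vdf P) Hp).
      * apply (f_ccomp P Hp).
    + symmetry; apply pred_ext. intros r; split.
      * intros (c' & f' & bs' & K1 & K2). eapply rst_trans; [apply (class_c_map K1)|exact K2].
      * intros K. exists c, f, bs. split; [apply rst_refl|exact K].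
Qed.

Lemma qtmap_tcomp s t : okqt P s -> okqt P t ->
  (qj s, tcod (qa s)) = (qi t, tdom (qa t)) ->
  qtmap (qtcomp P s t) = qtcomp Id (qtmap s) (qtmap t).
Proof.
  intros Hs Ht H. pose proof (okqt_tcomp Hs Ht H) as Hst. injection H as L T.
  apply (qtarr_eq (P := Id)); try reflexivity.
  - apply okqt_map, Hst.
  - apply okqt_tcomp; try (apply okqt_map; assumption). simpl.
    rewrite f_tcod, f_tdom, L, T. reflexivity.
  - apply f_tcomp, T.
  - simpl. intros K1 K2.
    destruct (okqt_levels Hs) as (_ & _ & G1). destruct (okqt_levels Ht) as (_ & _ & G2).
    rewrite <- L in G2.
    destruct (three_levels G1 G2 K1 K2) as [(_ & L1 & _)|[(_ & L1 & _)|(_ & L1 & _)]].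
    + exists (ftarr P (qa s), ftarr P (qa t)). split.
      * exists (qa s), (qa t). split; [|apply rst_refl].
        left. repeat split; try assumption. apply rst_refl.
      * left. repeat split; try assumption. apply rst_refl.
    + destruct (qlab_inhabited Ht) as (x & z & Hx); [congruence|congruence|].
      pose proof (qlab_pair Ht Hx) as [Tx Ex].
      exists (tcomp (ftarr P (qa s)) (ftarr P x), ftarr P z). split.
      * exists (tcomp (qa s) x), z. split.
        -- right; left. exists x, z. split; [exact Hx|apply rst_refl].
        -- rewrite f_tcomp; [apply rst_refl|]. rewrite T, Ex. apply (ax_tcomp_dom AD), Tx.
      * right; left. exists (ftarr P x), (ftarr P z). split; [|apply rst_refl].
        exists x, z. split; [exact Hx|apply rst_refl].
    + destruct (qlab_inhabited Hs) as (x & z & Hx); [congruence|congruence|].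
      pose proof (qlab_pair Hs Hx) as [Tx Ex].
      exists (ftarr P x, tcomp (ftarr P z) (ftarr P (qa t))). split.
      * exists x, (tcomp z (qa t)). split.
        -- right; right. exists x, z. split; [exact Hx|apply rst_refl].
        -- rewrite f_tcomp; [apply rst_refl|]. rewrite <- T, Ex.
           symmetry. apply (ax_tcomp_cod AD), Tx.
      * right; right. exists (ftarr P x), (ftarr P z). split; [|apply rst_refl].
        exists x, z. split; [exact Hx|apply rst_refl].
Qed.

Lemma qtmap_left c : okqc P c -> qleft Id (qcmap c) = qtmap (qleft P c).
Proof.
  intros Hc. apply (qtarr_eq (P := Id)); try reflexivity.
  - apply okqt_left, okqc_map, Hc.
  - apply okqt_map, okqt_left, Hc.
  - apply f_cleft.
  - simpl. intros K1 K2. destruct (clab_inhabited Hc K1 K2) as (a & f & bs & H).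
    exists (ftarr P f, cleft (fcell P a)). split.
    + do 3 eexists. split; [exists a, f, bs; split; [exact H|apply rst_refl]|apply rst_refl].
    + exists f, (cleft a). split; [exists a, f, bs; split; [exact H|apply rst_refl]|].
      rewrite f_cleft. apply rst_refl.
Qed.

Lemma qtmap_right c : okqc P c -> qright Id (qcmap c) = qtmap (qright P c).
Proof.
  intros Hc. apply (qtarr_eq (P := Id)); try reflexivity.
  - apply okqt_right, okqc_map, Hc.
  - apply okqt_map, okqt_right, Hc.
  - apply f_cright.
  - simpl. intros K1 K2. destruct (clab_inhabited Hc K1 K2) as (a & f & bs & H).
    exists (vrow_end E (ftarr P f) (map (fcell P) bs), cright (fcell P a)). split.
    + do 3 eexists. split; [exists a, f, bs; split; [exact H|apply rst_refl]|apply rst_refl].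
    + exists (vrow_end D f bs), (cright a).
      split; [exists a, f, bs; split; [exact H|apply rst_refl]|].
      pose proof (vmap_row_end (vmap_of_vdf P) f bs) as V. simpl in V.
      rewrite f_cright, V. apply rst_refl.
Qed.

Lemma qcmap_composable a f bs : okqc P a -> Forall (okqc P) bs ->
  composable (collage_data P) a f bs ->
  composable (collage_data Id) (qcmap a) (qtmap f) (map qcmap bs).
Proof.
  intros Ha Hb (H1 & H2 & H3). split; [|split].
  - clear Ha H2 H3. unfold vrow_ok in *. simpl in *. revert f H1.
    induction Hb as [|b bs Hb _ IH]; simpl; intros f H; [exact I|].
    destruct H as [<- H]. split; [apply (qtmap_left Hb)|].
    rewrite (qtmap_right Hb). apply IH, H.
  - apply (f_equal (map (fun u => (fst u, flarr P (snd u))))) in H2. simpl in H2.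
    rewrite !map_map in H2. simpl in *. rewrite f_csrc, !map_map. simpl.
    rewrite <- H2. apply map_ext. intros b. rewrite f_ctgt. reflexivity.
  - injection H3 as L T. simpl. rewrite f_tcod, f_cleft, f_tdom, L, T. reflexivity.
Qed.

Lemma qcmap_ccomp a f bs : okqc P a -> okqt P f -> Forall (okqc P) bs ->
  composable (collage_data P) a f bs ->
  qcmap (qccomp P a f bs) = qccomp Id (qcmap a) (qtmap f) (map qcmap bs).
Proof.
  intros Ha Hf Hb C. pose proof (okqc_ccomp Ha Hf Hb C) as Hab.
  pose proof (qcmap_composable Ha Hb C) as C'.
  destruct (q_composable C) as (C1 & Cl & _).
  assert (Em : map (@ca E) (map qcmap bs) = map (fcell P) (map (@ca D) bs))
    by (rewrite !map_map; reflexivity).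
  apply (qcell_eq (P := Id)); try reflexivity.
  - apply okqc_map, Hab.
  - apply okqc_ccomp; [apply okqc_map, Ha|apply okqt_map, Hf| |exact C'].
    apply Forall_map. revert Hb. apply Forall_impl. apply okqc_map.
  - simpl. rewrite Em. apply (f_ccomp P C1).
  - cbn [ci cj clab qcmap qccomp qtmap qi qj qa ca]. intros K1 K2.
    destruct (okqt_levels Hf) as (_ & _ & G1). destruct (okqc_levels Ha) as (_ & _ & G2).
    rewrite <- Cl in G2.
    destruct (three_levels G1 G2 K1 K2) as [(_ & L & _)|[(_ & L & _)|(_ & L & _)]].
    + exists (fcell P (ca a), ftarr P (qa f), map (fcell P) (map (@ca D) bs)). split.
      * exists (ca a), (qa f), (map (@ca D) bs). split; [|apply rst_refl].
        left. repeat split; try assumption. apply rst_refl.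
      * left. rewrite Em. repeat split; try assumption. apply rst_refl.
    + destruct (clab_inhabited Ha) as (c & h & ds & Hc); [congruence|exact K2|].
      pose proof (clab_stack Ha Hc) as [Hs E0]. rewrite E0 in C1.
      pose proof (proj1 (composable_stack (vdc_axioms_typing AD) _ _ Hs) C1) as S.
      exists (fcell P c, tcomp (ftarr P (qa f)) (ftarr P h),
        vrow_comp E (ftarr P (qa f)) (map (fcell P) ds) (map (fcell P) (map (@ca D) bs))). split.
      * exists c, (tcomp (qa f) h), (vrow_comp D (qa f) ds (map (@ca D) bs)). split.
        -- right; left. exists c, h, ds. split; [exact Hc|apply rst_refl].
        -- pose proof (vmap_row_comp (vmap_of_vdf P) (vdc_axioms_typing AD) S) as V.
           simpl in V. rewrite V, f_tcomp by apply S. apply rst_refl.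
      * right; left. exists (fcell P c), (ftarr P h), (map (fcell P) ds).
        split; [exists c, h, ds; split; [exact Hc|apply rst_refl]|].
        rewrite Em. apply rst_refl.
    + destruct Ha as [i x Hi Hx|i x Hi|x p Hp]; simpl in Cl, K2; try lia.
      destruct (vert_unary_row Hx C) as (b & -> & <-). apply Forall_inv in Hb.
      destruct (clab_inhabited Hb) as (c & h & ds & Hc); [exact K1|exact L|].
      pose proof (clab_stack Hb Hc) as [Hs E0]. simpl in C1. rewrite E0 in C1.
      pose proof (composable_lower Hs C1) as Cc.
      exists (ccomp (fcell P x) (cleft (fcell P c)) [fcell P c], ftarr P h, map (fcell P) ds).
      split.
      * exists (ccomp x (cleft c) [c]), h, ds. split.
        -- right; right. exists b, c, h, ds.
           split; [reflexivity|split; [exact Hc|apply rst_refl]].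
        -- rewrite (f_ccomp P Cc), f_cleft. apply rst_refl.
      * right; right. exists (qcmap b), (fcell P c), (ftarr P h), (map (fcell P) ds).
        split; [reflexivity|split; [|apply rst_refl]].
        exists c, h, ds. split; [exact Hc|apply rst_refl].
Qed.

Definition collage_map_vmap : vmap (collage P) (collage_data Id).
Proof.
  refine (@VMap (collage P) (collage_data Id) (fun x => (fst (proj1_sig x), fob P (snd (proj1_sig x))))
    (fun t => qtmap (proj1_sig t)) (fun u => (fst (proj1_sig u), flarr P (snd (proj1_sig u))))
    (fun c => qcmap (proj1_sig c)) _ _ _ _ _ _ _ _ _ _ _ _).
  - intros [t Ht]; simpl. rewrite f_tdom. reflexivity.
  - intros [t Ht]; simpl. rewrite f_tcod. reflexivity.
  - intros [[i x] Hx]; unfold qtmap; simpl. rewrite f_tid. f_equal.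
    apply pred_ext. intros r; split; [intros (? & ? & [] & _)|intros []].
  - intros f g H.
    etransitivity; [exact (f_equal qtmap (sub_tcomp_val (ST := collage_sub_typing P) H))|].
    apply qtmap_tcomp; try apply proj2_sig. exact (f_equal (@proj1_sig _ _) H).
  - intros [[i x] Hx]; simpl. rewrite f_lsrc. reflexivity.
  - intros [[i x] Hx]; simpl. rewrite f_ltgt. reflexivity.
  - intros c. symmetry.
    etransitivity; [symmetry; apply (map_map (@proj1_sig _ _)
      (fun u => (fst u, flarr P (snd u))))|].
    etransitivity; [apply f_equal; apply list_sig_val|]. simpl.
    rewrite f_csrc, !map_map. reflexivity.
  - intros [c Hc]; simpl. rewrite f_ctgt. reflexivity.
  - intros [c Hc]. apply (qtmap_left Hc).
  - intros [c Hc]. apply (qtmap_right Hc).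
  - intros [[i u] Hu]; unfold qcmap; simpl. rewrite f_cid. f_equal.
    apply pred_ext. intros r; split; [intros (? & ? & ? & [] & _)|intros []].
  - intros a f bs H.
    etransitivity; [exact (f_equal qcmap (sub_comp_val (ST := collage_sub_typing P) H))|].
    pose proof (proj1 (sub_composable (ST := collage_sub_typing P) _ _ _) H) as H'.
    etransitivity; [apply (qcmap_ccomp (proj2_sig a) (proj2_sig f) (sig_list_good _) H')|].
    rewrite map_map. reflexivity.
Defined.

Definition collage_map : vdf (collage P) (collage (vdf_id E)) :=
  vdf_of_vmap (A := collage P) (B := collage (vdf_id E))
    (sub_lift (collage_sub_typing (vdf_id E)) (F := collage_map_vmap)
      (fun x => proj2_sig x) (fun t => okqt_map (proj2_sig t))
      (fun u => proj2_sig u) (fun c => okqc_map (proj2_sig c))).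

End CollageFunctors.

Section IdentityClasses.
Context {E : vdc}.

(** A move preserves the images under the functor, and here these are the members of the pair.
    Labels in [collage (vdf_id E)] therefore remember the decomposition itself. *)
Lemma class_t_id p q : class_t (vdf_id E) p q -> p = q.
Proof.
  intros H. induction H as [p q H|p|p q _ IH|p q r _ IH _ IH']; try congruence.
  destruct p as [x z], q as [x' z']. apply step_t_inv in H. simpl in H.
  destruct H as (_ & _ & -> & ->). reflexivity.
Qed.

Lemma class_c_id p q : class_c (vdf_id E) p q -> p = q.
Proof.
  intros H. induction H as [p q H|p|p q _ IH|p q r _ IH _ IH']; try congruence.
  destruct p as [[c f] bs], q as [[c' f'] bs']. apply step_c_inv in H. simpl in H.
  destruct H as (_ & _ & -> & -> & H). rewrite !map_id in H. congruence.
Qed.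

End IdentityClasses.

(** * Exponentiability implies lifting *)

Section Steps.
Context (E : vdc).
Let AE := vaxioms E.
Let TE := vdc_axioms_typing AE.

Inductive ztarr := zv (b : bool) (x : ob E) | zm (t : tarr E).
Inductive zcell := zi (b : bool) (u : larr E) | zc (c : cell E).

(* Two copies of the objects and loose arrows of [E], joined by all the tight arrows and
   multicells of [E]. *)
Definition steps_data : vdc_data := {|
  ob := bool * ob E; tarr := ztarr; larr := bool * larr E; cell := zcell;
  tdom := fun t => match t with zv b x => (b, x) | zm t => (false, tdom t) end;
  tcod := fun t => match t with zv b x => (b, x) | zm t => (true, tcod t) end;
  tid := fun x => zv (fst x) (snd x);
  tcomp := fun s t => match s with zm _ => s | zv _ _ => t end;
  lsrc := fun u => (fst u, lsrc (snd u)); ltgt := fun u => (fst u, ltgt (snd u));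
  csrc := fun c => match c with zi b u => [(b, u)] | zc c => map (pair false) (csrc c) end;
  ctgt := fun c => match c with zi b u => (b, u) | zc c => (true, ctgt c) end;
  cleft := fun c => match c with zi b u => zv b (lsrc u) | zc c => zm (cleft c) end;
  cright := fun c => match c with zi b u => zv b (ltgt u) | zc c => zm (cright c) end;
  cid := fun u => zi (fst u) (snd u);
  ccomp := fun a f bs => match a, bs with zi _ _, [b] => b | _, _ => a end |}.

(** The sources of [zc c] lie in copy [false], and only identities have their target there. *)
Lemma zc_row c f bs : composable steps_data (zc c) f bs ->
  bs = map (zi false) (csrc c) /\ f = zv false (tdom (cleft c)).
Proof.
  intros (_ & H & H1). split.
  - simpl in H. revert H. generalize (csrc c). clear.
    induction bs as [|[b u|d] bs IH]; intros [|v l] H; try discriminate.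
    + reflexivity.
    + simpl in *. injection H as -> -> H. rewrite (IH _ H). reflexivity.
  - destruct f; simpl in H1; congruence.
Qed.

Lemma zi_row b u f bs : composable steps_data (zi b u) f bs ->
  exists c, bs = [c] /\ f = cleft (v := steps_data) c /\ ctgt (v := steps_data) c = (b, u).
Proof.
  intros (H & H1 & _). destruct bs as [|c [|]]; try discriminate. exists c.
  split; [reflexivity|split; [symmetry; apply H|]]. exact (f_equal (hd (b, u)) H1).
Qed.

Lemma z_row_end p b x :
  exists b' y, row_end (@cright steps_data) (zv b x) (map (zi false) p) = zv b' y.
Proof. revert b x. induction p as [|u p IH]; simpl; intros b x; [eauto|apply IH]. Qed.

Lemma steps_axioms : vdc_axioms steps_data.
Proof.
  split.
  - intros [b x]; reflexivity.
  - intros [b x]; reflexivity.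
  - intros [b x|t] [b' x'|t']; simpl; congruence.
  - intros [b x|t] [b' x'|t']; simpl; congruence.
  - intros [b x|t]; reflexivity.
  - intros [b x|t]; reflexivity.
  - intros [b x|t] g h; reflexivity.
  - intros [b u|c]; simpl; [auto|].
    pose proof (ax_cell_path AE c) as H. revert H.
    generalize (tdom (cleft c)) (tdom (cright c)). intros x y. revert x.
    induction (csrc c) as [|u p IH]; simpl; intros x H; [congruence|].
    destruct H as [<- H]. split; [reflexivity|apply IH, H].
  - intros [b u|c]; simpl; [reflexivity|]. rewrite (ax_cell_tgt_src AE). reflexivity.
  - intros [b u|c]; simpl; [reflexivity|]. rewrite (ax_cell_tgt_tgt AE). reflexivity.
  - intros [b u]; reflexivity.
  - intros [b u]; reflexivity.
  - reflexivity.
  - reflexivity.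
  - intros [b u|c] f bs H.
    + destruct (zi_row H) as (d & -> & _). symmetry. apply app_nil_r.
    + destruct (zc_row H) as (-> & _). simpl.
      clear H. induction (csrc c) as [|u p IH]; [reflexivity|]. simpl. f_equal. exact IH.
  - intros [b u|c] f bs H; [|reflexivity].
    destruct (zi_row H) as (d & -> & _ & K). exact K.
  - intros [b u|c] f bs H.
    + destruct (zi_row H) as (d & -> & -> & K). simpl.
      destruct d as [b' v|d]; [injection K as -> ->|]; reflexivity.
    + destruct (zc_row H) as (_ & ->). reflexivity.
  - intros [b u|c] f bs H.
    + destruct (zi_row H) as (d & -> & -> & K). simpl.
      destruct d as [b' v|d]; [injection K as -> ->|]; reflexivity.
    + destruct (zc_row H) as (-> & ->). unfold vrow_end.
      destruct (z_row_end (csrc c) false (tdom (cleft c))) as (b' & y & ->). reflexivity.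
  - intros u f b _. reflexivity.
  - intros [b u|c]; reflexivity.
  - intros [b u|c] f bs g cs H H'; [|reflexivity].
    destruct (zi_row H) as (d & -> & -> & K). simpl in H' |- *.
    pose proof (composable_length H') as L. simpl in L.
    rewrite <- L, firstn_all. reflexivity.
Qed.

Definition steps : vdc := Vdc steps_axioms.

Definition steps_proj : vdf steps E.
Proof.
  refine (@Vdf steps E snd (fun t => match t with zv _ x => tid x | zm t => t end) snd
    (fun c => match c with zi _ u => cid u | zc c => c end) _ _ _ _ _ _ _ _ _ _ _ _).
  - intros [b x|t]; simpl; [apply (ax_tid_dom AE)|reflexivity].
  - intros [b x|t]; simpl; [apply (ax_tid_cod AE)|reflexivity].
  - reflexivity.
  - intros [b x|t] [b' x'|t']; simpl; intros H; injection H as H1 H2.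
    + subst. rewrite <- (ax_tid_dom AE x') at 2. rewrite (ax_tcomp_idl AE). reflexivity.
    + subst. rewrite (ax_tcomp_idl AE). reflexivity.
    + subst. rewrite (ax_tcomp_idr AE). reflexivity.
    + discriminate.
  - reflexivity.
  - reflexivity.
  - intros [b u|c]; simpl; [apply (ax_cid_src AE)|]. rewrite map_map, map_id. reflexivity.
  - intros [b u|c]; simpl; [apply (ax_cid_tgt AE)|reflexivity].
  - intros [b u|c]; simpl; [apply (ax_cid_left AE)|reflexivity].
  - intros [b u|c]; simpl; [apply (ax_cid_right AE)|reflexivity].
  - reflexivity.
  - intros [b u|c] f bs H.
    + destruct (zi_row H) as (d & -> & -> & K). simpl. symmetry.
      destruct d as [b' v|d]; simpl in *.
      * injection K as -> ->. pose proof (composable_idl TE (cid u)) as C.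
        rewrite (ax_cid_tgt AE), (ax_cid_left AE) in C. apply (ax_comp_idl AE _ C).
      * injection K as _ <-. apply (ax_comp_idl AE _ (composable_idl TE d)).
    + destruct (zc_row H) as (-> & ->). simpl. rewrite map_map. symmetry. apply (ax_comp_idr AE).
Defined.

(** Test object for the shared middle level: the copy [true] of the first step and the copy [false]
    of the second are compared along it. *)
Definition discrete_data : vdc_data := {|
  ob := ob E; tarr := ob E; larr := larr E; cell := larr E;
  tdom := fun x => x; tcod := fun x => x; tid := fun x => x; tcomp := fun x _ => x;
  lsrc := @lsrc E; ltgt := @ltgt E; csrc := fun u => [u]; ctgt := fun u => u;
  cleft := @lsrc E; cright := @ltgt E; cid := fun u => u; ccomp := fun u _ _ => u |}.

Lemma discrete_row u f bs : composable discrete_data u f bs -> bs = [u] /\ f = lsrc u.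
Proof.
  intros (H & H1 & H2). destruct bs as [|v [|]]; try discriminate.
  simpl in *. injection H1 as ->. auto.
Qed.

Lemma discrete_axioms : vdc_axioms discrete_data.
Proof.
  split; simpl; try reflexivity; auto.
  - intros u f bs H. destruct (discrete_row H) as [-> ->]. reflexivity.
  - intros u f bs H. destruct (discrete_row H) as [-> ->]. reflexivity.
  - intros u f bs H. destruct (discrete_row H) as [-> ->]. reflexivity.
  - intros u f b H. destruct (discrete_row H) as [H' _]. congruence.
Qed.

Definition discrete : vdc := Vdc discrete_axioms.

Definition discrete_incl (b : bool) : vdf discrete steps.
Proof.
  refine (@Vdf discrete steps (pair b) (zv b) (pair b) (zi b) _ _ _ _ _ _ _ _ _ _ _ _);
    try reflexivity.
  - intros f g H. simpl in *. congruence.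
  - intros u f bs H. destruct (discrete_row H) as [-> ->]. reflexivity.
Defined.

(** [s] selects the step and [b] its end, so the two steps join levels 0 and 1 and levels 1 and
    2. *)
Definition shift (s : bool) (b : bool) : nat := (if s then 1 else 0) + (if b then 1 else 0).

Lemma shift_le s b : shift s b <= 2.
Proof. unfold shift. destruct s, b; lia. Qed.

End Steps.

Section StepFunctors.
Context {D E : vdc} (P : vdf D E).
Let AE := vaxioms E.
Let j := steps_proj E.

(* Level [b] of [steps E] is placed on level [shift s b] of the collage. *)
Definition step_incl (s : bool) : vdf (steps E) (collage (vdf_id E)).
Proof.
  refine (@collage_lift E E (vdf_id E) (steps E) j (fun x => shift s (fst x)) _ _ _ _).
  - intros x. apply shift_le.
  - reflexivity.
  - intros [b x|t]; [left|right].
    + split; [reflexivity|]. unfold vert_t. simpl. rewrite (ax_tid_dom AE). reflexivity.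
    + destruct s; reflexivity.
  - intros [b u|c] H.
    + unfold vert_c. simpl. rewrite (ax_cid_tgt AE). reflexivity.
    + destruct s; discriminate H.
Defined.

(** Levels come from the copy of [E]. What stays within one copy lies over an identity, so its
    component in [D] is vertical, as the collage requires within a level. *)
Definition step_lift (s : bool) : vdf (pb_vdc j P) (collage P).
Proof.
  refine (@collage_lift D E P (pb_vdc j P) (pb_snd j P)
    (fun x => shift s (fst (fob (pb_fst j P) x))) _ _ _ _).
  - intros x. apply shift_le.
  - reflexivity.
  - intros [[[b x|t] d] H]; [left|right].
    + split; [reflexivity|]. unfold vert_t. unfold pb_t in H. simpl in *.
      rewrite <- f_tdom, <- H, (ax_tid_dom AE). reflexivity.
    + destruct s; reflexivity.
  - intros [[[b u|c] d] H] K.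
    + unfold vert_c. unfold pb_c in H. simpl in *. rewrite <- H, (ax_cid_tgt AE). reflexivity.
    + destruct s; discriminate K.
Defined.

End StepFunctors.

Lemma qlab_class (D E : vdc) (P : vdf D E) t p q :
  okqt P t -> qlab t p -> qlab t q -> class_t P p q.
Proof.
  destruct 1; [intros []|intros []|]. intros H1 H2.
  eapply rst_trans; [apply rst_sym, H1|exact H2].
Qed.

Lemma clab_class (D E : vdc) (P : vdf D E) t p q :
  okqc P t -> clab t p -> clab t q -> class_c P p q.
Proof.
  destruct 1; [intros []|intros []|]. intros H1 H2.
  eapply rst_trans; [apply rst_sym, H1|exact H2].
Qed.

(** * Evaluating composites in the exponential of the collage *)

Section Forward.
Context {D E : vdc} (P : vdf D E).

Definition couniversal (Y R : vdc) (r : vdf R E) (eps : vdf (pb_vdc r P) Y) : Prop :=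
  forall (X : vdc) (x : vdf X E) (g : vdf (pb_vdc x P) Y),
    exists h : vdf X R, transposes eps g h /\
      forall h2 : vdf X R, transposes eps g h2 -> vdf_eq h h2.

Lemma couniversal_unique (Y R : vdc) (r : vdf R E) (eps : vdf (pb_vdc r P) Y) :
  couniversal eps -> forall (X : vdc) (x : vdf X E) (g : vdf (pb_vdc x P) Y) (h h' : vdf X R),
  transposes eps g h -> transposes eps g h' -> vdf_eq h h'.
Proof.
  intros U X x g h h' H H'. destruct (U X x g) as (k & _ & K).
  destruct (K h H) as (A1 & A2 & A3 & A4). destruct (K h' H') as (B1 & B2 & B3 & B4).
  split; [|split; [|split]]; congruence.
Qed.

Section TransposeEval.
Context (Y R X : vdc) (r : vdf R E) (eps : vdf (pb_vdc r P) Y) (x : vdf X E)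
  (g : vdf (pb_vdc x P) Y) (h : vdf X R) (T : transposes eps g h).

Lemma transpose_eval_t (q : tarr (pb_vdc r P)) z (H : ftarr x z = ftarr P (ftarr (pb_snd r P) q)) :
  ftarr (pb_fst r P) q = ftarr h z -> ftarr eps q = ftarr g (pbt H).
Proof.
  destruct q as [[c d] pf]. simpl in *. intros ->. destruct T as (_ & _ & T2 & _).
  apply (T2 z d H pf).
Qed.

Lemma transpose_eval_c (q : cell (pb_vdc r P)) z (H : fcell x z = fcell P (fcell (pb_snd r P) q)) :
  fcell (pb_fst r P) q = fcell h z -> fcell eps q = fcell g (pbc H).
Proof.
  destruct q as [[c d] pf]. simpl in *. intros ->. destruct T as (_ & _ & _ & _ & T4).
  apply (T4 z d H pf).
Qed.

End TransposeEval.

Let j := steps_proj E.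
Let Q := collage P.
Let QE := collage (vdf_id E).
Let pQ : vdf Q D := collage_proj P.
Let pE : vdf QE E := collage_proj (vdf_id E).

Lemma collage_square : vdf_sq (collage_map P) pE pQ P.
Proof. split; [|split; [|split]]; reflexivity. Qed.

Let Y2 := pb_vdc pE P.
Definition collage_compare : vdf Q Y2 := pb_pair collage_square.
Let k := collage_compare.

Lemma step_incl_square s : vdf_sq (vdf_comp (pb_fst j P) (step_incl s)) pE (pb_snd j P) P.
Proof. split; [|split; [|split]]; intros a; exact (proj2_sig a). Qed.

(** [hk] is the map of exponentials induced by [collage_compare], and [s] places the whole collage
    of [E] in the second exponential as the transpose of an identity. *)
Context (R : vdc) (r : vdf R E) (eps : vdf (pb_vdc r P) Q) (U : couniversal eps)
  (R2 : vdc) (r2 : vdf R2 E) (eps2 : vdf (pb_vdc r2 P) Y2) (U2 : couniversal eps2)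
  (h0 h1 : vdf (steps E) R)
  (T0 : transposes eps (step_lift P false) h0) (T1 : transposes eps (step_lift P true) h1)
  (s : vdf QE R2) (Ts : transposes eps2 (vdf_id Y2) s)
  (hk : vdf R R2) (Tk : transposes eps2 (vdf_comp eps k) hk).

(** Both sides transpose the same map, which pairs the inclusion of step [b] with the projection to
    [D]. The labels involved are all empty, so the two evaluations agree. *)
Lemma step_compare b h : transposes eps (step_lift P b) h ->
  vdf_eq (vdf_comp h hk) (vdf_comp (step_incl b) s).
Proof.
  intros ((B1 & B2 & B3 & B4) & C1 & C2 & C3 & C4).
  pose proof Tk as ((K1 & K2 & K3 & K4) & L1 & L2 & L3 & L4).
  pose proof Ts as ((S1 & S2 & S3 & S4) & V1 & V2 & V3 & V4).
  apply (couniversal_unique U2 (x := j) (g := pb_pair (step_incl_square b))).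
  - split; [split; [|split; [|split]]; intros a;
      [exact (eq_trans (K1 _) (B1 a))|exact (eq_trans (K2 _) (B2 a))|
       exact (eq_trans (K3 _) (B3 a))|exact (eq_trans (K4 _) (B4 a))]|].
    split; [|split; [|split]]; intros c d H H'; simpl.
    + assert (H0 : fob r (fob h c) = fob P d) by (rewrite B1; exact H).
      etransitivity; [apply (L1 _ _ H0 H')|]. simpl. rewrite (C1 _ _ H H0).
      apply sig_inj, injective_projections; [|reflexivity].
      apply sig_inj. simpl. f_equal. symmetry; exact H.
    + assert (H0 : ftarr r (ftarr h c) = ftarr P d) by (rewrite B2; exact H).
      etransitivity; [apply (L2 _ _ H0 H')|]. simpl. rewrite (C2 _ _ H H0).
      apply sig_inj, injective_projections; [|reflexivity].
      apply sig_inj. simpl. unfold qtmap, lift_t. simpl. f_equal; [symmetry; exact H|].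
      apply pred_ext. intros q; split; [intros (? & ? & [] & _)|intros []].
    + assert (H0 : flarr r (flarr h c) = flarr P d) by (rewrite B3; exact H).
      etransitivity; [apply (L3 _ _ H0 H')|]. simpl. rewrite (C3 _ _ H H0).
      apply sig_inj, injective_projections; [|reflexivity].
      apply sig_inj. simpl. f_equal. symmetry; exact H.
    + assert (H0 : fcell r (fcell h c) = fcell P d) by (rewrite B4; exact H).
      etransitivity; [apply (L4 _ _ H0 H')|]. simpl. rewrite (C4 _ _ H H0).
      apply sig_inj, injective_projections; [|reflexivity].
      apply sig_inj. simpl. unfold qcmap, lift_c. simpl. f_equal; [symmetry; exact H|].
      apply pred_ext. intros q; split; [intros (? & ? & ? & [] & _)|intros []].
  - split; [split; [|split; [|split]]; intros a; [exact (S1 _)|exact (S2 _)|exact (S3 _)|exact (S4 _)]|].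
    split; [|split; [|split]]; intros c d H H'; simpl.
    + etransitivity; [apply (V1 (fob (step_incl b) c) d H H')|].
      apply sig_inj, injective_projections; reflexivity.
    + etransitivity; [apply (V2 (ftarr (step_incl b) c) d H H')|].
      apply sig_inj, injective_projections; reflexivity.
    + etransitivity; [apply (V3 (flarr (step_incl b) c) d H H')|].
      apply sig_inj, injective_projections; reflexivity.
    + etransitivity; [apply (V4 (fcell (step_incl b) c) d H H')|].
      apply sig_inj, injective_projections; reflexivity.
Qed.

Lemma discrete_square b : vdf_sq
  (vdf_comp (pb_fst (vdf_comp (discrete_incl E true) j) P) (discrete_incl E b)) j
  (pb_snd (vdf_comp (discrete_incl E true) j) P) P.
Proof. split; [|split; [|split]]; intros a; exact (proj2_sig a). Qed.

(** Restricted to the shared level, both sides transpose the inclusion of level 1 in the collage.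
    This makes an arrow or row of the first step composable with an arrow or multicell of the
    second. *)
Lemma steps_agree :
  vdf_eq (vdf_comp (discrete_incl E true) h0) (vdf_comp (discrete_incl E false) h1).
Proof.
  pose proof T0 as ((B1 & B2 & B3 & B4) & C1 & C2 & C3 & C4).
  pose proof T1 as ((B1' & B2' & B3' & B4') & C1' & C2' & C3' & C4').
  apply (couniversal_unique U (x := vdf_comp (discrete_incl E true) j)
    (g := vdf_comp (pb_pair (discrete_square true)) (step_lift P false))).
  - split; [split; [|split; [|split]]; intros a; [exact (B1 _)|exact (B2 _)|exact (B3 _)|exact (B4 _)]|].
    split; [|split; [|split]]; intros c d H H'; simpl.
    + etransitivity; [apply (C1 (true, c) d H H')|]. apply sig_inj; reflexivity.
    + etransitivity; [apply (C2 (zv true c) d H H')|]. apply sig_inj; reflexivity.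
    + etransitivity; [apply (C3 (true, c) d H H')|]. apply sig_inj; reflexivity.
    + etransitivity; [apply (C4 (zi true c) d H H')|]. apply sig_inj; reflexivity.
  - split; [split; [|split; [|split]]; intros a;
      [exact (B1' _)|exact (B2' _)|exact (B3' _)|exact (B4' _)]|].
    split; [|split; [|split]]; intros c d H H'; simpl.
    + etransitivity; [apply (C1' (false, c) d H H')|]. apply sig_inj; reflexivity.
    + etransitivity; [apply (C2' (zv false c) d H H')|]. apply sig_inj; reflexivity.
    + etransitivity; [apply (C3' (false, c) d H H')|]. apply sig_inj; reflexivity.
    + etransitivity; [apply (C4' (zi false c) d H H')|]. apply sig_inj; reflexivity.
Qed.

Lemma two_factorizations_forward : two_factorizations P.
Proof.
  intros a b1 b2 Hb Ha.
  destruct steps_agree as (G1 & _).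
  pose proof T0 as ((B1 & B2 & B3 & B4) & _). pose proof T1 as ((B1' & B2' & B3' & B4') & _).
  assert (Hc : tcod (ftarr h0 (zm b1)) = tdom (ftarr h1 (zm b2))).
  { rewrite f_tcod, f_tdom. simpl. rewrite <- Hb. apply (G1 (tcod b1)). }
  set (C := tcomp (ftarr h0 (zm b1)) (ftarr h1 (zm b2))).
  assert (rC : ftarr r C = ftarr P a).
  { unfold C. rewrite f_tcomp, B2, B2', Ha by exact Hc. reflexivity. }
  set (y := ftarr eps (pbt rC)).
  (* A factorization of [a] factors the pair of [C] and [a] in the pullback, so [eps] sends it to
     [x] from level 0 to 1 followed by [z] from level 1 to 2, whose label contains [(x, z)]. *)
  assert (K : forall x z, pair_of a x z -> ftarr P x = b1 -> ftarr P z = b2 ->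
    qlab (proj1_sig y) (x, z)).
  { intros x z [Hp Ea] Hx Hz.
    assert (Px : ftarr r (ftarr h0 (zm b1)) = ftarr P x) by (rewrite B2, Hx; reflexivity).
    assert (Pz : ftarr r (ftarr h1 (zm b2)) = ftarr P z) by (rewrite B2', Hz; reflexivity).
    assert (Hq : tcod (pbt Px) = tdom (pbt Pz)) by (apply sig_inj, injective_projections; assumption).
    assert (Ey : y = tcomp (ftarr eps (pbt Px)) (ftarr eps (pbt Pz))).
    { unfold y. rewrite <- (f_tcomp eps _ _ Hq). f_equal. apply sig_inj.
      symmetry. etransitivity; [apply (sub_tcomp_val (ST := pb_sub_typing r P) Hq)|].
      simpl. rewrite Ea. reflexivity. }
    rewrite Ey.
    assert (Hq' : tcod (ftarr eps (pbt Px)) = tdom (ftarr eps (pbt Pz)))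
      by (rewrite f_tcod, f_tdom, Hq; reflexivity).
    refine (eq_ind_r (fun t => qlab t (x, z)) _ (sub_tcomp_val (ST := collage_sub_typing P) Hq')).
    assert (Zx : ftarr j (zm b1) = ftarr P x) by (symmetry; exact Hx).
    assert (Zz : ftarr j (zm b2) = ftarr P z) by (symmetry; exact Hz).
    rewrite (transpose_eval_t T0 (q := pbt Px) (z := zm b1) Zx eq_refl).
    rewrite (transpose_eval_t T1 (q := pbt Pz) (z := zm b2) Zz eq_refl).
    left. repeat split. apply rst_refl. }
  split.
  - pose proof Tk as (_ & _ & L2 & _). pose proof Ts as ((_ & S2 & _) & _ & V2 & _).
    set (G := tcomp (ftarr (step_incl (E := E) false) (zm b1)) (ftarr (step_incl (E := E) true) (zm b2))).
    assert (Hg : tcod (ftarr (step_incl (E := E) false) (zm b1)) =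
      tdom (ftarr (step_incl (E := E) true) (zm b2))).
    { apply sig_inj. simpl. rewrite Hb. reflexivity. }
    (* Functors preserve composites, so the comparison of the two steps extends to [C] and to the
       composite [G] of the steps in the collage of [E]. *)
    assert (EG : ftarr hk C = ftarr s G).
    { unfold C, G. rewrite !f_tcomp by assumption.
      destruct (step_compare T0) as (_ & M0 & _). destruct (step_compare T1) as (_ & M1 & _).
      f_equal; [apply M0|apply M1]. }
    assert (pG : ftarr pE G = ftarr P a).
    { unfold G. rewrite f_tcomp by exact Hg. symmetry; exact Ha. }
    assert (r2C : ftarr r2 (ftarr hk C) = ftarr P a).
    { rewrite EG, S2. exact pG. }
    (* Hence [y] compares to the pair of [G] and [a]: its levels are 0 and 2, its underlying arrow
       is [a], and the image of its label is that of [G]. *)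
    assert (ky : ftarr k y = pbt pG).
    { etransitivity; [symmetry; apply (L2 _ _ rC r2C)|].
      exact (transpose_eval_t Ts (q := pbt r2C) (z := G) pG EG). }
    assert (Ky1 : qtmap P (proj1_sig y) = proj1_sig G)
      by exact (f_equal (fun q => proj1_sig (fst (proj1_sig q))) ky).
    assert (Ky2 : qa (proj1_sig y) = a) by exact (f_equal (fun q => snd (proj1_sig q)) ky).
    assert (EG' : proj1_sig G = qtcomp (vdf_id E) (proj1_sig (ftarr (step_incl (E := E) false) (zm b1)))
      (proj1_sig (ftarr (step_incl (E := E) true) (zm b2))))
      by exact (sub_tcomp_val (ST := collage_sub_typing (vdf_id E)) Hg).
    rewrite EG' in Ky1.
    destruct (qlab_inhabited (proj2_sig y)) as (x & z & Hx);
      [exact (f_equal (@qi E) Ky1)|exact (f_equal (@qj E) Ky1)|].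
    pose proof (qlab_pair (proj2_sig y) Hx) as Hp. rewrite Ky2 in Hp.
    exists x, z. split; [exact Hp|].
    assert (Hm : qlab (qtmap P (proj1_sig y)) (ftarr P x, ftarr P z)).
    { exists x, z. split; [exact Hx|apply rst_refl]. }
    (* The label of [G] is the class of [(b1, b2)], formed at middle level 1; being a singleton, it
       forces the image of [(x, z)]. *)
    assert (Hn : qlab (qtmap P (proj1_sig y)) (b1, b2)).
    { rewrite Ky1. left. repeat split. apply rst_refl. }
    pose proof (okqt_map (proj2_sig y)) as Ok.
    assert (Eq : (ftarr P x, ftarr P z) = (b1, b2)).
    { apply class_t_id, (qlab_class Ok Hm Hn). }
    injection Eq; auto.
  - intros x z x' z' H1 H2 H3 H4 H5 H6.
    apply (qlab_class (proj2_sig y)); apply K; assumption.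
Qed.

Lemma zc_row_ok f bs : vrow_ok E f bs -> vrow_ok (steps E) (zm f) (map (@zc E) bs).
Proof.
  unfold vrow_ok. revert f; induction bs as [|b bs IH]; simpl; intros f H; [exact I|].
  destruct H as [<- H]. split; [reflexivity|apply IH, H].
Qed.

(** Agreement on the shared copy is all that composability needs across the interface. The lemma
    serves both the exponential and the collage of [E]. *)
Lemma steps_composable (W : vdc) (u v : vdf (steps E) W) c f bs :
  (forall x, fob u (true, x) = fob v (false, x)) ->
  (forall x, flarr u (true, x) = flarr v (false, x)) ->
  composable E c f bs ->
  composable W (fcell v (zc c)) (ftarr u (zm f)) (map (fcell u) (map (@zc E) bs)).
Proof.
  intros G1 G3 (H1 & H2 & H3). split; [|split].
  - apply (vmap_row_ok (vmap_of_vdf u)), zc_row_ok, H1.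
  - rewrite (vmap_tgts (vmap_of_vdf u)), f_csrc. simpl.
    rewrite <- H2, !map_map. apply map_ext. intros b. apply G3.
  - rewrite f_tcod, f_cleft, f_tdom. simpl. rewrite H3. apply G1.
Qed.

Lemma pb_row_exists Bs bs : map (fcell r) Bs = map (fcell P) bs ->
  exists qs, map (fcell (pb_fst r P)) qs = Bs /\ map (fcell (pb_snd r P)) qs = bs.
Proof.
  revert bs; induction Bs as [|B Bs IH]; intros [|b bs]; simpl; try discriminate.
  - intros _. exists []; auto.
  - intros H. injection H as H1 H2. destruct (IH _ H2) as (qs & <- & <-).
    exists (pbc H1 :: qs). auto.
Qed.

Lemma eval_row qs zs : map (fcell (pb_fst r P)) qs = map (fcell h0) zs ->
  map (fun q => ca (proj1_sig (fcell eps q))) qs = map (fcell (pb_snd r P)) qs.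
Proof.
  revert zs; induction qs as [|q qs IH]; intros [|z zs] H; try discriminate; [reflexivity|].
  injection H as H1 H2. cbn [map]. f_equal; [|apply (IH _ H2)]. clear IH.
  assert (H : fcell j z = fcell P (fcell (pb_snd r P) q)).
  { destruct T0 as ((_ & _ & _ & B4) & _). etransitivity; [symmetry; apply B4|].
    rewrite <- H1. exact (proj2_sig q). }
  rewrite (transpose_eval_c T0 H H1). reflexivity.
Qed.

Lemma two_decompositions_forward : two_decompositions P.
Proof.
  intros a c f bs Hb Ha.
  destruct steps_agree as (G1 & _ & G3 & _).
  pose proof T0 as ((B1 & B2 & B3 & B4) & _). pose proof T1 as ((B1' & B2' & B3' & B4') & _).
  pose proof (steps_composable (u := h0) (v := h1) G1 G3 Hb) as Hc.
  set (C := ccomp (fcell h1 (zc c)) (ftarr h0 (zm f)) (map (fcell h0) (map (@zc E) bs))).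
  assert (rBs : map (fcell r) (map (fcell h0) (map (@zc E) bs)) = bs).
  { rewrite !map_map. rewrite <- (map_id bs) at 2. apply map_ext. intros b. apply B4. }
  assert (rC : fcell r C = fcell P a).
  { unfold C. rewrite (f_ccomp r Hc), rBs, B2, B4', Ha. reflexivity. }
  set (y := fcell eps (pbc rC)).
  assert (K : forall c' f' bs', stack_of a c' f' bs' -> fcell P c' = c -> ftarr P f' = f ->
    map (fcell P) bs' = bs -> clab (proj1_sig y) (c', f', bs')).
  { intros c' f' bs' [Hp Ea] Hc' Hf' Hbs'.
    assert (Pc : fcell r (fcell h1 (zc c)) = fcell P c') by (rewrite B4', Hc'; reflexivity).
    assert (Pf : ftarr r (ftarr h0 (zm f)) = ftarr P f') by (rewrite B2, Hf'; reflexivity).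
    destruct (pb_row_exists (eq_trans rBs (eq_sym Hbs'))) as (qs & Q1 & Q2).
    assert (Hq : composable (pb_vdc r P) (pbc Pc) (pbt Pf) qs).
    { apply pb_composable_intro; [rewrite Q1; exact Hc|rewrite Q2; exact Hp]. }
    assert (Ey : y = ccomp (fcell eps (pbc Pc)) (ftarr eps (pbt Pf)) (map (fcell eps) qs)).
    { unfold y. rewrite <- (f_ccomp eps Hq). f_equal. apply sig_inj, injective_projections.
      - symmetry. etransitivity; [apply (f_ccomp (pb_fst r P) Hq)|]. rewrite Q1. reflexivity.
      - symmetry. etransitivity; [apply (f_ccomp (pb_snd r P) Hq)|]. rewrite Q2. symmetry. exact Ea. }
    rewrite Ey.
    pose proof (vmap_composable (vmap_of_vdf eps) Hq) as Hq'.
    refine (eq_ind_r (fun t => clab t (c', f', bs')) _ (sub_comp_val (ST := collage_sub_typing P) Hq')).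
    assert (Zc : fcell j (zc c) = fcell P c') by (symmetry; exact Hc').
    assert (Zf : ftarr j (zm f) = ftarr P f') by (symmetry; exact Hf').
    simpl mtarr. simpl mcell.
    rewrite (transpose_eval_c T1 (q := pbc Pc) (z := zc c) Zc eq_refl).
    rewrite (transpose_eval_t T0 (q := pbt Pf) (z := zm f) Zf eq_refl).
    left. split; [reflexivity|split; [reflexivity|split; [reflexivity|]]].
    (* Evaluating the row of the first step returns its components in [D], so the new label is
       generated by the given decomposition. *)
    match goal with |- class_c _ (_, _, ?l) _ => assert (El : l = bs') end.
    { rewrite <- Q2. etransitivity; [|exact (eval_row Q1)]. rewrite !map_map. reflexivity. }
    rewrite El. apply rst_refl. }
  split.
  - pose proof Tk as (_ & _ & _ & _ & L4). pose proof Ts as ((_ & _ & _ & S4) & _ & _ & _ & V4).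
    set (i0 := step_incl (E := E) false). set (i1 := step_incl (E := E) true).
    assert (Hg : composable QE (fcell i1 (zc c)) (ftarr i0 (zm f)) (map (fcell i0) (map (@zc E) bs))).
    { apply steps_composable; [| |exact Hb]; intros x; apply sig_inj; reflexivity. }
    set (G := ccomp (fcell i1 (zc c)) (ftarr i0 (zm f)) (map (fcell i0) (map (@zc E) bs))).
    assert (EG : fcell hk C = fcell s G).
    { etransitivity; [exact (f_ccomp hk Hc)|]. symmetry.
      etransitivity; [exact (f_ccomp s Hg)|]. symmetry.
      destruct (step_compare T0) as (_ & M0 & _ & M0').
      destruct (step_compare T1) as (_ & _ & _ & M1).
      rewrite !map_map. f_equal; [apply M1|apply M0|]. apply map_ext. intros b. apply M0'. }
    assert (pG : fcell pE G = fcell P a).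
    { etransitivity; [exact (f_ccomp pE Hg)|]. rewrite Ha, !map_map.
      exact (f_equal (ccomp c f) (map_id bs)). }
    assert (r2C : fcell r2 (fcell hk C) = fcell P a).
    { rewrite EG, S4. exact pG. }
    assert (ky : fcell k y = pbc pG).
    { etransitivity; [symmetry; apply (L4 _ _ rC r2C)|].
      exact (transpose_eval_c Ts (q := pbc r2C) (z := G) pG EG). }
    assert (Ky1 : qcmap P (proj1_sig y) = proj1_sig G)
      by exact (f_equal (fun q => proj1_sig (fst (proj1_sig q))) ky).
    assert (Ky2 : ca (proj1_sig y) = a) by exact (f_equal (fun q => snd (proj1_sig q)) ky).
    assert (EG' : proj1_sig G = qccomp (vdf_id E) (proj1_sig (fcell i1 (zc c)))
      (proj1_sig (ftarr i0 (zm f))) (map (@proj1_sig _ _) (map (fcell i0) (map (@zc E) bs))))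
      by exact (sub_comp_val (ST := collage_sub_typing (vdf_id E)) Hg).
    rewrite EG' in Ky1.
    (* The comparison has fixed the levels of [y] as 0 and 2, and there a label always has a
       member. *)
    destruct (clab_inhabited (proj2_sig y)) as (c' & f' & bs' & Hx);
      [exact (f_equal (@ci E) Ky1)|exact (f_equal (@cj E) Ky1)|].
    pose proof (clab_stack (proj2_sig y) Hx) as Hp. rewrite Ky2 in Hp.
    exists c', f', bs'. split; [exact Hp|].
    assert (Hm : clab (qcmap P (proj1_sig y)) (fcell P c', ftarr P f', map (fcell P) bs')).
    { exists c', f', bs'. split; [exact Hx|apply rst_refl]. }
    assert (Hn : clab (qcmap P (proj1_sig y)) (c, f, bs)).
    { rewrite Ky1. left. repeat split. simpl. rewrite !map_map. simpl. rewrite map_id.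
      apply rst_refl. }
    pose proof (okqc_map (proj2_sig y)) as Ok.
    assert (Eq : (fcell P c', ftarr P f', map (fcell P) bs') = (c, f, bs)).
    { apply class_c_id, (clab_class Ok Hm Hn). }
    injection Eq; auto.
  - intros c1 f1 bs1 c2 f2 bs2 H1 H2 H3 H4 H5 H6 H7 H8.
    apply (clab_class (proj2_sig y)); apply K; assumption.
Qed.

End Forward.

Lemma two_of_concretely_exponentiable (D E : vdc) (P : vdf D E) :
  concretely_exponentiable P -> two_factorizations P /\ two_decompositions P.
Proof.
  intros CE.
  destruct (CE (collage P)) as (R & r & eps & U).
  destruct (CE (pb_vdc (collage_proj (vdf_id E)) P)) as (R2 & r2 & eps2 & U2).
  destruct (U _ _ (step_lift P false)) as (h0 & T0 & _).
  destruct (U _ _ (step_lift P true)) as (h1 & T1 & _).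
  destruct (U2 _ _ (vdf_id _)) as (s & Ts & _).
  destruct (U2 _ _ (vdf_comp eps (collage_compare P))) as (hk & Tk & _).
  split.
  - exact (two_factorizations_forward U U2 T0 T1 Ts Tk).
  - exact (two_decompositions_forward U U2 T0 T1 Ts Tk).
Qed.

Theorem theoremA7 (D E : vdc) (P : vdf D E) :
  exponentiable P <-> lifts_decompositions_ess_uniquely P.
Proof.
  split.
  - intros H. destruct (two_of_concretely_exponentiable (concrete_of_exponentiable H)).
    split; [apply lifts_factorizations_of_two|apply lifts_decompositions_of_two]; assumption.
  - intros [HT HC]. apply exponentiable_of_concrete, concretely_exponentiable_of_two.
    + apply two_factorizations_of_lifts, HT.
    + apply two_decompositions_of_lifts, HC.
Qed.
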